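(* If $A$ is a UHF $C^*$-algebra such that $A\otimes A\cong A$, then there is a universal UHF flow $\gamma$ on $A$.
   Context: A flow on a unital $C^*$-algebra is a strongly continuous one-parameter group of *-automorphisms. For flows $\alpha$ on $A$ and $\beta$ on $B$, $\alpha\otimes\beta$ is the flow $t\mapsto\alpha_t\otimes\beta_t$ on $A\otimes B$. A flow $\alpha$ on a UHF algebra $A$ is a UHF flow if there is an increasing sequence $(A_n)$ of full matrix $C^*$-subalgebras of $A$ with $1_A\in A_1$, $A=\overline{\bigcup_nA_n}$ and $\alpha_t(A_n)=A_n$ for all $n$ and $t$. Given a flow $\alpha$ on $A$, an $\alpha$-cocycle is a norm-continuous family $u=(u_t)_{t\in\mathbb R}$ of unitaries of $A$ with $u_s\alpha_s(u_t)=u_{s+t}$ for all $s,t$; the flow $t\mapsto \mathrm{Ad}\,u_t\circ\alpha_t$, where $\mathrm{Ad}\,u(x)=uxu^*$, is then called a cocycle perturbation of $\alpha$. A flow $\alpha$ on $A$ is cocycle conjugate to a flow $\beta$ on $B$ if there is an isomorphism $\varphi:A\to B$ such that $\alpha$ is a cocycle perturbation of $t\mapsto\varphi^{-1}\beta_t\varphi$. For a UHF algebra $A$ with $A\otimes A\cong A$, a UHF flow $\gamma$ on $A$ is universal if $\gamma\otimes\alpha$ is cocycle conjugate to $\gamma$ for every UHF flow $\alpha$ on $A$. *)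

(* Defs.v *)
From HB Require Import structures.
From mathcomp Require Import all_boot all_order all_algebra.
From mathcomp Require Import all_classical all_reals all_analysis.
From mathcomp Require Import complex.
Set Implicit Arguments.
Unset Strict Implicit.
Unset Printing Implicit Defensive.
Import Order.TTheory GRing.Theory Num.Theory.
Import numFieldNormedType.Exports.
Local Open Scope classical_set_scope.
Local Open Scope ring_scope.
Local Open Scope complex_scope.

(* Unital C*-algebras over the complex numbers R[i], where R is the field of
   real numbers.  The norm of a normedModType R[i] takes its values in R[i].
   The only join of a ring structure and a norm in the MathComp hierarchy is
   numDomainType, so the multiplication cannot be inherited from algType here;
   the algType structure is declared on every C*-algebra below.  The zero
   algebra is excluded. *)
HB.mixin Record isCStarAlgebra (R : realType) A
    of CompleteNormedModule R[i] A := {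
  cstar_one : A;
  cstar_mul : A -> A -> A;
  star : A -> A;
  cstar_mulA : associative cstar_mul;
  cstar_mul1r : left_id cstar_one cstar_mul;
  cstar_mulr1 : right_id cstar_one cstar_mul;
  cstar_mulDl : left_distributive cstar_mul +%R;
  cstar_mulDr : right_distributive cstar_mul +%R;
  cstar_oner_neq0 : cstar_one != 0;
  cstar_scalerAl : forall (c : R[i]) (x y : A),
    c *: cstar_mul x y = cstar_mul (c *: x) y;
  cstar_scalerAr : forall (c : R[i]) (x y : A),
    c *: cstar_mul x y = cstar_mul x (c *: y);
  starK : involutive star;
  starD : {morph star : x y / x + y};
  starZ : forall (c : R[i]) (x : A), star (c *: x) = Num.conj c *: star x;
  starM_subproof : forall x y : A,
    star (cstar_mul x y) = cstar_mul (star y) (star x);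
  cstar_normM_subproof : forall x y : A, `|cstar_mul x y| <= `|x| * `|y|;
  cstar_identity_subproof : forall x : A,
    `|cstar_mul (star x) x| = `|x| ^+ 2
}.

#[short(type="cstarAlgType")]
HB.structure Definition CStarAlgebra (R : realType) :=
  {A of CompleteNormedModule R[i] A & isCStarAlgebra R A}.

HB.instance Definition _ (R : realType) (A : cstarAlgType R) :=
  GRing.Zmodule_isNzRing.Build (CStarAlgebra.sort A)
    (@cstar_mulA R A) (@cstar_mul1r R A) (@cstar_mulr1 R A)
    (@cstar_mulDl R A) (@cstar_mulDr R A) (@cstar_oner_neq0 R A).
HB.instance Definition _ (R : realType) (A : cstarAlgType R) :=
  GRing.Lmodule_isLalgebra.Build R[i] (CStarAlgebra.sort A)
    (@cstar_scalerAl R A).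
HB.instance Definition _ (R : realType) (A : cstarAlgType R) :=
  GRing.Lalgebra_isAlgebra.Build R[i] (CStarAlgebra.sort A)
    (@cstar_scalerAr R A).

Section CStarAlgebraTheory.
Variables (R : realType) (A : cstarAlgType R).
Implicit Types x y : A.

Lemma starM x y : star (x * y) = star y * star x.
Proof. exact: starM_subproof. Qed.

Lemma cstar_normM x y : `|x * y| <= `|x| * `|y|.
Proof. exact: cstar_normM_subproof. Qed.

Lemma cstar_identity x : `|star x * x| = `|x| ^+ 2.
Proof. exact: cstar_identity_subproof. Qed.

End CStarAlgebraTheory.

Section Isomorphisms.
Variable R : realType.

(* Morphisms of unital *-algebras; continuity is automatic. *)
Definition star_morphism (A B : cstarAlgType R) (f : A -> B) : Prop :=
  [/\ linear f, monoid_morphism f & forall x, f (star x) = star (f x)].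

Definition star_isomorphism (A B : cstarAlgType R) (f : A -> B) : Prop :=
  star_morphism f /\ bijective f.

Definition star_isomorphic (A B : cstarAlgType R) : Prop :=
  exists f : A -> B, star_isomorphism f.

End Isomorphisms.

(* A C*-algebra A (x) B with its elementary tensors a (x) b: a C*-completion
   of the algebraic tensor product of A and B.  The field tensor_faithful says
   that the linear map from the algebraic tensor product induced by the
   bilinear map (a, b) |-> a (x) b is injective.  If A is nuclear (for instance
   UHF), the algebraic tensor product has only one C*-norm, hence this
   completion is the C*-tensor product, unique up to a unique isomorphism
   preserving elementary tensors. *)
Record cstar_tensor (R : realType) (A B : cstarAlgType R) := CStarTensor {
  tensor_alg :> cstarAlgType R;
  tensor : A -> B -> tensor_alg;
  tensor_linearl : forall b, linear (tensor^~ b);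
  tensor_linearr : forall a, linear (tensor a);
  tensor1 : tensor 1 1 = 1;
  tensorM : forall a a' b b',
    tensor (a * a') (b * b') = tensor a b * tensor a' b';
  tensor_star : forall a b, tensor (star a) (star b) = star (tensor a b);
  tensor_faithful : forall (n : nat) (a : 'I_n -> A) (b : 'I_n -> B),
    (forall c : 'I_n -> R[i],
      \sum_(i < n) c i *: a i = 0 -> forall i, c i = 0) ->
    \sum_(i < n) tensor (a i) (b i) = 0 -> forall i, b i = 0;
  tensor_dense :
    closure [set x | exists (n : nat) (a : 'I_n -> A) (b : 'I_n -> B),
               x = \sum_(i < n) tensor (a i) (b i)] = setT
}.

Section Flows.
Variable R : realType.

Definition flow (A : cstarAlgType R) (alpha : R -> A -> A) : Prop :=
  [/\ forall t, star_isomorphism (alpha t),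
      forall a, alpha 0 a = a,
      forall s t a, alpha (s + t) a = alpha s (alpha t a)
    & forall a, continuous (fun t : R => alpha t a)].

(* tau is the flow alpha (x) beta on the tensor product AB; a flow is
   determined by its values on elementary tensors, which span a dense
   subspace. *)
Definition tensor_flow (A B : cstarAlgType R) (AB : cstar_tensor A B)
    (alpha : R -> A -> A) (beta : R -> B -> B) (tau : R -> AB -> AB) : Prop :=
  flow tau /\
  forall t a b, tau t (tensor AB a b) = tensor AB (alpha t a) (beta t b).

(* S is a *-subalgebra of A isomorphic to the algebra of k x k complex matrices
   for some k = n + 1 >= 1.  The embedding f is not required to map 1 to 1. *)
Definition full_matrix_subalgebra (A : cstarAlgType R) (S : set A) : Prop :=
  exists (n : nat) (f : 'M[R[i]]_n.+1 -> A),
    [/\ linear f,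
        {morph f : M N / M *m N >-> M * N},
        forall M, f ((map_mx Num.conj M)^T) = star (f M),
        injective f
      & range f = S].

Definition matrix_filtration (A : cstarAlgType R) (An : nat -> set A) : Prop :=
  [/\ forall n, full_matrix_subalgebra (An n),
      forall n, An n `<=` An n.+1,
      An 0%N 1
    & closure (\bigcup_n An n) = setT].

Definition UHF (A : cstarAlgType R) : Prop :=
  exists An : nat -> set A, matrix_filtration An.

Definition UHF_flow (A : cstarAlgType R) (alpha : R -> A -> A) : Prop :=
  flow alpha /\
  exists An : nat -> set A,
    matrix_filtration An /\ forall n t, alpha t @` An n = An n.

Definition unitary (A : cstarAlgType R) (u : A) : Prop :=
  star u * u = 1 /\ u * star u = 1.

Definition cocycle (A : cstarAlgType R) (alpha : R -> A -> A) (u : R -> A) :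
    Prop :=
  [/\ continuous u,
      forall t, unitary (u t)
    & forall s t, u s * alpha s (u t) = u (s + t)].

Definition cocycle_perturbation (A : cstarAlgType R)
    (beta alpha : R -> A -> A) : Prop :=
  exists u : R -> A,
    cocycle alpha u /\ forall t x, beta t x = u t * alpha t x * star (u t).

Definition cocycle_conjugate (A B : cstarAlgType R)
    (alpha : R -> A -> A) (beta : R -> B -> B) : Prop :=
  exists (phi : A -> B) (phi_inv : B -> A),
    [/\ star_isomorphism phi, cancel phi phi_inv, cancel phi_inv phi
      & cocycle_perturbation alpha (fun t x => phi_inv (beta t (phi x)))].

(* AA is the tensor product of A with itself.  The flow gamma (x) alpha on AA
   exists and is unique when A is UHF. *)
Definition universal_UHF_flow (A : cstarAlgType R) (AA : cstar_tensor A A)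
    (gamma : R -> A -> A) : Prop :=
  UHF_flow gamma /\
  forall alpha : R -> A -> A, UHF_flow alpha ->
    exists tau : R -> AA -> AA,
      tensor_flow gamma alpha tau /\ cocycle_conjugate tau gamma.

End Flows.

(* Main.v *)
(* A UHF flow is an infinite tensor product of flows Ad (exp (i t H_j)) on full
   matrix algebras of sizes k_j, with H_j = diag (nu j): relative commutants of
   consecutive members of an invariant filtration are full matrix algebras, and
   a flow on a full matrix algebra is implemented by commuting unitaries.
   Perturbing nu j by a summable amount changes the flow only by a cocycle, so
   the labels nu j may be taken rational, and then only countably many types
   (k_j, nu j) occur.  Since A (x) A ~ A, the set of sizes of matrix algebras
   embeddable in A is closed under products, and A is an infinite tensor product
   in which every type occurs infinitely often.  Let gamma be the corresponding
   product flow.  For a UHF flow alpha, perturbed to have rational labels, the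
   types of gamma (x) alpha still occur infinitely often each, and a bijection
   matching the tensor factors of equal type conjugates the two flows. *)
Require Import Defs.
From mathcomp Require Import all_boot all_order all_algebra.
From mathcomp Require Import all_classical all_reals all_analysis.
From mathcomp Require Import complex.
From mathcomp Require Import ring lra.
Set Implicit Arguments.
Unset Strict Implicit.
Unset Printing Implicit Defensive.
Import Order.TTheory GRing.Theory Num.Theory.
Import numFieldNormedType.Exports.
Local Open Scope classical_set_scope.
Local Open Scope ring_scope.
Local Open Scope complex_scope.

(** * Norms and limits *)

(** Maps are obtained from generators, not from formulas on the whole algebra. Matching the matrix
    units of two factorisations with the same sizes gives an isometric relation between dense
    subalgebras, whose closure is the graph of an isomorphism. The automorphisms of a labelled flow,
    the flow gamma (x) alpha and the conjugacy of two product flows all arise this way. Isometry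
    comes from the identity |x^(2^n)| = |x|^(2^n) for selfadjoint x, which removes constants
    depending on the dimension.

    The obstacle is the closure of the sizes under products: A (x) A ~ A yields commuting matrix
    algebras in A, but these need not lie in any member of a given filtration. A perturbation
    argument shows that the size of every unital matrix subalgebra still divides the size of some
    member. The same fact places the factors of an arbitrary UHF flow, which come from another
    filtration, among the types of gamma.

    Only every second factor of A gets a prescribed type; the others absorb the remaining sizes and
    carry zero labels. *)

Section RealNorm.
Variables (R : realType) (A : cstarAlgType R).
Implicit Types (x y z : A) (c : R[i]).

(** The norm of A takes values in [R[i]]; its real part gives a real number, to which [lra] and
    [nra] apply. *)
Definition nrm x : R := complex.Re `|x|.

Lemma nrmE x : `|x| = (nrm x)%:C.
Proof. by rewrite /nrm RRe_real // normr_real. Qed.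

Lemma nrm_ge0 x : 0 <= nrm x.
Proof. by rewrite -lecR -nrmE normr_ge0. Qed.

Lemma nrm0 : nrm 0 = 0.
Proof. by rewrite /nrm normr0. Qed.

Lemma nrm_eq0 x : nrm x = 0 -> x = 0.
Proof. by move=> h; apply/normr0_eq0; rewrite nrmE h. Qed.

Lemma nrmD x y : nrm (x + y) <= nrm x + nrm y.
Proof. by rewrite -lecR rmorphD /= -!nrmE ler_normD. Qed.

Lemma nrmN x : nrm (- x) = nrm x.
Proof. by rewrite /nrm normrN. Qed.

Lemma nrmB x y : nrm (x - y) = nrm (y - x).
Proof. by rewrite -nrmN opprB. Qed.

Lemma nrmBD x y z : nrm (x - y) <= nrm (x - z) + nrm (z - y).
Proof. by rewrite -[x - y](subrKA z) nrmD. Qed.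

Definition cnrm c : R := complex.Re `|c|.

Lemma cnrmE c : `|c| = (cnrm c)%:C.
Proof. by rewrite /cnrm RRe_real // normr_real. Qed.

Lemma cnrm_ge0 c : 0 <= cnrm c.
Proof. by rewrite -lecR -cnrmE normr_ge0. Qed.

Lemma nrmZ c x : nrm (c *: x) = cnrm c * nrm x.
Proof. by apply: complexI; rewrite rmorphM /= -cnrmE -!nrmE normrZ. Qed.

Lemma nrmM x y : nrm (x * y) <= nrm x * nrm y.
Proof. by rewrite -lecR rmorphM /= -!nrmE cstar_normM. Qed.

Lemma nrm_star2 x : nrm (star x * x) = nrm x ^+ 2.
Proof. by apply: complexI; rewrite rmorphXn /= -!nrmE cstar_identity. Qed.

Lemma nrm_sum (I : finType) (P : pred I) (F : I -> A) :
  nrm (\sum_(i | P i) F i) <= \sum_(i | P i) nrm (F i).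
Proof.
elim/big_ind2: _ => [|x a y b hx hy|//]; first by rewrite nrm0.
by apply: le_trans (nrmD _ _) _; apply: lerD.
Qed.

Lemma nrm_small x : (forall e : R, 0 < e -> nrm x <= e) -> x = 0.
Proof.
move=> h; apply: nrm_eq0; apply/eqP; rewrite eq_le nrm_ge0 andbT.
by apply/ler_addgt0Pr => e e0; rewrite add0r h.
Qed.

Lemma star0 : star (0 : A) = 0.
Proof. by apply: (@addrI _ (star 0)); rewrite -starD !addr0. Qed.

Lemma starN x : star (- x) = - star x.
Proof. by apply: (@addrI _ (star x)); rewrite -starD !subrr star0. Qed.

Lemma starB x y : star (x - y) = star x - star y.
Proof. by rewrite starD starN. Qed.

Lemma star1 : star (1 : A) = 1.
Proof.
by rewrite -[LHS]mul1r -{1}(starK 1) -starM mul1r starK.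
Qed.

Lemma star_sum (I : finType) (P : pred I) (F : I -> A) :
  star (\sum_(i | P i) F i) = \sum_(i | P i) star (F i).
Proof. exact: (big_morph _ (@starD R A) star0). Qed.

Lemma nrm_star x : nrm (star x) = nrm x.
Proof.
suff h y : nrm y <= nrm (star y).
  by apply/eqP; rewrite eq_le h andbT; have := h (star x); rewrite starK.
have [->|y0] := eqVneq (nrm y) 0; first exact: nrm_ge0.
have y1 : 0 < nrm y by rewrite lt_def y0 nrm_ge0.
by rewrite -(ler_pM2r y1) -expr2 -nrm_star2 nrmM.
Qed.

Lemma nrm_proj x : star x = x -> x * x = x -> x != 0 -> nrm x = 1.
Proof.
move=> xs xx x0; have := nrm_star2 x; rewrite xs xx expr2 => h.
have n0 : nrm x != 0 by apply: contra_neq x0; exact: nrm_eq0.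
by apply: (mulfI n0); rewrite mulr1 -h.
Qed.

Lemma nrm1 : nrm (1 : A) = 1.
Proof. by apply: nrm_proj; rewrite ?star1 ?mulr1 ?oner_neq0. Qed.

Lemma closureP (S : set A) x :
  closure S x <-> forall e : R, 0 < e -> exists2 y, S y & nrm (x - y) < e.
Proof.
split=> [h e e0|h B].
  have /h[y []] : nbhs x (ball_ Num.norm x e%:C).
    by apply/nbhs_normP; exists e%:C => //=; rewrite ltcR.
  by rewrite /ball_ /= nrmE ltcR => Sy ye; exists y.
case/nbhs_normP => d d0 dB.
have dR : d = (complex.Re d)%:C by rewrite RRe_real // gtr0_real.
have [|y Sy ye] := h (complex.Re d); first by rewrite -ltcR -dR.
by exists y; split => //; apply: dB; rewrite /ball_ /= dR nrmE ltcR.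
Qed.

Definition ncvg (u : nat -> A) (l : A) : Prop :=
  forall e : R, 0 < e -> exists N, forall n, (N <= n)%N -> nrm (l - u n) < e.

Lemma cauchy_nrm_cvg (u : nat -> A) :
  (forall e : R, 0 < e -> exists N, forall m n, (N <= m)%N -> (N <= n)%N ->
     nrm (u m - u n) < e) ->
  exists l, ncvg u l.
Proof.
move=> h.
have : cauchy_ex (u @ \oo).
  move=> e e0.
  have eR : e = (complex.Re e)%:C by rewrite RRe_real // gtr0_real.
  have [|N hN] := h (complex.Re e); first by rewrite -ltcR -eR.
  exists (u N); exists N => // n /= Nn.
  by rewrite -ball_normE /ball_ /= nrmE eR ltcR hN.
move/cauchy_exP/cauchy_cvg => /cvg_ex[l ul].
exists l => e e0.
have /cvgrPdist_lt/(_ e%:C) := ul.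
rewrite ltcR => /(_ e0) [N _ hN]; exists N => n Nn.
by rewrite -ltcR -nrmE; exact: hN.
Qed.

Lemma continuous_nrmP (f : R -> A) :
  continuous f <->
  forall t (e : R), 0 < e -> exists2 d : R, 0 < d &
    forall s, `|t - s| < d -> nrm (f t - f s) < e.
Proof.
split=> [h t e e0|h t].
  have /cvgrPdist_lt/(_ e%:C) := h t.
  rewrite ltcR => /(_ e0) /nbhs_normP[d d0 dB]; exists d => // s hs.
  by rewrite -ltcR -nrmE; exact: dB.
apply/cvgrPdist_lt => e e0.
have eR : e = (complex.Re e)%:C by rewrite RRe_real // gtr0_real.
have [|d d0 dB] := h t (complex.Re e); first by rewrite -ltcR -eR.
apply/nbhs_normP; exists d => // s hs; rewrite eR nrmE ltcR; exact: dB.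
Qed.

End RealNorm.

Section NormLimits.
Variables (R : realType) (A : cstarAlgType R).
Implicit Types (x y z l : A) (u v : nat -> A) (c : R[i]).

Lemma expr_small (r e : R) : 0 <= r -> r < 1 -> 0 < e ->
  exists N, forall n, (N <= n)%N -> r ^+ n < e.
Proof.
move=> r0 r1 e0; have := @cvg_expr R r; rewrite ger0_norm // => /(_ r1).
move=> /cvgrPdist_lt/(_ e e0) [N _ hN]; exists N => n Nn.
by have := hN n Nn; rewrite /= sub0r normrN ger0_norm // exprn_ge0.
Qed.

Lemma ncvg_geo u l (c r : R) : 0 <= c -> 0 <= r -> r < 1 ->
  (forall n, nrm (l - u n) <= c * r ^+ n) -> ncvg u l.
Proof.
move=> c0 r0 r1 h e e0; have c1 : 0 < c + 1 by rewrite ltr_wpDl.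
have [N hN] := expr_small r0 r1 (divr_gt0 e0 c1); exists N => n Nn.
have := hN n Nn; rewrite ltr_pdivlMr // => h2.
apply: le_lt_trans (h n) _; apply: le_lt_trans h2.
by rewrite mulrC ler_wpM2l ?exprn_ge0 // lerDl.
Qed.

(** Telescoping against the geometric series. The explicit tail bound is kept because its case n = 0
    later gives the norm continuity of the cocycle. *)
Lemma geo_cvg u (c r : R) : 0 <= c -> 0 <= r -> r < 1 ->
  (forall n, nrm (u n.+1 - u n) <= c * r ^+ n) ->
  exists2 l, ncvg u l & forall n, nrm (l - u n) <= c / (1 - r) * r ^+ n.
Proof.
move=> c0 r0 r1 h.
have d0 : 0 < 1 - r by rewrite subr_gt0.
set C := c / (1 - r).
have C0 : 0 <= C by rewrite divr_ge0 // ltW.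
have hk k n : nrm (u (n + k)%N - u n) <= C * r ^+ n.
  elim: k n => [|k IH] n; first by rewrite addn0 subrr nrm0 mulr_ge0 // exprn_ge0.
  rewrite addnS -addSn; apply: le_trans (nrmBD _ _ (u n.+1)) _.
  apply: le_trans (lerD (IH _) (h n)) _.
  by rewrite -[c](divfK (lt0r_neq0 d0)) -/C exprS; nra.
have [|l hl] := @cauchy_nrm_cvg R A u.
  move=> e e0; have C1 : 0 < 2 * C + 1 by nra.
  have [N hN] := expr_small r0 r1 (divr_gt0 e0 C1); exists N => m n Nm Nn.
  have := hN N (leqnn N); rewrite ltr_pdivlMr // => h2.
  apply: le_lt_trans h2; apply: le_trans (nrmBD _ _ (u N)) _.
  have := hk (m - N)%N N; have := hk (n - N)%N N; rewrite !subnKC // nrmB => h3 h4.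
  by have := exprn_ge0 N r0; nra.
exists l => // n; apply/ler_addgt0Pr => e e0.
have [N hN] := hl e e0.
apply: le_trans (nrmBD _ _ (u (n + N)%N)) _; rewrite addrC.
by apply: lerD (hk _ _) _; apply/ltW/hN; rewrite leq_addl.
Qed.

Lemma ncvg_uniq u l l' : ncvg u l -> ncvg u l' -> l = l'.
Proof.
move=> h h'; apply/eqP; rewrite -subr_eq0; apply/eqP/nrm_small => e e0.
have e2 : 0 < e / 2 by rewrite divr_gt0.
have [N hN] := h _ e2; have [N' hN'] := h' _ e2.
apply: le_trans (nrmBD _ _ (u (maxn N N'))) _; rewrite [e]splitr.
apply: lerD; first by apply/ltW/hN; rewrite leq_maxl.
by rewrite nrmB; apply/ltW/hN'; rewrite leq_maxr.
Qed.

Lemma ncvg_lip (B : cstarAlgType R) (f : A -> B) (C : R) u l :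
  (forall x y, nrm (f x - f y) <= C * nrm (x - y)) ->
  ncvg u l -> ncvg (f \o u) (f l).
Proof.
move=> hf h e e0; have C1 : 0 < `|C| + 1 by rewrite ltr_wpDl.
have [N hN] := h _ (divr_gt0 e0 C1); exists N => n Nn /=.
apply: le_lt_trans (hf _ _) _; have := hN n Nn; rewrite ltr_pdivlMr // => h2.
apply: le_lt_trans h2; rewrite mulrC ler_wpM2l ?nrm_ge0 //.
by rewrite (le_trans (ler_norm C)) // lerDl.
Qed.

Lemma ncvg_const x : ncvg (fun _ => x) x.
Proof. by move=> e e0; exists 0%N => n _; rewrite subrr nrm0. Qed.

Lemma ncvgZ c u l : ncvg u l -> ncvg (fun n => c *: u n) (c *: l).
Proof. by apply: (@ncvg_lip _ _ (cnrm c)) => x y; rewrite -scalerBr nrmZ. Qed.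

Lemma ncvg_star u l : ncvg u l -> ncvg (fun n => star (u n)) (star l).
Proof. by apply: (@ncvg_lip _ _ 1) => x y; rewrite -starB nrm_star mul1r. Qed.

Lemma ncvgD u v l m : ncvg u l -> ncvg v m -> ncvg (fun n => u n + v n) (l + m).
Proof.
move=> h h' e e0; have e2 : 0 < e / 2 by rewrite divr_gt0.
have [N hN] := h _ e2; have [N' hN'] := h' _ e2.
exists (maxn N N') => n; rewrite geq_max => /andP[Nn N'n].
rewrite [e]splitr opprD addrACA; apply: le_lt_trans (nrmD _ _) _.
by apply: ltrD; [exact: hN|exact: hN'].
Qed.

Lemma nrmMB x y x' y' :
  nrm (x * y - x' * y') <= nrm (x - x') * nrm y + nrm x' * nrm (y - y').
Proof.
have -> : x * y - x' * y' = (x - x') * y + x' * (y - y').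
  by rewrite mulrBl mulrBr addrA subrK.
by apply: le_trans (nrmD _ _) _; apply: lerD; apply: nrmM.
Qed.

Lemma ncvgM u v l m : ncvg u l -> ncvg v m -> ncvg (fun n => u n * v n) (l * m).
Proof.
move=> h h' e e0.
have C0 : 0 < nrm l + nrm m + 1 by have := nrm_ge0 l; have := nrm_ge0 m; lra.
pose d := Num.min 1 (e / (2 * (nrm l + nrm m + 1))).
have d0 : 0 < d by rewrite lt_min ltr01 divr_gt0 // mulr_gt0.
have [N hN] := h _ d0; have [N' hN'] := h' _ d0.
exists (maxn N N') => n; rewrite geq_max => /andP[/hN h1 /hN' h2].
apply: le_lt_trans (nrmMB _ _ _ _) _.
have d1 : d <= 1 by rewrite /d ge_min lexx.
have : d <= e / (2 * (nrm l + nrm m + 1)) by rewrite /d ge_min lexx orbT.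
rewrite ler_pdivlMr ?mulr_gt0 // => h3.
have h4 : nrm (u n) <= nrm l + 1.
  rewrite -[u n](subrK l); apply: le_trans (nrmD _ _) _; rewrite nrmB; lra.
have := nrm_ge0 l; have := nrm_ge0 m; have := nrm_ge0 (u n).
have := nrm_ge0 (l - u n); have := nrm_ge0 (m - v n).
move: (nrm l) (nrm m) (nrm (u n)) (nrm (l - u n)) (nrm (m - v n)) h1 h2 h3 h4 => a b c' p q.
nra.
Qed.

(** Each squaring is an instance of the C*-identity, since the powers of x are again selfadjoint. *)
Lemma nrm_pow_selfadj x n : star x = x -> nrm (x ^+ (2 ^ n)) = nrm x ^+ (2 ^ n).
Proof.
move=> xs; elim: n => [|n IH]; first by rewrite expn0 !expr1.
rewrite expnSr !exprM -IH -nrm_star2.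
suff -> : star (x ^+ (2 ^ n)) = x ^+ (2 ^ n) by rewrite expr2.
elim: (2 ^ n)%N => [|k IHk]; first by rewrite !expr0 star1.
by rewrite exprS starM IHk xs -exprSr exprS.
Qed.

End NormLimits.

(** If b < a, the powers of b / a tend to 0 and eventually beat any constant C. *)
Lemma pow_bound_le (R : realType) (a b C : R) : 0 <= a -> 0 <= b ->
  (forall n, a ^+ (2 ^ n) <= C * b ^+ (2 ^ n)) -> a <= b.
Proof.
move=> a0 b0 h; rewrite leNgt; apply/negP => ba.
have ap : 0 < a by apply: le_lt_trans ba.
have r0 : 0 <= b / a by rewrite divr_ge0.
have r1 : b / a < 1 by rewrite ltr_pdivrMr // mul1r.
have C1 : 0 < `|C| + 1 by rewrite ltr_wpDl.
have [N hN] := expr_small r0 r1 (divr_gt0 ltr01 C1).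
have Nlt : (N <= 2 ^ N)%N by apply/ltnW/ltn_expl.
have := hN _ Nlt; rewrite ltr_pdivlMr // expr_div_n mulrAC ltr_pdivrMr ?exprn_gt0 //.
rewrite mul1r => h2; have := h N; have := exprn_ge0 (2 ^ N) b0.
have := ler_norm C; move: (b ^+ _) (a ^+ _) h2 => p q; nra.
Qed.

Section RelationNorm.
Variables (R : realType) (A B : cstarAlgType R) (G : A -> B -> Prop) (C : R).
Hypothesis GM : forall x y x' y', G x y -> G x' y' -> G (x * x') (y * y').
Hypothesis Gstar : forall x y, G x y -> G (star x) (star y).
Hypothesis Gbound : forall x y, G x y -> nrm x <= C * nrm y.

(* The spectral radius formula for selfadjoint elements removes the constant. *)
Lemma relation_nrm_le x y : G x y -> nrm x <= nrm y.
Proof.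
have C0 u v : G u v -> star u = u -> star v = v -> nrm u <= nrm v.
  move=> Guv us vs; apply: (@pow_bound_le _ _ _ C); rewrite ?nrm_ge0 // => n.
  rewrite -!nrm_pow_selfadj //; apply: Gbound.
  have: (0 < 2 ^ n)%N by rewrite expn_gt0.
  case: (2 ^ n)%N => // k _; elim: k => [|k IH]; first by rewrite !expr1.
  by rewrite [u ^+ _]exprS [v ^+ _]exprS; apply: GM.
move=> Gxy; have := C0 _ _ (GM (Gstar Gxy) Gxy).
rewrite !starM !starK => /(_ erefl erefl); rewrite !nrm_star2.
by rewrite ler_pXn2r // ?nnegrE nrm_ge0.
Qed.

End RelationNorm.

(** * Contractivity of morphisms of C*-algebras *)

Section Contractive.
Variable R : realType.

Lemma cnrm_half : cnrm (2%:R^-1 : R[i]) = 2^-1.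
Proof.
by apply: complexI; rewrite -cnrmE normfV normr_nat fmorphV /= rmorph_nat.
Qed.

(** The root is 1 - r, where r is a fixed point of [T r = (y * y + r * r) / 2], an equation
    equivalent to (1 - r)^2 = 1 - y^2. The iterates of T from 0 are selfadjoint and commute with y,
    hence so does r. *)
Lemma sqrt_one_minus_square (A : cstarAlgType R) (y : A) :
  star y = y -> nrm y < 1 ->
  exists z : A, [/\ star z = z, z * y = y * z & z * z = 1 - y * y].
Proof.
move=> ys y1; set w := y * y; set c := nrm w.
have c0 : 0 <= c by apply: nrm_ge0.
have c1 : c < 1.
  by apply: le_lt_trans (nrmM _ _) _; have := nrm_ge0 y; nra.
pose s := Num.sqrt (1 - c).
have s0 : 0 < s by rewrite sqrtr_gt0 subr_gt0.
have ss : s * s = 1 - c by rewrite -expr2 sqr_sqrtr // subr_ge0 ltW.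
have s1 : s <= 1 by nra.
(* p is the smaller root of p = (c + p^2) / 2, so T maps the ball of radius p into itself and is
   p-Lipschitz there. *)
pose p := 1 - s; have p0 : 0 <= p by rewrite subr_ge0.
have p1 : p < 1 by rewrite /p; lra.
have pp : (c + p * p) / 2 = p by rewrite /p; nra.
pose T (r : A) := (2%:R^-1 : R[i]) *: (w + r * r).
have half := cnrm_half.
have Tp r : nrm r <= p -> nrm (T r) <= p.
  move=> hr; rewrite nrmZ half -[leRHS]pp mulrC ler_wpM2r ?invr_ge0 //.
  apply: le_trans (nrmD _ _) _; apply: lerD => //.
  by apply: le_trans (nrmM _ _) _; apply: ler_pM; rewrite ?nrm_ge0.
pose u n := iter n T 0.
have uS n : u n.+1 = (2%:R^-1 : R[i]) *: (w + u n * u n) by [].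
have up n : nrm (u n) <= p by elim: n => [|n IH] /=; [rewrite nrm0|exact: Tp].
have du n : nrm (u n.+1 - u n) <= p * p ^+ n.
  elim: n => [|n IH]; first by rewrite /= subr0 expr0 mulr1 Tp // nrm0.
  have -> : u n.+2 - u n.+1 =
      2%:R^-1 *: (u n.+1 * u n.+1 - u n * u n).
    by rewrite (uS n.+1) {3}(uS n) -scalerBr opprD addrACA subrr add0r.
  rewrite nrmZ half.
  have := nrmMB (u n.+1) (u n.+1) (u n) (u n).
  have := up n; have := up n.+1; have := nrm_ge0 (u n); have := nrm_ge0 (u n.+1).
  have := nrm_ge0 (u n.+1 - u n); rewrite [p ^+ n.+1]exprS; move: IH.
  move: (nrm (u n)) (nrm (u n.+1)) (nrm (u n.+1 - u n)) (nrm (_ * _ - _)) (p ^+ n).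
  move=> a b d e q; nra.
have [r hr _] := geo_cvg p0 p0 p1 du.
have rT : r = T r.
  apply: (@ncvg_uniq _ _ (u \o succn)).
    by move=> e /hr[N hN]; exists N => n Nn; apply: hN; rewrite leqW.
  apply: ncvgZ; apply: ncvgD (ncvg_const _) _; exact: ncvgM.
have rs : star r = r.
  apply: (ncvg_uniq (ncvg_star hr)).
  suff -> : (fun n => star (u n)) = u by [].
  apply/funext; elim=> [|n IH]; first exact: star0.
  rewrite uS starZ starD starM IH /w starM ys.
  by congr (_ *: _); rewrite fmorphV /= rmorph_nat.
have ry : r * y = y * r.
  apply: (ncvg_uniq (ncvgM hr (ncvg_const y))).
  suff -> : (fun n => u n * y) = (fun n => y * u n).
    exact: ncvgM (ncvg_const y) hr.
  apply/funext; elim=> [|n IH]; first by rewrite mul0r mulr0.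
  rewrite uS -scalerAl -scalerAr mulrDl mulrDr /w !mulrA; congr (_ *: (_ + _)).
  by rewrite -[LHS]mulrA IH mulrA IH.
exists (1 - r); split.
- by rewrite starB star1 rs.
- by rewrite mulrBl mulrBr mul1r mulr1 ry.
have : r + r = w + r * r.
  rewrite {1 2}rT /T -mulr2n -scaler_nat scalerA mulfV ?scale1r //.
move=> h; have -> : w = r + r - r * r by rewrite h addrK.
by rewrite mulrBl mul1r mulrBr mulr1 !opprD !opprK !addrA.
Qed.

Lemma unitary_nrm (A : cstarAlgType R) (u : A) : star u * u = 1 -> nrm u = 1.
Proof.
move=> h; have := nrm_star2 u; rewrite h nrm1 => /esym/eqP.
by rewrite sqrf_eq1 => /orP[/eqP //|/eqP h2]; have := nrm_ge0 u; lra.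
Qed.

(* A selfadjoint strict contraction y is the mean of the two unitaries
   y + i z and y - i z with z^2 = 1 - y^2, and morphisms preserve unitaries. *)
Lemma star_morphism_contractive (A B : cstarAlgType R) (f : A -> B) (x : A) :
  star_morphism f -> nrm (f x) <= nrm x.
Proof.
move=> [fl [f1 fM] fs].
have fD a b : f (a + b) = f a + f b by have := fl 1 a b; rewrite !scale1r.
have f0 : f 0 = 0 by apply: (@addrI _ (f 0)); rewrite -fD !addr0.
have fZ c a : f (c *: a) = c *: f a by have := fl c a 0; rewrite f0 !addr0.
have key y : star y = y -> nrm y < 1 -> nrm (f y) <= 1.
  move=> ys y1; have [z [zs zy zz]] := sqrt_one_minus_square ys y1.
  have fun_u (e : R[i]) : e * e = -1 -> Num.conj e = - e -> nrm (f (y + e *: z)) = 1.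
    move=> ee ec; apply: unitary_nrm; rewrite -fs -fM -f1; congr (f _).
    rewrite starD starZ ys zs ec mulrDl !mulrDr -!scalerAr -!scalerAl zy !scalerA.
    rewrite mulrN ee opprK scale1r zz scaleNr addrA addrK.
    by rewrite addrCA subrr addr0.
  have h1 : nrm (f (y + 'i%C *: z)) = 1.
    by apply: fun_u; [rewrite -expr2 sqr_i|apply/eqP; rewrite eq_complex /= oppr0 !eqxx].
  have h2 : nrm (f (y + (- 'i%C) *: z)) = 1.
    apply: fun_u; first by rewrite mulrNN -expr2 sqr_i.
    by apply/eqP; rewrite eq_complex /= !oppr0 !eqxx.
  have -> : y = (2%:R^-1 : R[i]) *: ((y + 'i%C *: z) + (y + (- 'i%C) *: z)).
    rewrite addrACA -scalerDl subrr scale0r addr0 -mulr2n -[y *+ 2]scaler_nat.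
    by rewrite scalerA mulVf ?scale1r // pnatr_eq0.
  rewrite fZ fD nrmZ cnrm_half; have := nrmD (f (y + 'i%C *: z)) (f (y + (- 'i%C) *: z)).
  by rewrite h1 h2; lra.
have selfadj y : star y = y -> nrm (f y) <= nrm y.
  move=> ys; rewrite leNgt; apply/negP => h.
  (* A scale strictly between the two norms: y / r is a strict contraction whose image would have
     norm greater than 1. *)
  pose r := (nrm y + nrm (f y)) / 2.
  have y0 := nrm_ge0 y; have r0 : 0 < r by rewrite /r; lra.
  have cr : cnrm (r^-1)%:C = r^-1.
    by apply: complexI; rewrite -cnrmE normc_def /= expr0n addr0 sqrtr_sqr gtr0_norm ?invr_gt0.
  have := key ((r^-1)%:C *: y); rewrite starZ ys fZ !nrmZ cr.
  rewrite ![r^-1 * _]mulrC ltr_pdivrMr // ler_pdivrMr // mul1r.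
  have -> : Num.conj (r^-1)%:C = (r^-1)%:C :> R[i] by apply: conjc_real.
  move=> /(_ erefl); rewrite /r; lra.
have := selfadj (star x * x); rewrite starM starK => /(_ erefl).
by rewrite fM fs !nrm_star2 ler_pXn2r // ?nnegrE nrm_ge0.
Qed.

End Contractive.

(** * Morphisms and extension of isometric relations *)

Section ClosedSubalgebras.
Variables (R : realType) (A : cstarAlgType R).
Implicit Types (S X : set A) (x y : A).

Definition closed_subalgebra S : Prop :=
  [/\ S 1, forall (c : R[i]) x y, S x -> S y -> S (c *: x + y),
      forall x y, S x -> S y -> S (x * y)
    & forall x, (forall e : R, 0 < e -> exists2 y, S y & nrm (x - y) < e) -> S x].

(** An induction principle: a property holds on all of A once it defines a closed subalgebra
    containing X. Closed subalgebras are not asked to be stable under [star], which makes this the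
    stronger notion of generation. *)
Definition generating X : Prop :=
  forall S, closed_subalgebra S -> X `<=` S -> forall x, S x.

Section Theory.
Variables (S : set A) (SP : closed_subalgebra S).

Lemma csub1 : S 1. Proof. by case: SP. Qed.
Lemma csub0 : S 0.
Proof. by case: SP => S1 SZ _ _; have := SZ (-1) 1 1 S1 S1; rewrite scaleN1r addNr. Qed.
Lemma csubD x y : S x -> S y -> S (x + y).
Proof. by case: SP => _ SZ _ _ /(SZ 1 x y) h /h; rewrite scale1r. Qed.
Lemma csubZ (c : R[i]) x : S x -> S (c *: x).
Proof. by case: SP => _ SZ _ _ Sx; rewrite -[_ *: _]addr0; exact: SZ csub0. Qed.
Lemma csubM x y : S x -> S y -> S (x * y).
Proof. by case: SP => _ _ SM _; exact: SM. Qed.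
Lemma csub_sum (I : finType) (P : pred I) (F : I -> A) :
  (forall i, P i -> S (F i)) -> S (\sum_(i | P i) F i).
Proof. by move=> h; elim/big_ind: _ => //; [exact: csub0|exact: csubD]. Qed.
End Theory.

End ClosedSubalgebras.

Section StarMorphismTheory.
Variables (R : realType) (A B : cstarAlgType R) (f : A -> B).
Hypothesis fP : star_morphism f.

Lemma smD x y : f (x + y) = f x + f y.
Proof. by have [fl _ _] := fP; have := fl 1 x y; rewrite !scale1r. Qed.
Lemma sm0 : f 0 = 0.
Proof. by apply: (@addrI _ (f 0)); rewrite -smD !addr0. Qed.
Lemma smZ c x : f (c *: x) = c *: f x.
Proof. by have [fl _ _] := fP; have := fl c x 0; rewrite sm0 !addr0. Qed.
Lemma smB x y : f (x - y) = f x - f y.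
Proof. by rewrite smD -[- y]scaleN1r smZ scaleN1r. Qed.
Lemma sm1 : f 1 = 1. Proof. by have [_ []] := fP. Qed.
Lemma smM x y : f (x * y) = f x * f y. Proof. by have [_ []] := fP. Qed.
Lemma sm_star x : f (star x) = star (f x). Proof. by have [_ _] := fP. Qed.
Lemma sm_sum (I : finType) (P : pred I) (F : I -> A) :
  f (\sum_(i | P i) F i) = \sum_(i | P i) f (F i).
Proof. exact: (big_morph _ smD sm0). Qed.
Lemma sm_nrm x : nrm (f x) <= nrm x.
Proof. exact: star_morphism_contractive. Qed.
Lemma sm_nrmB x y : nrm (f x - f y) <= nrm (x - y).
Proof. by rewrite -smB sm_nrm. Qed.

Lemma preimage_closed_subalgebra (S : set B) :
  closed_subalgebra S -> closed_subalgebra (f @^-1` S).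
Proof.
move=> SP; split=> /=.
- by rewrite /preimage /= sm1; exact: csub1.
- by move=> c x y Sx Sy; rewrite /preimage /= smD smZ; apply: csubD => //; exact: csubZ.
- by move=> x y Sx Sy; rewrite /preimage /= smM; exact: csubM.
move=> x h; have [_ _ _] := SP; apply => e /h[y Sy xy]; exists (f y) => //.
by apply: le_lt_trans xy; rewrite -smB sm_nrm.
Qed.

End StarMorphismTheory.

Section Uniqueness.
Variables (R : realType) (A B : cstarAlgType R).

Lemma star_morphism_comp (C : cstarAlgType R) (f : A -> B) (g : B -> C) :
  star_morphism f -> star_morphism g -> star_morphism (g \o f).
Proof.
move=> fP gP; split=> [c x y||x] /=.
- by rewrite (smD fP) (smD gP) (smZ fP) (smZ gP).
- by split=> [|x y] /=; rewrite ?(sm1 fP) ?(sm1 gP) ?(smM fP) ?(smM gP).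
- by rewrite (sm_star fP) (sm_star gP).
Qed.

Lemma star_morphism_id : star_morphism (@id A).
Proof. by []. Qed.

(** Contractivity makes the equaliser of two morphisms norm closed, hence a closed subalgebra. *)
Lemma star_morphism_eq (f g : A -> B) (X : set A) :
  star_morphism f -> star_morphism g -> generating X ->
  (forall x, X x -> f x = g x) -> forall x, f x = g x.
Proof.
move=> fP gP XP fg; apply: (XP [set x | f x = g x]) => //; split => /=.
- by rewrite (sm1 fP) (sm1 gP).
- by move=> c x y hx hy; rewrite (smD fP) (smD gP) (smZ fP) (smZ gP) hx hy.
- by move=> x y hx hy; rewrite (smM fP) (smM gP) hx hy.
move=> x h; apply/eqP; rewrite -subr_eq0; apply/eqP/nrm_small => e e0.
have e2 : 0 < e / 2 by rewrite divr_gt0.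
have [y yE /ltW xy] := h _ e2; apply: le_trans (nrmBD _ _ (f y)) _.
rewrite [e]splitr; apply: lerD; first exact: le_trans (sm_nrmB fP _ _) _.
by rewrite yE; apply: le_trans (sm_nrmB gP _ _) _; rewrite nrmB.
Qed.

Lemma star_isomorphism_inv (f : A -> B) (g : B -> A) :
  star_isomorphism f -> cancel f g -> cancel g f ->
  star_isomorphism g.
Proof.
move=> [fP _] fK gK; split; last by exists f.
split=> [c x y||x].
- by apply: (can_inj fK); rewrite gK (smD fP) (smZ fP) !gK.
- split=> [|x y]; apply: (can_inj fK); rewrite gK ?(sm1 fP) //.
  by rewrite (smM fP) !gK.
- by apply: (can_inj fK); rewrite gK (sm_star fP) gK.
Qed.

End Uniqueness.

Section Extension.
Variables (R : realType) (A B : cstarAlgType R) (G : A -> B -> Prop).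
Hypothesis G1 : G 1 1.
Hypothesis GL : forall (c : R[i]) x y x' y', G x y -> G x' y' ->
  G (c *: x + x') (c *: y + y').
Hypothesis GM : forall x y x' y', G x y -> G x' y' -> G (x * x') (y * y').
Hypothesis Gs : forall x y, G x y -> G (star x) (star y).
Hypothesis Gn : forall x y, G x y -> nrm x = nrm y.

Definition relation_closure (x : A) (y : B) : Prop :=
  forall e : R, 0 < e -> exists x' y', [/\ G x' y', nrm (x - x') < e & nrm (y - y') < e].

Local Notation H := relation_closure.

Lemma relation_closure_sub x y : G x y -> H x y.
Proof. by move=> Gxy e e0; exists x, y; split; rewrite // subrr nrm0. Qed.

Lemma relation_closure_seq x y : H x y <->
  exists u v, [/\ forall n, G (u n) (v n), ncvg u x & ncvg v y].
Proof.
split=> [h|[u [v [Guv ux vy]]] e e0]; last first.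
  have [N hN] := ux e e0; have [N' hN'] := vy e e0.
  exists (u (maxn N N')), (v (maxn N N')).
  by split; [|apply: hN; rewrite leq_maxl|apply: hN'; rewrite leq_maxr].
have p0 n : 0 < (2^-1 : R) ^+ n by rewrite exprn_gt0 // invr_gt0.
have /choice[uv huv] : forall n, exists p : A * B,
    [/\ G p.1 p.2, nrm (x - p.1) < (2^-1) ^+ n & nrm (y - p.2) < (2^-1) ^+ n].
  by move=> n; have [x' [y' h']] := h _ (p0 n); exists (x', y').
exists (fun n => (uv n).1), (fun n => (uv n).2).
have r0 : 0 <= 2^-1 :> R by rewrite invr_ge0.
have r1 : 2^-1 < 1 :> R by rewrite invf_lt1 // ltr1n.
split; first by move=> n; case: (huv n).
- by apply: (ncvg_geo ler01 r0 r1) => n; rewrite mul1r; case: (huv n) => _ /ltW.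
- by apply: (ncvg_geo ler01 r0 r1) => n; rewrite mul1r; case: (huv n) => _ _ /ltW.
Qed.

Lemma relation_closureL (c : R[i]) x y x' y' : H x y -> H x' y' ->
  H (c *: x + x') (c *: y + y').
Proof.
move=> /relation_closure_seq[u [v [h1 h2 h3]]] /relation_closure_seq[u' [v' [h4 h5 h6]]].
apply/relation_closure_seq; exists (fun n => c *: u n + u' n), (fun n => c *: v n + v' n).
by split=> [n||]; [exact: GL|apply: ncvgD => //; exact: ncvgZ..].
Qed.

Lemma relation_closureM x y x' y' : H x y -> H x' y' -> H (x * x') (y * y').
Proof.
move=> /relation_closure_seq[u [v [h1 h2 h3]]] /relation_closure_seq[u' [v' [h4 h5 h6]]].
apply/relation_closure_seq; exists (fun n => u n * u' n), (fun n => v n * v' n).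
by split=> [n||]; [exact: GM|exact: ncvgM..].
Qed.

Lemma relation_closure_star x y : H x y -> H (star x) (star y).
Proof.
move=> /relation_closure_seq[u [v [h1 h2 h3]]]; apply/relation_closure_seq.
exists (fun n => star (u n)), (fun n => star (v n)).
by split=> [n||]; [exact: Gs|exact: ncvg_star..].
Qed.

Lemma relation_closure_nrm x y : H x y -> nrm x = nrm y.
Proof.
move=> h; have {}h e : 0 < e -> nrm x <= nrm y + e /\ nrm y <= nrm x + e.
  move=> e0; have e2 : 0 < e / 2 by rewrite divr_gt0.
  have [x' [y' [/Gn g hx hy]]] := h _ e2.
  have hx1 := nrmBD x 0 x'; have hx2 := nrmBD x' 0 x.
  have hy1 := nrmBD y 0 y'; have hy2 := nrmBD y' 0 y.
  rewrite !subr0 in hx1 hx2 hy1 hy2; rewrite nrmB in hx2; rewrite nrmB in hy2.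
  by split; lra.
by apply/eqP; rewrite eq_le; apply/andP; split; apply/ler_addgt0Pr => e /h[].
Qed.

Lemma relation_closure_fun x y y' : H x y -> H x y' -> y = y'.
Proof.
move=> h h'; have := relation_closureL (-1) h h'.
rewrite !scaleN1r addNr => /relation_closure_nrm; rewrite nrm0 => /esym/nrm_eq0.
by move/eqP; rewrite addrC subr_eq0 => /eqP.
Qed.

Lemma relation_closure_total :
  (forall x (e : R), 0 < e -> exists x' y', G x' y' /\ nrm (x - x') < e) ->
  forall x, exists y, H x y.
Proof.
move=> dG x.
have p0 n : 0 < (2^-1 : R) ^+ n by rewrite exprn_gt0 // invr_gt0.
have r0 : 0 <= 2^-1 :> R by rewrite invr_ge0.
have r1 : 2^-1 < 1 :> R by rewrite invf_lt1 // ltr1n.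
have /choice[uv huv] : forall n, exists p : A * B,
    G p.1 p.2 /\ nrm (x - p.1) < (2^-1) ^+ n.
  by move=> n; have [x' [y' h']] := dG x _ (p0 n); exists (x', y').
(* Consecutive approximants of x differ by at most 2^-n + 2^-(n+1), below 2 * 2^-n, and G carries
   this bound over to B. *)
have [|l vl _] := @geo_cvg _ _ (fun n => (uv n).2) 2 2^-1 (ler0n _ 2) r0 r1.
  move=> n; have [g1 h1] := huv n; have [g2 h2] := huv n.+1.
  have := Gn (GL (-1) g1 g2); rewrite !scaleN1r ![- _ + _]addrC => <-.
  apply: le_trans (nrmBD _ _ x) _; rewrite nrmB exprS in h2 *.
  by move: h1 h2; have := p0 n; move: (_ ^+ n) => q; lra.
exists l; apply/relation_closure_seq.
exists (fun n => (uv n).1), (fun n => (uv n).2); split=> //.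
- by move=> n; case: (huv n).
- by apply: (ncvg_geo ler01 r0 r1) => n; rewrite mul1r; case: (huv n) => _ /ltW.
Qed.

End Extension.

Lemma relation_closureC (R : realType) (A B : cstarAlgType R) (G : A -> B -> Prop) x y :
  relation_closure G x y <-> relation_closure (fun y x => G x y) y x.
Proof.
by split=> h e /h[x' [y' [? ? ?]]]; exists y', x'.
Qed.

(** The closure of a linear isometric relation is linear and isometric, hence single-valued in both
    directions. Cauchy sequences transfer through the isometry, so dense domain and range make the
    closure total and onto. Working with a relation avoids checking that a map defined through
    representatives is well defined. *)
Lemma star_isomorphism_of_relation (R : realType) (A B : cstarAlgType R)
    (G : A -> B -> Prop) :
  G 1 1 ->
  (forall (c : R[i]) x y x' y', G x y -> G x' y' -> G (c *: x + x') (c *: y + y')) ->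
  (forall x y x' y', G x y -> G x' y' -> G (x * x') (y * y')) ->
  (forall x y, G x y -> G (star x) (star y)) ->
  (forall x y, G x y -> nrm x = nrm y) ->
  (forall x (e : R), 0 < e -> exists x' y', G x' y' /\ nrm (x - x') < e) ->
  (forall y (e : R), 0 < e -> exists x' y', G x' y' /\ nrm (y - y') < e) ->
  exists (f : A -> B) (g : B -> A),
    [/\ star_isomorphism f, cancel f g, cancel g f & forall x y, G x y -> f x = y].
Proof.
move=> G1 GL GM Gs Gn dG rG.
have /choice[f fP] := relation_closure_total GL Gn dG.
have /choice[g gP] : forall y, exists x, relation_closure G x y.
  move=> y; have [|||x hx] := @relation_closure_total R B A (fun y x => G x y) _ _ _ y.
  - by move=> c x1 y1 x2 y2; exact: GL.
  - by move=> x1 y1 /Gn.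
  - by move=> z e /(rG z)[x' [y' h]]; exists y', x'.
  by exists x; apply/relation_closureC.
have Gfun := relation_closure_fun GL Gn.
have Ginj x x' y : relation_closure G x y -> relation_closure G x' y -> x = x'.
  move=> /relation_closureC h /relation_closureC h'.
  apply: (@relation_closure_fun R B A (fun y x => G x y) _ _ y) => //.
  - by move=> c x1 y1 x2 y2; exact: GL.
  - by move=> x1 y1 /Gn.
have fK : cancel f g by move=> x; exact: Ginj (gP (f x)) (fP x).
have gK : cancel g f by move=> y; exact: Gfun (fP (g y)) (gP y).
exists f, g; split=> //; last first.
  by move=> x y /relation_closure_sub; exact: Gfun.
split; last by exists g.
split=> [c x y||x].
- by apply: Gfun (fP _) _; exact: relation_closureL.
- split; first by apply: Gfun (fP _) (relation_closure_sub G1).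
  by move=> x y; apply: Gfun (fP _) _; exact: relation_closureM.
- by apply: Gfun (fP _) _; exact: relation_closure_star.
Qed.

(** * Matrix units and infinite tensor factorisations *)

Section MatrixUnits.
Variables (R : realType) (A : cstarAlgType R).

(** An arbitrary finite index type lets products and splittings of systems be indexed by pairs,
    without arithmetic on indices. *)
Definition munits (I : finType) (e : I -> I -> A) : Prop :=
  [/\ forall a b c d, e a b * e c d = e a d *+ (b == c),
      forall a b, star (e a b) = e b a
    & \sum_a e a a = 1].

Definition lin (I : finType) (e : I -> I -> A) (c : I -> I -> R[i]) : A :=
  \sum_a \sum_b c a b *: e a b.

Definition mspan (I : finType) (e : I -> I -> A) : set A :=
  [set x | exists c, x = lin e c].

Section OneSystem.
Variables (I : finType) (e : I -> I -> A) (eP : munits e).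
Implicit Types (a b : I) (c d : I -> I -> R[i]).

Lemma muM a b a' b' : e a b * e a' b' = e a b' *+ (b == a').
Proof. by case: eP. Qed.
Lemma muME a b b' : e a b * e b b' = e a b'.
Proof. by rewrite muM eqxx. Qed.
Lemma mu_star a b : star (e a b) = e b a.
Proof. by case: eP. Qed.
Lemma mu_sum : \sum_a e a a = 1.
Proof. by case: eP. Qed.

Lemma mu_inh : exists a : I, True.
Proof.
case: (pickP (@predT I)) => [a _|h]; first by exists a.
by have /eqP := mu_sum; rewrite big_pred0 // eq_sym oner_eq0.
Qed.

Lemma mu_neq0 a b : e a b != 0.
Proof.
apply/eqP => h; have := mu_sum; rewrite big1 => [/eqP|c _].
  by rewrite eq_sym oner_eq0.
by rewrite -(muME c a) -(muME a b) h mul0r mulr0.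
Qed.

Lemma mu_nrm a b : nrm (e a b) = 1.
Proof.
apply: (@pexpIrn _ 2) => //; rewrite ?nnegrE ?nrm_ge0 ?ler01 //.
rewrite expr1n -nrm_star2 mu_star muME.
by apply: nrm_proj; rewrite ?mu_star ?muME ?mu_neq0.
Qed.

Lemma lin_entry c a a' b b' :
  e a a' * lin e c * e b' b = c a' b' *: e a b.
Proof.
rewrite /lin mulr_sumr mulr_suml (bigD1 a') //= [X in _ + X]big1 ?addr0; last first.
  move=> k ka; rewrite mulr_sumr mulr_suml big1 // => l _.
  by rewrite -scalerAr muM eq_sym (negPf ka) scaler0 mul0r.
rewrite mulr_sumr mulr_suml (bigD1 b') //= [X in _ + X]big1 ?addr0; last first.
  by move=> l lb; rewrite -scalerAr -scalerAl muME muM (negPf lb) scaler0.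
by rewrite -scalerAr -scalerAl !muME.
Qed.

Lemma lin_coef_le c a b : cnrm (c a b) <= nrm (lin e c).
Proof.
rewrite -[cnrm _]mulr1 -(mu_nrm a b) -nrmZ -(lin_entry c a a b b).
apply: le_trans (nrmM _ _) _; rewrite mu_nrm mulr1.
by apply: le_trans (nrmM _ _) _; rewrite mu_nrm mul1r.
Qed.

Lemma lin_inj c d : lin e c = lin e d -> forall a b, c a b = d a b.
Proof.
move=> h a b; have := lin_entry c a a b b; rewrite h lin_entry => /eqP.
rewrite -subr_eq0 -scalerBl scaler_eq0 (negPf (mu_neq0 _ _)) orbF subr_eq0.
by move/eqP.
Qed.

(** Together with [lin_coef_le] this compares the norms of the same matrix in two algebras up to the
    factor [#|I| * #|I|], which [relation_nrm_le] then removes. *)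
Lemma lin_le c (K : R) : (forall a b, cnrm (c a b) <= K) ->
  nrm (lin e c) <= #|I|%:R * (#|I|%:R * K).
Proof.
move=> cK; apply: le_trans (nrm_sum _ _) _.
have -> : #|I|%:R * (#|I|%:R * K) = \sum_(a : I) \sum_(b : I) K.
  by rewrite !sumr_const -[in RHS]mulr_natl -[in X in _ = _ * X]mulr_natl.
apply: ler_sum => a _; apply: le_trans (nrm_sum _ _) _.
by apply: ler_sum => b _; rewrite nrmZ mu_nrm mulr1.
Qed.

Lemma linL (k : R[i]) c d :
  k *: lin e c + lin e d = lin e (fun a b => k * c a b + d a b).
Proof.
rewrite /lin scaler_sumr -big_split; apply: eq_bigr => a _ /=.
rewrite scaler_sumr -big_split; apply: eq_bigr => b _ /=.
by rewrite scalerDl scalerA.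
Qed.

Lemma linM c d :
  lin e c * lin e d = lin e (fun a b => \sum_k c a k * d k b).
Proof.
rewrite /lin mulr_suml; apply: eq_bigr => a _.
rewrite mulr_suml.
under [RHS]eq_bigr do rewrite scaler_suml.
rewrite [RHS]exchange_big /=; apply: eq_bigr => k _.
rewrite mulr_sumr (bigD1 k) //= [X in _ + X]big1 ?addr0; last first.
  move=> l lk; rewrite mulr_sumr big1 // => b _.
  by rewrite -scalerAl -scalerAr muM eq_sym (negPf lk) !scaler0.
rewrite mulr_sumr; apply: eq_bigr => b _.
by rewrite -scalerAl -scalerAr muME scalerA.
Qed.

Lemma lin_star c : star (lin e c) = lin e (fun a b => Num.conj (c b a)).
Proof.
rewrite /lin star_sum exchange_big /=; apply: eq_bigr => a _.
rewrite star_sum; apply: eq_bigr => b _.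
by rewrite starZ mu_star.
Qed.

Lemma lin_unit a b : e a b = lin e (fun a' b' => ((a == a') && (b == b'))%:R).
Proof.
rewrite /lin (bigD1 a) //= (bigD1 b) //= !eqxx scale1r.
rewrite big1 ?addr0 => [|b' bb]; last by rewrite eq_sym (negPf bb) scale0r.
rewrite big1 ?addr0 // => a' aa; rewrite big1 // => b' _.
by rewrite eq_sym (negPf aa) scale0r.
Qed.

Lemma lin_one : 1 = lin e (fun a b => (a == b)%:R).
Proof.
rewrite -mu_sum; apply: eq_bigr => a _.
rewrite (bigD1 a) //= eqxx scale1r big1 ?addr0 // => b ab.
by rewrite eq_sym (negPf ab) scale0r.
Qed.

Lemma mspan1 : mspan e 1.
Proof. by eexists; exact: lin_one. Qed.
Lemma mspanL (k : R[i]) x y : mspan e x -> mspan e y -> mspan e (k *: x + y).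
Proof. by move=> [c ->] [d ->]; eexists; exact: linL. Qed.
Lemma mspanM x y : mspan e x -> mspan e y -> mspan e (x * y).
Proof. by move=> [c ->] [d ->]; eexists; exact: linM. Qed.
Lemma mspan_star x : mspan e x -> mspan e (star x).
Proof. by move=> [c ->]; eexists; exact: lin_star. Qed.
Lemma mspan_unit a b : mspan e (e a b).
Proof. by eexists; exact: lin_unit. Qed.
Lemma mspan0 : mspan e 0.
Proof. by exists (fun _ _ => 0); rewrite /lin big1 // => a _; rewrite big1 // => b _; rewrite scale0r. Qed.
Lemma mspanD x y : mspan e x -> mspan e y -> mspan e (x + y).
Proof. by move=> hx hy; rewrite -[x]scale1r; exact: mspanL. Qed.
Lemma mspanZ k x : mspan e x -> mspan e (k *: x).
Proof. by move=> hx; rewrite -[_ *: _]addr0; apply: mspanL => //; exact: mspan0. Qed.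
Lemma mspan_sum (J : finType) (P : pred J) (F : J -> A) :
  (forall j, P j -> mspan e (F j)) -> mspan e (\sum_(j | P j) F j).
Proof. by move=> h; elim/big_ind: _ => //; [exact: mspan0|exact: mspanD]. Qed.

Lemma units_expand x : x = \sum_a \sum_b e a a * x * e b b.
Proof.
rewrite -{1}[x]mul1r -{1}[1 * x]mulr1 -{1}mu_sum -mu_sum !mulr_suml.
by apply: eq_bigr => a _; rewrite mulr_sumr.
Qed.

End OneSystem.

Lemma mspan_sub (I J : finType) (e : I -> I -> A) (f : J -> J -> A) :
  munits f -> (forall a b, mspan f (e a b)) -> mspan e `<=` mspan f.
Proof.
move=> fP ef x [c ->]; apply: mspan_sum => // a _; apply: mspan_sum => // b _.
exact: mspanZ.
Qed.

Lemma munits_reindex (I J : finType) (e : I -> I -> A) (r : J -> I) :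
  bijective r -> munits e -> munits (fun a b => e (r a) (r b)).
Proof.
move=> rB [eM es e1]; split=> [a b c d|a b|]; rewrite ?eM ?es //.
  by rewrite (bij_eq rB).
by rewrite -e1 [RHS](reindex r) //; exact: onW_bij.
Qed.

Lemma mspan_reindex (I J : finType) (e : I -> I -> A) (r : J -> I) :
  bijective r -> munits e -> mspan (fun a b => e (r a) (r b)) = mspan e.
Proof.
move=> rB eP; have fP := munits_reindex rB eP; have [q qK rK] := rB.
rewrite eqEsubset; split; apply: mspan_sub => // a b.
  exact: mspan_unit.
by have := mspan_unit (fun a b => e (r a) (r b)) (q a) (q b); rewrite !rK.
Qed.

Definition mprod (I J : finType) (e : I -> I -> A) (f : J -> J -> A)
  (a b : I * J) : A := e a.1 b.1 * f a.2 b.2.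

Lemma munits_prod (I J : finType) (e : I -> I -> A) (f : J -> J -> A) :
  munits e -> munits f ->
  (forall a b c d, f a b * e c d = e c d * f a b) -> munits (mprod e f).
Proof.
move=> [eM es e1] [fM fs f1] fe; split.
- move=> [a a'] [b b'] [c c'] [d d']; rewrite /mprod /= mulrA -(mulrA (e a b)).
  rewrite fe mulrA eM -mulrA fM xpair_eqE.
  by rewrite mulrnAl mulrnAr -mulrnA mulnb andbC.
- by move=> [a a'] [b b']; rewrite /mprod /= starM es fs fe.
rewrite -[RHS]mulr1 -{1}e1 -f1 mulr_suml -(pair_bigA _ (fun a b => e a a * f b b)) /=.
by apply: eq_bigr => a _; rewrite mulr_sumr.
Qed.

End MatrixUnits.

Lemma star_morphism_munits (R : realType) (A B : cstarAlgType R) (f : A -> B)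
    (I : finType) (e : I -> I -> A) :
  star_morphism f -> munits e -> munits (fun a b => f (e a b)).
Proof.
move=> fP [eM es e1]; split=> [a b c d|a b|].
- by rewrite -(smM fP) eM; case: eqP; rewrite ?mulr0n ?mulr1n ?(sm0 fP).
- by rewrite -(sm_star fP) es.
- by rewrite -(sm_sum fP) e1 (sm1 fP).
Qed.

Lemma star_morphism_lin (R : realType) (A B : cstarAlgType R) (f : A -> B)
    (I : finType) (e : I -> I -> A) c :
  star_morphism f -> f (lin e c) = lin (fun a b => f (e a b)) c.
Proof.
move=> fP; rewrite /lin (sm_sum fP); apply: eq_bigr => a _.
by rewrite (sm_sum fP); apply: eq_bigr => b _; rewrite (smZ fP).
Qed.

(* A matrix algebra has only one C*-norm. *)
Lemma lin_nrm_eq (R : realType) (A B : cstarAlgType R) (I : finType)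
    (e : I -> I -> A) (f : I -> I -> B) c :
  munits e -> munits f -> nrm (lin e c) = nrm (lin f c).
Proof.
suff h (A' B' : cstarAlgType R) (e' : I -> I -> A') (f' : I -> I -> B') :
    munits e' -> munits f' -> nrm (lin e' c) <= nrm (lin f' c).
  by move=> eP fP; apply/eqP; rewrite eq_le !h.
move=> eP fP.
apply: (@relation_nrm_le _ _ _
  (fun x y => exists c, x = lin e' c /\ y = lin f' c) (#|I|%:R * #|I|%:R)).
- move=> x y x' y' [c1 [-> ->]] [c2 [-> ->]]; eexists.
  by split; [exact: linM eP _ _|exact: linM fP _ _].
- move=> x y [c1 [-> ->]]; eexists.
  by split; [exact: lin_star eP _|exact: lin_star fP _].
- move=> x y [c1 [-> ->]]; rewrite -mulrA; apply: (lin_le eP) => a b.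
  exact: lin_coef_le.
- by exists c.
Qed.

Section UnitCircle.
Variable R : realType.
Implicit Types x y : R.

Definition cis x : R[i] := cos x +i* sin x.

Lemma cis0 : cis 0 = 1.
Proof. by rewrite /cis cos0 sin0. Qed.

Lemma cisD x y : cis (x + y) = cis x * cis y.
Proof. by rewrite /cis cosD sinD [X in _ +i* X]addrC. Qed.

Lemma cis_conj x : Num.conj (cis x) = cis (- x).
Proof. by rewrite /cis cosN sinN. Qed.

Lemma cisNl x : cis (- x) * cis x = 1.
Proof. by rewrite -cisD addNr cis0. Qed.

Lemma cnrm_cis x : cnrm (cis x) = 1.
Proof.
by apply: complexI; rewrite -cnrmE normc_def /= cos2Dsin2 sqrtr1.
Qed.

Lemma lip1_at0 (f df : R -> R) x :
  (forall y, is_derive y 1 f (df y)) -> (forall y, `|df y| <= 1) ->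
  `|f x - f 0| <= `|x|.
Proof.
move=> fd df1.
have fc (i : interval R) : {within [set` i], continuous f}.
  by apply: derivable_within_continuous => y _; exact: ex_derive.
have key a b : a <= b -> `|f b - f a| <= `|b - a|.
  move=> ab; have [c _ ->] := MVT_segment ab (fun y _ => fd y) (fc _).
  by rewrite normrM ler_piMl.
have [x0|x0] := leP 0 x; first by have := key _ _ x0; rewrite subr0.
by have := key _ _ (ltW x0); rewrite sub0r normrN distrC.
Qed.

(** The constant 2 arises from bounding the modulus by |Re| + |Im|, each of which is 1-Lipschitz by
    the mean value theorem. *)
Lemma cnrm_cis1 x : cnrm (cis x - 1) <= 2 * `|x|.
Proof.
have cn (z : R[i]) : cnrm z <= `|complex.Re z| + `|complex.Im z|.
  rewrite -[leLHS]ger0_norm ?cnrm_ge0 // -ler_sqr ?nnegrE ?addr_ge0 //.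
  have -> : `|cnrm z| ^+ 2 = complex.Re z ^+ 2 + complex.Im z ^+ 2.
    by apply: complexI; rewrite ger0_norm ?cnrm_ge0 // rmorphXn /= -cnrmE -add_Re2_Im2.
  rewrite sqrrD !real_normK ?num_real // lerD2r lerDl mulrn_wge0 // mulr_ge0 //.
apply: le_trans (cn _) _; rewrite mulr2n mulrDl mul1r.
apply: lerD => /=.
  rewrite -{1}(cos0 R); apply: (@lip1_at0 _ (fun y => - sin y)) => y.
  by rewrite normrN sin_max.
by rewrite oppr0 addr0 -[sin x]subr0 -{1}(sin0 R); exact: (@lip1_at0 _ cos) (@cos_max R).
Qed.

Lemma cnrmM (z w : R[i]) : cnrm (z * w) = cnrm z * cnrm w.
Proof. by apply: complexI; rewrite rmorphM /= -!cnrmE normrM. Qed.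

Lemma cis_lip x y : cnrm (cis x - cis y) <= 2 * `|x - y|.
Proof.
have -> : cis x - cis y = (cis (x - y) - 1) * cis y.
  by rewrite mulrBl mul1r -cisD subrK.
by rewrite cnrmM cnrm_cis mulr1 cnrm_cis1.
Qed.

End UnitCircle.

Section Systems.
Variables (R : realType) (A : cstarAlgType R).
Implicit Types (k : nat -> nat) (e : nat -> nat -> nat -> A).

(** Units are stored as functions on [nat], so that the size of a factor does not enter its type;
    only the values below n have a meaning. *)
Definition ounits (n : nat) (e : nat -> nat -> A) : 'I_n -> 'I_n -> A :=
  fun a b => e a b.

Definition sys_units k e : set A :=
  [set x | exists j (a b : 'I_(k j)), x = e j a b].

(* An infinite tensor factorisation of A into matrix algebras of sizes k j. *)
Definition usystem k e : Prop :=
  [/\ forall j, munits (@ounits (k j) (e j)),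
      forall i j (a b : 'I_(k i)) (c d : 'I_(k j)), i != j ->
        e i a b * e j c d = e j c d * e i a b
    & generating (sys_units k e)].

(* sysE e n are matrix units, indexed by sysI k n, of the first n factors. *)
Fixpoint sysI k n : finType :=
  if n is m.+1 then (sysI k m * 'I_(k m))%type : finType else unit : finType.

Fixpoint sysE k e n : sysI k n -> sysI k n -> A :=
  if n is m.+1 then mprod (@sysE k e m) (@ounits (k m) (e m)) else fun _ _ => 1.

Section OneSystem.
Variables (k : nat -> nat) (e : nat -> nat -> nat -> A) (eP : usystem k e).

Lemma sysE_comm n j (a b : sysI k n) (c d : 'I_(k j)) : (n <= j)%N ->
  e j c d * sysE e a b = sysE e a b * e j c d.
Proof.
elim: n a b => [|n IH] a b nj /=; first by rewrite mulr1 mul1r.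
have [_ eC _] := eP.
have h1 := IH a.1 b.1 (ltnW nj).
have h2 : e j c d * e n a.2 b.2 = e n a.2 b.2 * e j c d by apply: eC; rewrite gtn_eqF.
by rewrite /mprod mulrA h1 -mulrA [in LHS]h2 mulrA.
Qed.

Lemma munits_sysE n : munits (@sysE k e n).
Proof.
elim: n => [|n IH] /=.
  split=> [a b c d|a b|]; first by case: b; case: c; rewrite mulr1.
    by rewrite star1.
  by rewrite big_const cardT enumT unlock /= addr0.
have [eM _ _] := eP; apply: munits_prod => // a b c d.
exact: sysE_comm.
Qed.

Lemma sysE_monoS n : mspan (@sysE k e n) `<=` mspan (@sysE k e n.+1).
Proof.
have uP := munits_sysE n.+1; have [eM _ _] := eP.
apply: mspan_sub => // a b; rewrite -[sysE e a b]mulr1 -(mu_sum (eM n)) mulr_sumr.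
by apply: mspan_sum => c _; exact: (mspan_unit (@sysE k e n.+1) (a, c) (b, c)).
Qed.

Lemma sysE_mono n m : (n <= m)%N -> mspan (@sysE k e n) `<=` mspan (@sysE k e m).
Proof.
move=> /subnK <-; elim: (m - n)%N => [//|d IH].
exact: subset_trans IH (@sysE_monoS _).
Qed.

Lemma sysE_unit j (a b : 'I_(k j)) : mspan (@sysE k e j.+1) (e j a b).
Proof.
rewrite -[e j a b]mul1r -(mu_sum (munits_sysE j)) mulr_suml.
by apply: mspan_sum => c _; exact: (mspan_unit (@sysE k e j.+1) (c, a) (c, b)).
Qed.

(** The limits of elements of the increasing matrix spans form a closed subalgebra, and it contains
    the generators. *)
Lemma sysE_dense x (r : R) : 0 < r ->
  exists n y, mspan (@sysE k e n) y /\ nrm (x - y) < r.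
Proof.
have [_ _ gen] := eP.
pose S := [set x | forall r : R, 0 < r ->
  exists n y, mspan (@sysE k e n) y /\ nrm (x - y) < r].
have Ssub n y : mspan (@sysE k e n) y -> S y.
  by move=> h r0 r0P; exists n, y; split; rewrite // subrr nrm0.
have Sseq y : S y -> exists (u : nat -> A) (N : nat -> nat),
    ncvg u y /\ forall n, mspan (@sysE k e (N n)) (u n).
  move=> Sy; have p0 n : 0 < (2^-1 : R) ^+ n by rewrite exprn_gt0 // invr_gt0.
  have /choice[uv huv] : forall n, exists p : A * nat,
    mspan (@sysE k e p.2) p.1 /\ nrm (y - p.1) < (2^-1) ^+ n.
    by move=> n; have [m [z hz]] := Sy _ (p0 n); exists (z, m).
  exists (fun n => (uv n).1), (fun n => (uv n).2); split; last by move=> n; case: (huv n).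
  have r0 : 0 <= 2^-1 :> R by rewrite invr_ge0.
  have r1 : 2^-1 < 1 :> R by rewrite invf_lt1 // ltr1n.
  by apply: (ncvg_geo ler01 r0 r1) => n; rewrite mul1r; case: (huv n) => _ /ltW.
have Slim (u : nat -> A) y : ncvg u y -> (forall n, exists m, mspan (@sysE k e m) (u n)) -> S y.
  move=> uy hu r0 r0P; have [n hn] := uy _ r0P; have [m hm] := hu n.
  by exists m, (u n); split; last exact: hn.
move: x r; apply: (gen S); last first.
  by move=> _ [j [a [b ->]]]; apply: Ssub (sysE_unit a b).
split.
- exact: (Ssub 0%N) (mspan1 (munits_sysE 0)).
- move=> c x y /Sseq[u [N [ux uN]]] /Sseq[v [M [vy vM]]].
  apply: (Slim (fun n => c *: u n + v n)); first by apply: ncvgD => //; exact: ncvgZ.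
  move=> n; exists (maxn (N n) (M n)); apply: mspanL.
    by apply: sysE_mono (uN n); rewrite leq_maxl.
  by apply: sysE_mono (vM n); rewrite leq_maxr.
- move=> x y /Sseq[u [N [ux uN]]] /Sseq[v [M [vy vM]]].
  apply: (Slim (fun n => u n * v n)); first exact: ncvgM.
  move=> n; exists (maxn (N n) (M n)); apply: mspanM (munits_sysE _) _ _ _ _.
    by apply: sysE_mono (uN n); rewrite leq_maxl.
  by apply: sysE_mono (vM n); rewrite leq_maxr.
- move=> x h r0 r0P; have r2 : 0 < r0 / 2 by rewrite divr_gt0.
  have [y Sy xy] := h _ r2; have [n [z [zS yz]]] := Sy _ r2.
  exists n, z; split=> //; apply: le_lt_trans (nrmBD _ _ y) _.
  by rewrite [r0]splitr; exact: ltrD.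
Qed.

End OneSystem.
End Systems.

(** Two elements are related when they have the same coefficients over the first n factors. Passing
    to more factors replaces the coefficient matrix c by c (x) 1 in both algebras, so any two
    related pairs can be compared at a common level, and uniqueness of the C*-norm of a matrix
    algebra makes the relation isometric. *)
Lemma usystem_isomorphism (R : realType) (A B : cstarAlgType R) (k : nat -> nat)
    (e : nat -> nat -> nat -> A) (f : nat -> nat -> nat -> B) :
  usystem k e -> usystem k f ->
  exists (phi : A -> B) (psi : B -> A),
    [/\ star_isomorphism phi, cancel phi psi, cancel psi phi
      & forall j (a b : 'I_(k j)), phi (e j a b) = f j a b].
Proof.
move=> eP fP.
pose G x y := exists n c, x = lin (@sysE R A k e n) c /\ y = lin (@sysE R B k f n) c.
have raise n m c : (n <= m)%N -> exists c',
    lin (@sysE R A k e n) c = lin (@sysE R A k e m) c' /\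
    lin (@sysE R B k f n) c = lin (@sysE R B k f m) c'.
  move=> /subnK <-; elim: (m - n)%N => [|d [c' [-> ->]]]; first by exists c.
  have up (A' : cstarAlgType R) (e' : nat -> nat -> nat -> A') : usystem k e' ->
      lin (@sysE R A' k e' (d + n)) c' =
      lin (@sysE R A' k e' (d.+1 + n))
        (fun a b => c' a.1 b.1 *+ (a.2 == b.2)).
    move=> e'P; have [eM _ _] := e'P; rewrite /lin /=.
    rewrite -(pair_bigA _ (fun a i => \sum_(b : sysI k (d + n) * 'I_(k (d + n)))
       (c' a b.1 *+ (i == b.2)) *: mprod (@sysE R A' k e' (d + n))
       (@ounits R A' (k (d + n)) (e' (d + n)%N)) (a, i) b)) /=.
    apply: eq_bigr => a _; rewrite exchange_big /=.
    under eq_bigr do rewrite -[sysE _ _ _]mulr1 -(mu_sum (eM (d + n)%N)) mulr_sumr scaler_sumr.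
    rewrite (pair_bigA _ (fun b i => c' a b *: (sysE e' a b * ounits (e' (d + n)%N) i i))) /=.
    apply: eq_bigr => -[b j] _ /=; rewrite (bigD1 j) //= eqxx big1 ?addr0 // => i ij.
    by rewrite (negPf ij) scale0r.
  by eexists; split; [exact: up|exact: up].
have join n c m d : exists N c' d',
  [/\ lin (@sysE R A k e n) c = lin (@sysE R A k e N) c',
      lin (@sysE R B k f n) c = lin (@sysE R B k f N) c',
      lin (@sysE R A k e m) d = lin (@sysE R A k e N) d' &
      lin (@sysE R B k f m) d = lin (@sysE R B k f N) d'].
  have [c' [h1 h2]] := raise n _ c (leq_maxl n m).
  have [d' [h3 h4]] := raise m _ d (leq_maxr n m).
  by exists (maxn n m), c', d'.
have [||||||| phi [psi [h1 h2 h3 h4]]] := @star_isomorphism_of_relation _ _ _ G.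
- exists 0%N; eexists; split.
    exact: lin_one (munits_sysE eP 0).
  exact: lin_one (munits_sysE fP 0).
- move=> c x y x' y' [n [d [-> ->]]] [m [d' [-> ->]]].
  have [N [c1 [c2 [-> -> -> ->]]]] := join n d m d'; exists N.
  by eexists; split; exact: linL.
- move=> x y x' y' [n [d [-> ->]]] [m [d' [-> ->]]].
  have [N [c1 [c2 [-> -> -> ->]]]] := join n d m d'; exists N.
  by eexists; split; [exact: linM (munits_sysE eP N) _ _|exact: linM (munits_sysE fP N) _ _].
- move=> x y [n [d [-> ->]]]; exists n; eexists.
  by split; [exact: lin_star (munits_sysE eP n) _|exact: lin_star (munits_sysE fP n) _].
- by move=> x y [n [c [-> ->]]]; apply: lin_nrm_eq; exact: munits_sysE.
- move=> x r /(sysE_dense eP x)[n [_ [[c ->] h]]].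
  by eexists; exists (lin (@sysE R B k f n) c); split; last exact: h; exists n, c.
- move=> x r /(sysE_dense fP x)[n [_ [[c ->] h]]].
  by exists (lin (@sysE R A k e n) c); eexists; split; last exact: h; exists n, c.
exists phi, psi; split=> // j a b; apply: h4; exists j.+1.
have unitE (A' : cstarAlgType R) (e' : nat -> nat -> nat -> A') : usystem k e' ->
   e' j a b = lin (@sysE R A' k e' j.+1)
     (fun x y => ((x.1 == y.1) && ((a == x.2) && (b == y.2)))%:R).
  move=> e'P; have [eM _ _] := e'P.
  rewrite -[e' j a b]mul1r -(mu_sum (munits_sysE e'P j)) mulr_suml /lin /=.
  rewrite -(pair_bigA _ (fun x i => \sum_(y : sysI k j * 'I_(k j))
     ((x == y.1) && ((a == i) && (b == y.2)))%:R *: mprod (@sysE R A' k e' j)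
       (@ounits R A' (k j) (e' j)) (x, i) y)) /=.
  apply: eq_bigr => x _; rewrite exchange_big /= (bigD1 (x, b)) //= [X in _ + X]big1 ?addr0.
    rewrite (bigD1 a) //= !eqxx scale1r big1 ?addr0 // => i ia.
    by rewrite eq_sym (negPf ia) scale0r.
  move=> [y i]; rewrite xpair_eqE negb_and => /orP[h|h]; apply: big1 => l _ /=.
    by rewrite eq_sym (negPf h) scale0r.
  by rewrite [b == i]eq_sym (negPf h) !andbF scale0r.
by eexists; split; exact: unitE.
Qed.

(** * Product flows and their cocycle perturbations *)

Section Unitaries.
Variables (R : realType) (A : cstarAlgType R).

Lemma star_morphism_ad (u : A) : unitary u -> star_morphism (fun x => u * x * star u).
Proof.
move=> [u1 u2]; split=> [c x y||x].
- by rewrite mulrDr mulrDl -scalerAr -scalerAl.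
- split=> [|x y] /=; first by rewrite mulr1.
  by rewrite !mulrA -[u * x * star u * u]mulrA u1 mulr1.
- by rewrite !starM starK mulrA.
Qed.

End Unitaries.

Section LabelledFlows.
Variables (R : realType) (A : cstarAlgType R).
Variables (k : nat -> nat) (e : nat -> nat -> nat -> A) (eP : usystem k e).

(* alpha acts on the j-th factor as Ad (exp (i t diag (nu j))). *)
Definition labelled (nu : nat -> nat -> R) (alpha : R -> A -> A) : Prop :=
  forall t j (a b : 'I_(k j)), alpha t (e j a b) = cis (t * (nu j a - nu j b)) *: e j a b.

(** These are the units conjugated, factor by factor, by diagonal unitaries. The infinite product of
    those unitaries need not converge, yet the rephased units form a factorisation of the same
    algebra. *)
Lemma usystem_phase (th : nat -> nat -> R) :
  usystem k (fun j a b => cis (th j a - th j b) *: e j a b).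
Proof.
have [eM eC eG] := eP; split.
- move=> j; have [jM js j1] := eM j; split=> [a b c d|a b|]; rewrite /ounits.
  + have := jM a b c d; rewrite /ounits -scalerAr -scalerAl => ->.
    case: eqP => [->|_]; last by rewrite !mulr0n !scaler0.
    by rewrite !mulr1n scalerA -cisD addrC addrA subrK.
  + by have := js a b; rewrite /ounits starZ => ->; rewrite cis_conj opprB.
  + by rewrite -j1; apply: eq_bigr => a _; rewrite subrr cis0 scale1r.
- move=> i j a b c d ij; rewrite -!scalerAl -!scalerAr eC //.
  by rewrite !scalerA mulrC.
- move=> S SP h; apply: eG => // _ [j [a [b ->]]].
  have := csubZ SP (cis (- (th j a - th j b))) (h _ (ex_intro _ j (ex_intro _ a (ex_intro _ b erefl)))).
  by rewrite scalerA cisNl scale1r.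
Qed.

(** For each t the automorphism matches the units with their rephased copies, and the group law is
    checked on generators. Elements with norm-continuous orbit form a closed subalgebra; limits are
    covered because the automorphisms are contractive. *)
Lemma labelled_flow_exists (nu : nat -> nat -> R) :
  exists alpha, flow alpha /\ labelled nu alpha.
Proof.
have [eM eC eG] := eP.
have /choice[al alP] : forall t, exists f : A -> A, star_isomorphism f /\
    forall j (a b : 'I_(k j)), f (e j a b) = cis (t * (nu j a - nu j b)) *: e j a b.
  move=> t; have := usystem_phase (fun j a => t * nu j a).
  move=> /(usystem_isomorphism eP)[f [g [fP _ _ fE]]]; exists f; split=> // j a b.
  by rewrite fE mulrBr.
have alM t : star_morphism (al t) by case: (alP t) => -[].
exists al; split; last by move=> t j a b; case: (alP t) => _ ->.
split.
- by move=> t; case: (alP t).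
- apply: (star_morphism_eq (alM 0) (star_morphism_id _) eG) => _ [j [a [b ->]]].
  by case: (alP 0) => _ ->; rewrite mul0r cis0 scale1r.
- move=> s t; apply: (star_morphism_eq (alM _) (star_morphism_comp (alM t) (alM s)) eG).
  move=> _ [j [a [b ->]]] /=; have [_ ->] := alP (s + t); have [_ ->] := alP t.
  by rewrite (smZ (alM s)); have [_ ->] := alP s; rewrite scalerA -cisD -mulrDl addrC.
move=> x; apply/continuous_nrmP.
move: x; apply: (eG [set x | forall t (r : R), 0 < r -> exists2 d : R, 0 < d &
    forall s, `|t - s| < d -> nrm (al t x - al s x) < r]); last first.
  move=> _ [j [a [b ->]]] t r r0 /=; set c := nu j a - nu j b.
  have c0 : 0 < 2 * `|c| + 1 by have := normr_ge0 c; lra.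
  exists (r / (2 * `|c| + 1)); first exact: divr_gt0.
  move=> s; rewrite ltr_pdivlMr // => hs.
  have [_ ->] := alP t; have [_ ->] := alP s; rewrite -/c -scalerBl nrmZ.
  rewrite (mu_nrm (eM j) a b) mulr1; apply: le_lt_trans (cis_lip _ _) _.
  rewrite -mulrBl normrM; apply: le_lt_trans hs.
  by have := normr_ge0 (t - s); have := normr_ge0 c; nra.
split=> /=.
- by move=> t r r0; exists 1 => // s _; rewrite !(sm1 (alM _)) subrr nrm0.
- move=> c x y hx hy t r r0.
  have c0 : 0 < cnrm c + 1 by have := cnrm_ge0 c; lra.
  have r1 : 0 < r / 2 / (cnrm c + 1) by rewrite !divr_gt0.
  have r2 : 0 < r / 2 by rewrite divr_gt0.
  have [d d0 hd] := hx t _ r1; have [d' d'0 hd'] := hy t _ r2.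
  exists (Num.min d d'); first by rewrite lt_min d0.
  move=> s; rewrite lt_min => /andP[/hd h1 /hd' h2].
  rewrite !(smD (alM _)) !(smZ (alM _)) opprD addrACA -scalerBr.
  apply: le_lt_trans (nrmD _ _) _; rewrite nrmZ.
  move: h1; rewrite ltr_pdivlMr //; have := nrm_ge0 (al t x - al s x).
  have := cnrm_ge0 c; move: h2; move: (nrm _) (nrm _) (cnrm _) => p q z; nra.
- move=> x y hx hy t r r0.
  have C0 : 0 < nrm x + nrm y + 1 by have := nrm_ge0 x; have := nrm_ge0 y; lra.
  have r1 : 0 < r / (nrm x + nrm y + 1) by rewrite divr_gt0.
  have [d d0 hd] := hx t _ r1; have [d' d'0 hd'] := hy t _ r1.
  exists (Num.min d d'); first by rewrite lt_min d0.
  move=> s; rewrite lt_min => /andP[/hd h1 /hd' h2].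
  rewrite !(smM (alM _)); apply: le_lt_trans (nrmMB _ _ _ _) _.
  move: h1 h2; rewrite !ltr_pdivlMr // => h1 h2.
  have := sm_nrm (alM t) y; have := sm_nrm (alM s) x.
  have := nrm_ge0 (al s x); have := nrm_ge0 (al t y).
  have := nrm_ge0 x; have := nrm_ge0 y.
  have := nrm_ge0 (al t x - al s x); have := nrm_ge0 (al t y - al s y); move: h1 h2.
  move: (nrm (al t x - al s x)) (nrm (al t y - al s y)) (nrm (al s x)) (nrm (al t y)).
  move: (nrm x) (nrm y) => X Y p q X' Y' *.
  have : p * Y' <= p * Y by apply: ler_wpM2l.
  have : X' * q <= X * q by apply: ler_wpM2r.
  nra.
move=> x h t r r0; have r3 : 0 < r / 3 by rewrite divr_gt0.
have [y hy xy] := h _ r3; have [d d0 hd] := hy t _ r3; exists d => // s /hd h1.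
have h2 := sm_nrmB (alM t) x y; have h3 := sm_nrmB (alM s) y x.
have h4 := nrmBD (al t x) (al s x) (al t y).
have h5 := nrmBD (al t y) (al s x) (al s y).
by rewrite [nrm (y - x)]nrmB in h3; lra.
Qed.

Lemma labelled_sysE (nu : nat -> nat -> R) (alpha : R -> A -> A) n :
  flow alpha -> labelled nu alpha ->
  exists ph : sysI k n -> R, forall t a b,
    alpha t (sysE e a b) = cis (t * (ph a - ph b)) *: (sysE e a b : A).
Proof.
move=> [fI _ _ _] fL; have aM t : star_morphism (alpha t) by case: (fI t).
elim: n => [|n [ph IH]].
  by exists (fun _ => 0) => t a b /=; rewrite (sm1 (aM t)) subrr mulr0 cis0 scale1r.
exists (fun a : sysI k n * 'I_(k n) => ph a.1 + nu n a.2) => t a b; rewrite /= /mprod (smM (aM t)) IH fL.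
rewrite -scalerAl -scalerAr scalerA -cisD -mulrDr; congr (cis (_ * _) *: _).
by rewrite opprD addrACA.
Qed.

Lemma full_matrix_mspan n (f : 'I_n.+1 -> 'I_n.+1 -> A) :
  munits f -> full_matrix_subalgebra (mspan f).
Proof.
move=> fP; exists n, (fun M : 'M[R[i]]_n.+1 => lin f M); split.
- move=> c M N; rewrite linL /lin; apply: eq_bigr => a _; apply: eq_bigr => b _.
  by rewrite !mxE.
- move=> M N; rewrite linM // /lin; apply: eq_bigr => a _; apply: eq_bigr => b _.
  by rewrite !mxE.
- move=> M; rewrite lin_star // /lin; apply: eq_bigr => a _; apply: eq_bigr => b _.
  by rewrite !mxE.
- by move=> M N /(lin_inj fP) h; apply/matrixP.
rewrite eqEsubset; split=> x.
  by case=> M _ <-; exists M.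
case=> c ->; exists (\matrix_(a, b) c a b) => //.
by rewrite /lin; apply: eq_bigr => a _; apply: eq_bigr => b _; rewrite !mxE.
Qed.

Lemma munits_ord (I : finType) (f : I -> I -> A) : munits f ->
  exists n, #|I| = n.+1 /\ exists g : 'I_n.+1 -> 'I_n.+1 -> A, munits g /\ mspan g = mspan f.
Proof.
move=> fP; have [a _] := mu_inh fP.
have : (0 < #|I|)%N by apply/card_gt0P; exists a.
case E : #|I| => [//|n] _; exists n; split=> //.
pose r (i : 'I_n.+1) : I := enum_val (cast_ord (esym E) i).
have rB : bijective r.
  exists (fun x => cast_ord E (enum_rank x)) => x; rewrite /r.
    by rewrite enum_valK cast_ordKV.
  by rewrite cast_ordK enum_rankK.
exists (fun a b => f (r a) (r b)); split; first exact: munits_reindex.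
exact: mspan_reindex.
Qed.

Lemma labelled_UHF_flow (nu : nat -> nat -> R) (alpha : R -> A -> A) :
  flow alpha -> labelled nu alpha -> UHF_flow alpha.
Proof.
move=> fP fL; split=> //; exists (fun n => mspan (@sysE R A k e n)).
have [fI f0 fD _] := fP; have aM t : star_morphism (alpha t) by case: (fI t).
split; last first.
  have inv n t x : mspan (@sysE R A k e n) x -> mspan (@sysE R A k e n) (alpha t x).
    have [ph hph] := labelled_sysE n fP fL.
    move=> [c ->]; rewrite (star_morphism_lin _ _ (aM t)).
    apply: mspan_sum => // a _; apply: mspan_sum => // b _; rewrite hph.
    by apply/mspanZ/mspanZ/mspan_unit.
  move=> n t; rewrite eqEsubset; split=> [_ [x h <-]|x h]; first exact: inv.
  by exists (alpha (- t) x); [exact: inv|rewrite -fD subrr f0].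
split.
- move=> n; have [m [_ [g [gP <-]]]] := munits_ord (munits_sysE eP n).
  exact: full_matrix_mspan.
- exact: sysE_monoS.
- exact: mspan1 (munits_sysE eP 0).
rewrite eqEsubset; split=> // x _; apply/closureP => r /(sysE_dense eP x)[n [y [hy xy]]].
by exists y => //; exists n.
Qed.

End LabelledFlows.

Section CocyclePerturbation.
Variables (R : realType) (A : cstarAlgType R).
Variables (k : nat -> nat) (e : nat -> nat -> nat -> A) (eP : usystem k e).
Variables (nu nu' : nat -> nat -> R) (tau tau' : R -> A -> A).
Hypotheses (tauP : flow tau) (tauL : labelled k e nu tau).
Hypotheses (tau'P : flow tau') (tau'L : labelled k e nu' tau').
Hypothesis nu_close :
  forall j, \sum_(a < k j) `|nu j a - nu' j a| <= (2^-1 : R) ^+ j.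

Let delta j a := nu j a - nu' j a.
(** [w j t] is exp (i t diag (delta j)) in the j-th factor, and [U n t] is the product over the
    first n factors. All of these commute, so each [U n] is a one-parameter group of unitaries. *)
Let w j t : A := \sum_(a < k j) cis (t * delta j a) *: e j a a.
Let U n t : A := iteri n (fun j x => x * w j t) 1.

Let eM j : munits (@ounits R A (k j) (e j)).
Proof. by case: eP. Qed.

Let w_unit j t (a b : 'I_(k j)) : w j t * e j a b = cis (t * delta j a) *: e j a b.
Proof.
rewrite /w mulr_suml (bigD1 a) //= [X in _ + X]big1 ?addr0; last first.
  move=> c ca; have := muM (eM j) c c a b; rewrite /ounits -scalerAl => ->.
  by rewrite (negPf ca) scaler0.
by have := muME (eM j) a a b; rewrite /ounits -scalerAl => ->.
Qed.

Let w_star j t : star (w j t) = w j (- t).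
Proof.
rewrite /w star_sum; apply: eq_bigr => a _; have := mu_star (eM j) a a.
by rewrite /ounits starZ => ->; rewrite cis_conj mulNr.
Qed.

Let unit_w j t (a b : 'I_(k j)) : e j a b * w j t = cis (t * delta j b) *: e j a b.
Proof.
rewrite /w mulr_sumr (bigD1 b) //= [X in _ + X]big1 ?addr0; last first.
  move=> c cb; have := muM (eM j) a b c c; rewrite /ounits -scalerAr => ->.
  by rewrite eq_sym (negPf cb) scaler0.
by have := muME (eM j) a b b; rewrite /ounits -scalerAr => ->.
Qed.

Let wD j s t : w j (s + t) = w j s * w j t.
Proof.
rewrite [w j t]/w mulr_sumr; apply: eq_bigr => a _.
by rewrite -scalerAr w_unit scalerA -cisD -mulrDl addrC.
Qed.

Let w0 j : w j 0 = 1.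
Proof.
rewrite -(mu_sum (eM j)); apply: eq_bigr => a _.
by rewrite mul0r cis0 scale1r.
Qed.

Let w_comm_unit i j t (a b : 'I_(k j)) : i != j -> w i t * e j a b = e j a b * w i t.
Proof.
move=> ij; rewrite /w mulr_suml mulr_sumr; apply: eq_bigr => c _.
by have [_ eC _] := eP; rewrite -scalerAl -scalerAr eC.
Qed.

Let w_comm i j s t : w i s * w j t = w j t * w i s.
Proof.
have [->|ij] := eqVneq i j; first by rewrite -!wD addrC.
rewrite {1 2}[w j t]/w mulr_sumr mulr_suml; apply: eq_bigr => c _.
by rewrite -scalerAl -scalerAr w_comm_unit.
Qed.

Let U_comm_unit n j t (a b : 'I_(k j)) : (n <= j)%N -> U n t * e j a b = e j a b * U n t.
Proof.
elim: n => [|n IH] nj /=; first by rewrite mul1r mulr1.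
rewrite -/(U n t) -mulrA w_comm_unit ?ltn_eqF // mulrA IH 1?ltnW //.
by rewrite mulrA.
Qed.

Let U_comm_w n j s t : U n t * w j s = w j s * U n t.
Proof.
elim: n => [|n IH] /=; first by rewrite mul1r mulr1.
by rewrite -/(U n t) -mulrA w_comm mulrA IH mulrA.
Qed.

Let UD n s t : U n (s + t) = U n s * U n t.
Proof.
elim: n => [|n IH] /=; first by rewrite mul1r.
rewrite -!/(U n _) IH wD !mulrA; congr (_ * _); rewrite -!mulrA; congr (_ * _).
exact: U_comm_w.
Qed.

Let U0 n : U n 0 = 1.
Proof. by elim: n => [//|n IH] /=; rewrite -/(U n 0) IH w0 mul1r. Qed.

Let U_star n t : star (U n t) = U n (- t).
Proof.
elim: n => [|n IH] /=; first exact: star1.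
by rewrite -!/(U n _) starM IH w_star U_comm_w.
Qed.

Let U_nrm n t : nrm (U n t) = 1.
Proof. by apply: unitary_nrm; rewrite U_star -UD addNr U0. Qed.

Let w_near1 j t : nrm (w j t - 1) <= 2 * `|t| * (2^-1) ^+ j.
Proof.
rewrite -(mu_sum (eM j)) -sumrB; apply: le_trans (nrm_sum _ _) _.
apply: le_trans (ler_wpM2l _ (nu_close j)); last by rewrite mulr_ge0.
rewrite mulr_sumr; apply: ler_sum => a _; rewrite /ounits.
rewrite -[X in _ - X]scale1r -scalerBl nrmZ (mu_nrm (eM j) a a) mulr1.
by apply: le_trans (cnrm_cis1 _) _; rewrite normrM mulrA.
Qed.

Let r0 : 0 <= 2^-1 :> R. Proof. by rewrite invr_ge0. Qed.
Let r1 : 2^-1 < 1 :> R. Proof. by rewrite invf_lt1 // ltr1n. Qed.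

Let U_conj n t j (a b : 'I_(k j)) : (j < n)%N ->
  U n t * e j a b * U n (- t) = cis (t * (delta j a - delta j b)) *: e j a b.
Proof.
elim: n => [//|n IH]; rewrite ltnS leq_eqVlt => /predU1P[<-|jn] /=; rewrite -!/(U _ _).
  rewrite [U j (- t) * _]U_comm_w -[U j t * _ * _]mulrA w_unit -scalerAr -scalerAl.
  rewrite mulrA -[_ * e j a b * _]mulrA unit_w -scalerAr -scalerAl scalerA.
  rewrite U_comm_unit // -mulrA.
  rewrite -UD subrr U0 mulr1 -cisD.
  by rewrite mulNr -mulrBr.
rewrite [U n (- t) * _]U_comm_w -[U n t * _ * _]mulrA w_comm_unit ?gtn_eqF //.
rewrite !mulrA -[_ * w n t * _]mulrA -wD subrr w0 mulr1; exact: IH.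
Qed.

(* The cocycle is the norm convergent infinite product of the unitaries w j t. *)
Lemma labelled_cocycle_perturbation : cocycle_perturbation tau tau'.
Proof.
have [tI _ _ _] := tauP; have tM t : star_morphism (tau t) by case: (tI t).
have [t'I _ _ _] := tau'P; have t'M t : star_morphism (tau' t) by case: (t'I t).
(* 4|t| is the tail bound 2|t| / (1 - 1/2) at n = 0. It gives continuity of u at 0, and the group
   law spreads it to all t. *)
have /choice[u uP] : forall t, exists l, ncvg (U^~ t) l /\ nrm (l - 1) <= 4 * `|t|.
  move=> t; have t0 : 0 <= 2 * `|t| by rewrite mulr_ge0.
  have [|l Ul hl] := @geo_cvg R A (U^~ t) (2 * `|t|) 2^-1 t0 r0 r1.
    move=> n /=; rewrite -/(U n t) -[X in _ - X]mulr1 -mulrBr.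
    by apply: le_trans (nrmM _ _) _; rewrite U_nrm mul1r w_near1.
  exists l; split=> //; have := hl 0%N; rewrite expr0 mulr1 /= => h.
  apply: le_trans h _; have -> : 1 - 2^-1 = 2^-1 :> R by lra.
  by rewrite invrK; lra.
have ucvg t : ncvg (U^~ t) (u t) by case: (uP t).
have uD s t : u (s + t) = u s * u t.
  apply: (ncvg_uniq (ucvg _)).
  suff -> : U^~ (s + t) = (fun n => U n s * U n t) by exact: ncvgM.
  by apply/funext => n; exact: UD.
have u0 : u 0 = 1.
  apply: (ncvg_uniq (ucvg _)).
  suff -> : U^~ 0 = (fun n => 1) by exact: ncvg_const.
  by apply/funext => n; exact: U0.
have us t : star (u t) = u (- t).
  apply: (ncvg_uniq (ncvg_star (ucvg _))).
  suff -> : (fun n => star (U n t)) = U^~ (- t) by [].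
  by apply/funext => n; exact: U_star.
have uU t : unitary (u t) by rewrite /unitary us -!uD addNr subrr u0.
have fix_w s j t : tau' s (w j t) = w j t.
  rewrite /w (sm_sum (t'M s)); apply: eq_bigr => a _.
  by rewrite (smZ (t'M s)) tau'L subrr mulr0 cis0 scale1r.
have fix_U s n t : tau' s (U n t) = U n t.
  elim: n => [|n IH] /=; first exact: sm1 (t'M s).
  by rewrite -!/(U _ _) (smM (t'M s)) IH fix_w.
(* Since [tau'] fixes u, the cocycle identity is the group law of u. *)
have fix_u s t : tau' s (u t) = u t.
  apply: (ncvg_uniq (ncvg_lip (C := 1) _ (ucvg t))).
    by move=> x y; rewrite mul1r; exact: sm_nrmB.
  suff -> : tau' s \o U^~ t = U^~ t by [].
  by apply/funext => n; exact: fix_U.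
exists u; split.
  split=> //; last by move=> s t; rewrite fix_u uD.
  apply/continuous_nrmP => t r r_gt0; exists (r / 4); first by rewrite divr_gt0.
  move=> s; rewrite ltr_pdivlMr // => hs.
  have -> : u t - u s = u s * (u (t - s) - 1).
    by rewrite mulrBr mulr1 -uD [s + _]addrC subrK.
  apply: le_lt_trans (nrmM _ _) _; rewrite (unitary_nrm (proj1 (uU s))) mul1r.
  by apply: le_lt_trans (proj2 (uP _)) _; rewrite mulrC.
move=> t; have [_ _ eG] := eP.
apply: (star_morphism_eq (tM t) (star_morphism_comp (t'M t) (star_morphism_ad (uU t))) eG).
move=> _ [j [a [b ->]]] /=; rewrite tauL tau'L -scalerAr -scalerAl us.
have -> : u t * e j a b * u (- t) = cis (t * (delta j a - delta j b)) *: e j a b.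
  apply: (ncvg_uniq (ncvgM (ncvgM (ucvg t) (ncvg_const (e j a b))) (ucvg (- t)))).
  move=> r r_gt0; exists j.+1 => n jn; rewrite U_conj // subrr nrm0 //.
rewrite scalerA -cisD -mulrDr; congr (cis (_ * _) *: _).
by rewrite /delta opprB addrCA !addrA; ring.
Qed.

End CocyclePerturbation.

(** * Relative commutants *)

Import sesquilinear spectral.
Local Open Scope sesquilinear_scope.

(** Rank and nullity in the form used by the dimension counts below: more vectors than
    coordinates. *)
Lemma linear_dependence (F : fieldType) (T J : finType) (w : T -> J -> F) :
  (#|J| < #|T|)%N ->
  exists c : T -> F, (exists s, c s != 0) /\ forall j, \sum_s c s * w s j = 0.
Proof.
move=> h; pose M : 'M[F]_(#|T|, #|J|) := \matrix_(i, j) w (enum_val i) (enum_val j).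
have : kermx M != 0.
  rewrite -mxrank_eq0 mxrank_ker -lt0n subn_gt0.
  exact: leq_ltn_trans (rank_leq_col _) h.
case/rowV0Pn => v /sub_kermxP vM v0; exists (fun t => v 0 (enum_rank t)); split.
  have [i vi] : exists i, v 0 i != 0.
    apply/existsP; apply: contra_neqT v0; rewrite negb_exists => /forallP h0.
    by apply/rowP => i; have := h0 i; rewrite negbK mxE => /eqP.
  by exists (enum_val i); rewrite enum_valK.
move=> j; have /rowP/(_ (enum_rank j)) := vM; rewrite !mxE => {2}<-.
rewrite (reindex (@enum_val T predT)) /=; last exact/onW_bij/enum_val_bij.
by apply: eq_bigr => i _; rewrite !mxE enum_valK enum_rankK.
Qed.

Section FiniteMatrixAlgebra.
Variables (R : realType) (A : cstarAlgType R).

(** The [#|I|^2] units [e a b] are linearly independent and lie in a space spanned by [#|J|^2]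
    elements. *)
Lemma mspan_card (I J : finType) (e : I -> I -> A) (P : J -> J -> A) :
  munits e -> munits P -> (forall a b, mspan P (e a b)) -> (#|I| <= #|J|)%N.
Proof.
move=> eP PP eIn; rewrite leqNgt; apply/negP => lt.
have /choice[w wE] : forall s : I * I, exists c : J * J -> R[i],
    e s.1 s.2 = \sum_i \sum_j c (i, j) *: P i j.
  by move=> s; have [c ->] := eIn s.1 s.2; exists (fun p => c p.1 p.2).
have [|c [[s cs] cw]] := @linear_dependence _ _ _ w.
  by rewrite !card_prod; apply: ltn_mul.
have /(lin_inj eP)/(_ s.1 s.2) : lin e (fun a b => c (a, b)) = lin e (fun _ _ => 0).
  transitivity (0 : A); last first.
    by rewrite /lin big1 // => a _; rewrite big1 // => b _; rewrite scale0r.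
  rewrite /lin (pair_bigA _ (fun a b => c (a, b) *: e a b)) /=.
  under eq_bigr do rewrite wE scaler_sumr.
  rewrite exchange_big big1 //= => i _.
  under eq_bigr do rewrite scaler_sumr.
  rewrite exchange_big big1 //= => j _.
  rewrite -[RHS](scale0r (P i j)) -(cw (i, j)) scaler_suml; apply: eq_bigr => -[a b] _.
  by rewrite scalerA.
by rewrite -surjective_pairing => /eqP; apply/negP.
Qed.

Section Conjugation.
Variables (m : nat) (P : 'I_m -> 'I_m -> A) (PP : munits P).
Implicit Types M N U : 'M[R[i]]_m.

Definition mxlin M : A := lin P (fun a b => M a b).

Lemma mxlinM M N : mxlin (M *m N) = mxlin M * mxlin N.
Proof.
rewrite /mxlin linM //; apply: eq_bigr => a _; apply: eq_bigr => b _.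
by rewrite mxE.
Qed.

Lemma mxlinL (c : R[i]) M N : mxlin (c *: M + N) = c *: mxlin M + mxlin N.
Proof.
rewrite /mxlin linL; apply: eq_bigr => a _; apply: eq_bigr => b _.
by rewrite !mxE.
Qed.

Lemma mxlin1 : mxlin 1%:M = 1.
Proof.
rewrite (lin_one PP); apply: eq_bigr => a _; apply: eq_bigr => b _.
by rewrite !mxE.
Qed.

Lemma mxlin_star M : mxlin (M ^t* ) = star (mxlin M).
Proof.
rewrite /mxlin lin_star //; apply: eq_bigr => a _; apply: eq_bigr => b _.
by rewrite !mxE.
Qed.

Lemma mxlin0 : mxlin 0 = 0.
Proof. by have := mxlinL (-1) 0 0; rewrite !scaleN1r oppr0 addr0 addNr. Qed.

Lemma mxlinZ c M : mxlin (c *: M) = c *: mxlin M.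
Proof. by have := mxlinL c M 0; rewrite mxlin0 !addr0. Qed.

Lemma mxlin_sum (I : finType) (F : I -> 'M[R[i]]_m) :
  mxlin (\sum_i F i) = \sum_i mxlin (F i).
Proof.
by apply: (big_morph mxlin) => [M N|]; [have := mxlinL 1 M N; rewrite !scale1r|exact: mxlin0].
Qed.

Lemma mxlin_inj : injective mxlin.
Proof. by move=> M N /(lin_inj PP) h; apply/matrixP. Qed.

Lemma mspan_mxlin M : mspan P (mxlin M).
Proof. by exists (fun a b => M a b). Qed.

Lemma mspanP x : mspan P x -> exists M, x = mxlin M.
Proof.
move=> [c ->]; exists (\matrix_(a, b) c a b).
by apply: eq_bigr => a _; apply: eq_bigr => b _; rewrite mxE.
Qed.

Definition conj_units U (a b : 'I_m) : A := mxlin (U ^t* *m delta_mx a b *m U).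

Lemma lin_conj_units U c :
  lin (conj_units U) c = mxlin (U ^t* *m (\matrix_(a, b) c a b) *m U).
Proof.
rewrite [X in _ *m X *m _](matrix_sum_delta (\matrix_(a, b) c a b)).
rewrite mulmx_sumr mulmx_suml mxlin_sum; apply: eq_bigr => a _.
rewrite mulmx_sumr mulmx_suml mxlin_sum; apply: eq_bigr => b _.
by rewrite -scalemxAr -scalemxAl mxlinZ mxE.
Qed.

Lemma munits_conj U : U \is unitarymx -> munits (conj_units U).
Proof.
move=> Uu; have U1 : U *m U ^t* = 1%:M by apply/unitarymxP.
have U2 : U ^t* *m U = 1%:M by apply: mulmx1C.
split=> [a b c d|a b|].
- rewrite /conj_units -mxlinM !mulmxA -[_ *m U *m U ^t* ]mulmxA U1 mulmx1.
  rewrite -[_ *m delta_mx a b *m _]mulmxA mul_delta_mx_cond.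
  by case: eqP => _; rewrite ?mulr1n ?mulr0n // mulmx0 mul0mx mxlin0.
- rewrite /conj_units -mxlin_star; congr mxlin.
  by rewrite !trmx_mul !map_mxM trmxCK mulmxA trmx_delta map_delta_mx.
rewrite -mxlin1 -mxlin_sum; congr mxlin; rewrite -mulmx_suml -mulmx_sumr.
suff -> : \sum_a delta_mx a a = 1%:M :> 'M[R[i]]_m by rewrite mulmx1.
by rewrite mx1_sum_delta.
Qed.

Lemma mspan_conj U : U \is unitarymx -> mspan (conj_units U) = mspan P.
Proof.
move=> Uu; have U2 : U ^t* *m U = 1%:M by apply: mulmx1C; apply/unitarymxP.
rewrite eqEsubset; split; first by apply: mspan_sub => // a b; exact: mspan_mxlin.
move=> x /mspanP[M ->]; exists (fun a b => (U *m M *m U ^t* ) a b).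
rewrite lin_conj_units; congr mxlin.
have -> : \matrix_(a, b) (U *m M *m U ^t* ) a b = U *m M *m U ^t*.
  by apply/matrixP => a b; rewrite mxE.
by rewrite !mulmxA U2 mul1mx -mulmxA U2 mulmx1.
Qed.

(** The spectral theorem for normal matrices, where the orthonormal eigenbasis appears as a new
    system of units with the same span. *)
Lemma normal_diagonalisation x : mspan P x -> x * star x = star x * x ->
  exists (Q : 'I_m -> 'I_m -> A) (d : 'I_m -> R[i]),
    [/\ munits Q, mspan Q = mspan P & x = \sum_a d a *: Q a a].
Proof.
move=> /mspanP[M ->]; rewrite -mxlin_star -!mxlinM => /mxlin_inj MM.
have /orthomx_spectralP ME : M \is normalmx by apply/normalmxP.
have Uu := spectral_unitarymx M.
exists (conj_units (spectralmx M)), (fun a => spectral_diag M 0 a); split.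
- exact: munits_conj.
- exact: mspan_conj.
rewrite {1}ME invmx_unitary // diag_mx_sum_delta mulmx_sumr mulmx_suml mxlin_sum.
by apply: eq_bigr => a _; rewrite -scalemxAr -scalemxAl mxlinZ.
Qed.

End Conjugation.

Lemma lin_diag (I : finType) (e : I -> I -> A) (d : I -> R[i]) :
  \sum_a d a *: e a a = lin e (fun a b => d a *+ (a == b)).
Proof.
apply: eq_bigr => a _; rewrite (bigD1 a) //= eqxx big1 ?addr0 // => b ab.
by rewrite eq_sym (negPf ab) scale0r.
Qed.

Lemma selfadjoint_diag_real (I : finType) (e : I -> I -> A) (d : I -> R[i]) :
  munits e -> star (\sum_a d a *: e a a) = \sum_a d a *: e a a ->
  forall a, Num.conj (d a) = d a.
Proof.
move=> eP; rewrite lin_diag (lin_star eP) => /(lin_inj eP) h a.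
by have := h a a; rewrite eqxx.
Qed.

End FiniteMatrixAlgebra.

Section RelativeCommutant.
Variables (R : realType) (A : cstarAlgType R).

(* e_00 is a sum of rank one projections Q_aa, and h_ab = \sum_i e_i0 Q_ab e_0i. *)
Lemma relative_commutant m (P : 'I_m -> 'I_m -> A) (I : finType) (e : I -> I -> A) :
  munits P -> munits e -> (forall a b, mspan P (e a b)) ->
  exists l (h : 'I_l -> 'I_l -> A),
    [/\ munits h, forall a b, mspan P (h a b),
        forall a b c d, h a b * e c d = e c d * h a b
      & [/\ (#|I| * l)%N = m,
        mspan P `<=` mspan (mprod e h) &
        forall x, mspan P x -> (forall a b, x * e a b = e a b * x) -> mspan h x]].
Proof.
move=> PP eP eIn; have [z _] := mu_inh eP.
have [|Q [d [QP QS oE]]] := normal_diagonalisation PP (eIn z z).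
  by rewrite (mu_star eP).
have d_idem a : d a * d a = d a.
  have := muME eP z z z; rewrite {1 2 3}oE lin_diag (linM QP) => /(lin_inj QP)/(_ a a).
  rewrite eqxx mulr1n (bigD1 a) //= eqxx big1 ?addr0 // => b ba.
  by rewrite eq_sym (negPf ba) mul0r.
(* The eigenvalues of the projection [e z z] are 0 or 1; T indexes the rank one projections below
   it, so the units [Q a b] with a, b in T span the corner. *)
pose D := [pred a | d a != 0]; pose T : finType := {a : 'I_m | a \in D}.
have d_one (a : T) : d (val a) = 1.
  by apply: (mulfI (valP a)); rewrite mulr1 d_idem.
have oT : e z z = \sum_(a : T) Q (val a) (val a).
  rewrite oE (bigID (fun a => d a != 0)) /= [X in _ + X]big1 ?addr0; last first.
    by move=> a; rewrite negbK => /eqP ->; rewrite scale0r.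
  rewrite -[LHS]/(\sum_(i in D) d i *: Q i i) big_sub.
  by apply: eq_bigr => a _; rewrite d_one scale1r.
have corner x : mspan P x -> exists c : T -> T -> R[i],
    e z z * x * e z z = \sum_(a : T) \sum_(b : T) c a b *: Q (val a) (val b).
  rewrite -QS => -[c ->]; exists (fun a b => c (val a) (val b)).
  rewrite oT !mulr_suml; apply: eq_bigr => a _; rewrite mulr_sumr.
  by apply: eq_bigr => b _; rewrite lin_entry.
have Qo (a b : T) : e z z * Q (val a) (val b) = Q (val a) (val b).
  rewrite oT mulr_suml (bigD1 a) //= (muME QP) big1 ?addr0 // => c ca.
  by rewrite (muM QP) (inj_eq val_inj) (negPf ca).
have Qr (a b : T) : Q (val a) (val b) * e z z = Q (val a) (val b).
  rewrite oT mulr_sumr (bigD1 b) //= (muME QP) big1 ?addr0 // => c cb.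
  by rewrite (muM QP) (inj_eq val_inj) eq_sym (negPf cb).
pose h (a b : T) : A := \sum_i e i z * Q (val a) (val b) * e z i.
have eh i j a b : e i j * h a b = e i z * Q (val a) (val b) * e z j.
  rewrite /h mulr_sumr (bigD1 j) //= [X in _ + X]big1 ?addr0 => [|k kj].
    by rewrite !mulrA (muME eP).
  by rewrite !mulrA (muM eP) eq_sym (negPf kj) !mul0r.
have he i j a b : h a b * e i j = e i z * Q (val a) (val b) * e z j.
  rewrite /h mulr_suml (bigD1 i) //= [X in _ + X]big1 ?addr0 => [|k ki].
    by rewrite -!mulrA (muME eP).
  by rewrite -!mulrA (muM eP) (negPf ki) !mulr0.
have hP : munits h.
  split=> [a b c d'|a b|].
  - rewrite {1}/h mulr_suml.
    transitivity (\sum_i e i z * (Q (val a) (val b) * Q (val c) (val d')) * e z i).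
      apply: eq_bigr => i _; rewrite -mulrA eh -!mulrA; congr (_ * _).
      by rewrite !mulrA Qr.
    rewrite (muM QP) (inj_eq val_inj); case: eqP => _; first by rewrite mulr1n.
    by rewrite mulr0n big1 // => i _; rewrite mulr0 mul0r.
  - rewrite /h star_sum; apply: eq_bigr => i _.
    by rewrite !starM !(mu_star eP) (mu_star QP) mulrA.
  rewrite /h exchange_big /= -(mu_sum eP); apply: eq_bigr => i _.
  by rewrite -mulr_suml -mulr_sumr -oT !(muME eP).
have QPs a b : mspan P (Q a b) by rewrite -QS; exact: mspan_unit.
have hIn a b : mspan P (h a b).
  apply: mspan_sum => i _; apply: (mspanM PP) => //.
  exact: (mspanM PP).
have ehP : munits (mprod e h) by apply: munits_prod => // a b c d'; rewrite he eh.
have full : mspan P `<=` mspan (mprod e h).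
  move=> x Px; rewrite (units_expand eP x); apply: mspan_sum => i _; apply: mspan_sum => j _.
  have [|c cE] := corner (e z i * x * e j z).
    by do 2?[apply: (mspanM PP) => //].
  have -> : e i i * x * e j j = \sum_(a : T) \sum_(b : T) c a b *: (e i j * h a b).
    have -> : e i i * x * e j j = e i z * (e z z * (e z i * x * e j z) * e z z) * e z j.
      by rewrite !mulrA !(muME eP) -!mulrA !(muME eP).
    rewrite cE mulr_sumr mulr_suml; apply: eq_bigr => a _.
    rewrite mulr_sumr mulr_suml; apply: eq_bigr => b _.
    by rewrite -scalerAr -scalerAl eh.
  apply: mspan_sum => a _; apply: mspan_sum => b _; apply: mspanZ.
  exact: (mspan_unit (mprod e h) (i, a) (j, b)).
have ehIn p q : mspan P (mprod e h p q) by apply: (mspanM PP).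
pose r (i : 'I_#|T|) : T := enum_val i.
have rB : bijective r by exact: enum_val_bij.
exists #|T|, (fun a b => h (r a) (r b)); split=> //.
- exact: munits_reindex.
- by move=> a b c d'; rewrite he eh.
split.
(* Each of the systems [mprod e h] and [P] lies in the span of the other, so the counts agree. *)
- have -> : (#|I| * #|T|)%N = #|{: I * T}| by rewrite card_prod.
  rewrite -[m in RHS]card_ord; apply/eqP; rewrite eqn_leq; apply/andP; split.
    exact: (mspan_card ehP PP ehIn).
  by apply: (mspan_card PP ehP) => a b; apply: full; exact: mspan_unit.
- apply: subset_trans full _; apply: mspan_sub.
    apply: munits_prod => //; first exact: munits_reindex.
    by move=> a b c d'; rewrite he eh.
  move=> [i a] [j b]; have [q qK rK] := rB.
  have := mspan_unit (mprod e (fun a b : 'I_#|T| => h (r a) (r b))) (i, q a) (j, q b).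
  by rewrite /mprod /= !rK.
move=> x Px xe; rewrite mspan_reindex //.
have [c cE] := corner x Px.
(* An element commuting with e is determined by its corner: x is the sum of the
   [e i z * (e z z * x * e z z) * e z i]. *)
have -> : x = \sum_(a : T) \sum_(b : T) c a b *: h a b.
  rewrite -[LHS]mulr1 -(mu_sum eP) mulr_sumr.
  transitivity (\sum_i e i z * (e z z * x * e z z) * e z i).
    apply: eq_bigr => i _; rewrite !mulrA (muME eP) -[_ * e z z * _]mulrA (muME eP).
    by rewrite -xe -mulrA (muME eP).
  rewrite cE; under eq_bigr do rewrite mulr_sumr mulr_suml.
  rewrite exchange_big /=; apply: eq_bigr => a _.
  under eq_bigr do rewrite mulr_sumr mulr_suml.
  rewrite exchange_big /=; apply: eq_bigr => b _.
  rewrite /h scaler_sumr; apply: eq_bigr => i _.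
  by rewrite -scalerAr -scalerAl.
by apply: mspan_sum => a _; apply: mspan_sum => b _; apply/mspanZ/mspan_unit.
Qed.

End RelativeCommutant.

(** * Flows on matrix algebras *)

Section MatrixAutomorphisms.
Variables (F : fieldType) (n : nat).
Implicit Types (M N V W : 'M[F]_n.+1) (th : 'M[F]_n.+1 -> 'M[F]_n.+1).

Lemma central_matrix_scalar V : (forall M, M * V = V * M) -> exists c, V = c%:M.
Proof.
move=> VC; exists (V 0 0); apply/matrixP => j l.
have := congr1 (fun M => M 0 l) (VC (delta_mx 0 j)); rewrite !mxE.
rewrite (bigD1 j) //= big1 ?addr0 => [|i ij]; last by rewrite mxE (negPf ij) andbF mul0r.
rewrite mxE !eqxx mul1r => ->; rewrite (bigD1 0) //= big1 ?addr0 => [|i i0].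
  by rewrite !mxE eqxx /= eq_sym mulr_natr.
by rewrite mxE (negPf i0) mulr0.
Qed.

(* Skolem-Noether: the rows of V are the vectors w * th (E_0i), where w is a
   nonzero row vector fixed by the idempotent th (E_00). *)
Lemma matrix_endomorphism_inner th :
  (forall c M N, th (c *: M + N) = c *: th M + th N) ->
  (forall M N, th (M * N) = th M * th N) -> th 1 = 1 ->
  exists2 V, V \is a GRing.unit & forall M, M * V = V * th M.
Proof.
move=> thL thM th1.
have th0 : th 0 = 0 by have := thL (-1) 0 0; rewrite !scaleN1r oppr0 addr0 addNr.
have thZ c M : th (c *: M) = c *: th M by have := thL c M 0; rewrite th0 !addr0.
have thD M N : th (M + N) = th M + th N by have := thL 1 M N; rewrite !scale1r.
have th_sum (I : finType) (f : I -> 'M[F]_n.+1) : th (\sum_i f i) = \sum_i th (f i).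
  exact: (big_morph th thD th0).
pose E i j : 'M[F]_n.+1 := delta_mx i j.
have EM i j l : E i j * E j l = E i l by rewrite -mulmxE mul_delta_mx.
have : th (E 0 0) != 0.
  apply/eqP => h; suff : th 1 = 0 by rewrite th1 => /eqP; rewrite oner_eq0.
  rewrite -[1]/(1%:M) mx1_sum_delta th_sum big1 //.
  by move=> i _; rewrite -/(E i i) -(EM i 0 i) -(EM i 0 0) !thM h mulr0 mul0r.
case/rowV0Pn => w /submxP[x wE] w0.
have wfix : w *m th (E 0 0) = w by rewrite wE -mulmxA mulmxE -thM EM.
pose V : 'M[F]_n.+1 := \matrix_i (w *m th (E 0 i)).
have VC M : M * V = V * th M.
  apply/row_matrixP => i; rewrite -!mulmxE !row_mul rowK -mulmxA mulmxE -thM.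
  have -> : E 0 i * M = \sum_l M i l *: E 0 l.
    apply/matrixP => a b; rewrite !mxE summxE (bigD1 i) //= big1 ?addr0; last first.
      by move=> c ci; rewrite mxE (negPf ci) andbF mul0r.
    rewrite (bigD1 b) //= big1 ?addr0 => [|c cb].
      by rewrite !mxE !eqxx !andbT mulrC.
    by rewrite !mxE [b == c]eq_sym (negPf cb) andbF mulr0.
  rewrite th_sum mulmx_sumr mulmx_sum_row; apply: eq_bigr => l _.
  by rewrite rowK thZ -scalemxAr mxE.
exists V => //; rewrite -[_ \is a _]/(V \in unitmx) -row_free_unit -kermx_eq0.
apply/negPn/negP => /rowV0Pn[y /sub_kermxP yV y0].
have [i yi] : exists i, y 0 i != 0.
  apply/existsP; apply: contra_neqT y0; rewrite negb_exists => /forallP h0.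
  by apply/rowP => i; have := h0 i; rewrite negbK mxE => /eqP.
(* The intertwining relation moves [E i 0] to the right of V, where y V = 0 applies; but the same
   product equals [y 0 i *: w], which is not 0. *)
have : y *m E i 0 *m V = 0.
  by rewrite -mulmxA mulmxE VC -mulmxE mulmxA yV mul0mx.
have -> : y *m E i 0 = y 0 i *: delta_mx 0 0.
  rewrite {1}[y]row_sum_delta mulmx_suml (bigD1 i) //= big1 ?addr0 => [|j ji].
    by rewrite -scalemxAl mul_delta_mx.
  by rewrite -scalemxAl mul_delta_mx_cond (negPf ji) scaler0.
rewrite -scalemxAl -rowE rowK wfix => /eqP; rewrite scaler_eq0 (negPf yi) /=.
exact/negP.
Qed.

(** [W * V^-1] commutes with every matrix. *)
Lemma intertwiner_unique th V W : V \is a GRing.unit ->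
  (forall M, M * V = V * th M) -> (forall M, M * W = W * th M) ->
  exists c, W = c *: V.
Proof.
move=> Vu hV hW; have [M|c cE] := @central_matrix_scalar (W * V^-1).
  have h : th M * V^-1 = V^-1 * M.
    by rewrite -[LHS](mulKr Vu) [V * _]mulrA -hV mulrK.
  by rewrite mulrA hW -!mulrA h.
exists c; rewrite -mul_scalar_mx -cE -[_ *m _]/(_ * _).
by rewrite -mulrA mulVr // mulr1.
Qed.

End MatrixAutomorphisms.

Section OneParameterGroups.
Variables (R : realType) (n : nat) (th : R -> 'M[R[i]]_n.+1 -> 'M[R[i]]_n.+1).
Implicit Types (M N V : 'M[R[i]]_n.+1).
Hypothesis thL : forall t c M N, th t (c *: M + N) = c *: th t M + th t N.
Hypothesis thM : forall t M N, th t (M * N) = th t M * th t N.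
Hypothesis th1 : forall t, th t 1 = 1.
Hypothesis th_star : forall t M, th t (M ^t* ) = (th t M) ^t*.
Hypothesis th0 : forall M, th 0 M = M.
Hypothesis thD : forall s t M, th (s + t) M = th s (th t M).

(* The implementing matrices commute up to a scalar whose n-th power is 1 by
   taking determinants; divisibility of the additive group of R removes it. *)
Lemma commuting_implementers : exists v : R -> 'M[R[i]]_n.+1,
  [/\ forall t, v t \is a GRing.unit, forall t M, M * v t = v t * th t M,
      forall s t, v s * v t = v t * v s
    & forall t, exists2 c : R[i], c != 0 & v t * (v t) ^t* = c%:M ].
Proof.
have /choice[v vP] : forall t, exists V, V \is a GRing.unit /\ forall M, M * V = V * th t M.
  by move=> t; have [V Vu hV] := matrix_endomorphism_inner (thL t) (@thM t) (th1 t); exists V.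
have vu t : v t \is a GRing.unit by case: (vP t).
have vC t M : M * v t = v t * th t M by case: (vP t).
have vD s t M : M * (v t * v s) = v t * v s * th (s + t) M.
  by rewrite mulrA (vC t) -mulrA (vC s) thD mulrA.
exists v; split=> //; last first.
  (* Since [th t] respects adjoints, the product of [v t] and its adjoint is central. Being a
     multiple of a unitary suffices for the later diagonalisation, so [v t] is not normalised. *)
  move=> t; have [M|c cE] := @central_matrix_scalar _ _ (v t * (v t) ^t* ).
    have adj N : (v t) ^t* * N = th t N * (v t) ^t*.
      have := congr1 (fun X => X ^t* ) (vC t (N ^t* )).
      by rewrite th_star -!mulmxE !trmx_mul !map_mxM !trmxCK.
    by rewrite mulrA vC -!mulrA adj.
  exists c => //; apply/eqP => c0; move: cE; rewrite c0.
  have -> : (0 : R[i])%:M = 0 :> 'M[R[i]]_n.+1.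
    by apply/matrixP => i j; rewrite !mxE mul0rn.
  move=> /(congr1 (fun X => (v t)^-1 * X)); rewrite mulKr // mulr0 => h.
  have : v t = 0 by rewrite -[v t]trmxCK h trmx0 map_mx0.
  by move=> v0; have := vu t; rewrite v0 unitr0.
have pow s m M : M * v s ^+ m = v s ^+ m * th (s *+ m) M.
  elim: m M => [|m IH] M; first by rewrite !expr0 mulr1 mul1r mulr0n th0.
  by rewrite exprS mulrA vC -mulrA IH mulrA mulrSr thD.
have dM (a : R[i]) (X : 'M[R[i]]_n.+1) : \det (a *: X) = a ^+ n.+1 * \det X by rewrite detZ.
(* [v s] is a multiple of [v r ^+ n.+1]. Moving [v t] past this power costs the scalar l^(n+1), and
   determinants show that this is 1. *)
move=> s t; pose r := s / n.+1%:R.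
have rs : r *+ n.+1 = s by rewrite -[_ *+ _]mulr_natr divfK // pnatr_eq0.
have [c cE] : exists c, v s = c *: v r ^+ n.+1.
  apply: (@intertwiner_unique _ _ (th s)); first by rewrite unitrX.
    by move=> M; rewrite pow rs.
  exact: vC.
have [l lE] : exists l, v t * v r = l *: (v r * v t).
  apply: (@intertwiner_unique _ _ (th (r + t))); first by rewrite unitrMl ?vu.
    by move=> M; rewrite addrC vD.
  exact: vD.
have l1 : l ^+ n.+1 = 1.
  have := congr1 determinant lE; rewrite dM -!mulmxE !det_mulmx [\det (v r) * _]mulrC.
  have d0 : \det (v t) * \det (v r) != 0.
    by rewrite mulf_neq0 // -unitfE -unitmxE -[_ \in _]/(_ \is a GRing.unit) vu.
  by rewrite -[LHS]mul1r => /(mulIf d0) <-.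
have key m : v t * v r ^+ m = l ^+ m *: (v r ^+ m * v t).
  elim: m => [|m IH]; first by rewrite !expr0 scale1r mulr1 mul1r.
  rewrite [v r ^+ _]exprS [LHS]mulrA lE -scalerAl -[_ * _ * v r ^+ m]mulrA IH.
  by rewrite -scalerAr scalerA mulrA exprS.
by rewrite cE -scalerAl -scalerAr key l1 scale1r.
Qed.

(** The family is infinite, but a finite list with span of maximal dimension already spans every
    [v t]. Trigonalising this list together with its adjoints by one unitary makes each member and
    its adjoint lower triangular, hence diagonal. *)
Lemma commuting_normal_diagonalisation (T : eqType) (v : T -> 'M[R[i]]_n.+1) :
  (forall s t, v s * v t = v t * v s) -> (forall s t, v s * (v t) ^t* = (v t) ^t* * v s) ->
  exists2 U : 'M[R[i]]_n.+1, U \is unitarymx &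
    exists d : T -> 'rV[R[i]]_n.+1, forall t, v t = U ^t* * diag_mx (d t) * U.
Proof.
move=> vC vCs.
pose W (ts : seq T) := <<[seq v t | t <- ts]>>%VS.
have [||m mP mmax] := @ex_maxnP (fun m => `[< exists ts, \dim (W ts) = m >]) (n.+1 * n.+1)%N.
- by exists (\dim (W [::])); apply/asboolP; exists [::].
- move=> i /asboolP[ts <-]; apply: leq_trans (dimvS (subvf _)) _; by rewrite dimvf dim_matrix.
have /asboolP[ts tsE] := mP.
have inW t : v t \in W ts.
  have sub : (W ts <= W (t :: ts))%VS by rewrite /W /= span_cons addvSr.
  have /eqP -> : W ts == W (t :: ts).
    by rewrite eqEdim sub tsE; apply: mmax; apply/asboolP; exists (t :: ts).
  by apply: memv_span; rewrite inE eqxx.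
pose As := [seq v t | t <- ts] ++ [seq (v t) ^t* | t <- ts].
have [|U Uu /allP UP] := @cotrigonalization _ _ As.
  have star2 s t : (v s) ^t* * (v t) ^t* = (v t) ^t* * (v s) ^t*.
    by rewrite -!mulmxE -!map_mxM -!trmx_mul !mulmxE vC.
  move=> X Y; rewrite !mem_cat => /orP[]/mapP[s _ ->] /orP[]/mapP[t _ ->].
  - exact: vC.
  - exact: vCs.
  - by apply: esym; exact: vCs.
  - exact: star2.
have trig X : similar_trig U X -> forall i j : 'I_n.+1, (i < j)%N -> (U *m X *m U ^t* ) i j = 0.
  by rewrite /similar_to conjymx // => /is_trig_mxP.
have diagts t : t \in [seq v t | t <- ts] -> forall i j : 'I_n.+1, i != j ->
    (U *m t *m U ^t* ) i j = 0.
  move=> tin i j; rewrite neq_ltn => /orP[ij|ji].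
    by apply: trig => //; apply: UP; rewrite mem_cat tin.
  have /trig/(_ j i ji) : similar_trig U (t ^t* ).
    apply: UP; rewrite mem_cat; apply/orP; right; have /mapP[s sts ->] := tin.
    by apply/mapP; exists s.
  have -> : U *m t ^t* *m U ^t* = (U *m t *m U ^t* ) ^t*.
    by rewrite !trmx_mul !map_mxM trmxCK mulmxA.
  by rewrite !mxE => /eqP; rewrite conjC_eq0 => /eqP.
have diagW X : X \in W ts -> forall i j : 'I_n.+1, i != j -> (U *m X *m U ^t* ) i j = 0.
  rewrite /W -[[seq _ | _ <- _]]/(val (in_tuple [seq v t | t <- ts])) => /coord_span -> i j ij.
  rewrite mulmx_sumr mulmx_suml summxE big1 // => l _.
  rewrite -scalemxAr -scalemxAl mxE diagts ?mulr0 //.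
  exact: mem_nth.
have U2 : U ^t* *m U = 1%:M by apply: mulmx1C; apply/unitarymxP.
exists U => //; exists (fun t => \row_i (U *m v t *m U ^t* ) i i) => t.
have -> : diag_mx (\row_i (U *m v t *m U ^t* ) i i) = U *m v t *m U ^t*.
  apply/matrixP => i j; rewrite !mxE; have [->|ij] := eqVneq i j.
    by rewrite mulr1n.
  by rewrite mulr0n; have := diagW _ (inW t) i j ij; rewrite !mxE => ->.
by rewrite -!mulmxE !mulmxA U2 mul1mx -mulmxA U2 mulmx1.
Qed.

End OneParameterGroups.

(** * Continuous characters of the real line *)

Section Characters.
Variable R : realType.

(* chi (d / 2^n) is determined by halving, since its real part is positive;
   dyadic multiples of d are dense. *)
Lemma continuous_character (chi : R -> R[i]) :
  (forall s t, chi (s + t) = chi s * chi t) -> (forall t, cnrm (chi t) = 1) ->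
  (forall r : R, 0 < r -> exists2 d : R, 0 < d &
     forall t, `|t| < d -> cnrm (chi t - 1) < r) ->
  exists l : R, forall t, chi t = cis (t * l).
Proof.
move=> chiD chi1 chiC.
have cB (z w : R[i]) : cnrm (z - w) = cnrm (w - z) by rewrite /cnrm distrC.
have Re_le (z : R[i]) : `|complex.Re z| <= cnrm z.
  rewrite -[leRHS]ger0_norm ?cnrm_ge0 // -ler_sqr ?nnegrE // !real_normK ?num_real //.
  have -> : cnrm z ^+ 2 = complex.Re z ^+ 2 + complex.Im z ^+ 2.
    by apply: complexI; rewrite rmorphXn /= -cnrmE -add_Re2_Im2.
  by rewrite lerDl sqr_ge0.
have [d0 d0_gt0 hd0] := chiC 1 ltr01.
have Re_gt0 t : `|t| < d0 -> 0 < complex.Re (chi t).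
  move=> /hd0; have := Re_le (chi t - 1); case: (chi t) => a b /=.
  by rewrite ler_norml => /andP[+ _]; lra.
pose d := d0 / 2; have d_gt0 : 0 < d by rewrite divr_gt0.
have two_pow m : 1 <= (2 : R) ^+ m by rewrite exprn_ege1 // ler1n.
have pow_le n : d / 2 ^+ n <= d.
  by rewrite ler_pdivrMr ?exprn_gt0 //; have := two_pow n; nra.
have small n : `|d / 2 ^+ n| < d0.
  rewrite ger0_norm ?divr_ge0 ?exprn_ge0 ?ltW //.
  by apply: le_lt_trans (pow_le n) _; rewrite /d; lra.
have [th th_le thE] : exists2 th : R, `|th| <= pi / 2 & chi d = cis th.
  have := chi1 d; have := Re_gt0 d; have := small 0%N; rewrite expr0 divr1 => h /(_ h).
  case: (chi d) => a b /= a0 n1.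
  have ab : a ^+ 2 + b ^+ 2 = 1.
    apply: complexI; have := add_Re2_Im2 (a +i* b)%C; rewrite /= cnrmE n1 => ->.
    by rewrite expr1n.
  have b1 : -1 <= b <= 1 by apply/andP; split; nra.
  have [h1 h2] := asin_def b1; exists (asin b); first by rewrite ler_norml.
  rewrite /cis h2 (cos_asin b1); congr (_ +i* _).
  by rewrite -ab addrK sqrtr_sqr gtr0_norm.
have half n : chi (d / 2 ^+ n) = cis (th / 2 ^+ n).
  elim: n => [|n IH]; first by rewrite !expr0 !divr1.
  have dbl (x : R) : x / 2 ^+ n = x / 2 ^+ n.+1 + x / 2 ^+ n.+1.
    by rewrite exprS invfM mulrA -mulrDl; congr (_ * _); rewrite -splitr.
  (* Both numbers are square roots of the same value, one with positive and the other with
     nonnegative real part, so the opposite sign is excluded. *)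
  have : chi (d / 2 ^+ n.+1) ^+ 2 = cis (th / 2 ^+ n.+1) ^+ 2.
    by rewrite !expr2 -chiD -cisD -!dbl.
  move/eqP; rewrite eqf_sqr => /orP[/eqP //|/eqP h].
  have := Re_gt0 _ (small n.+1); rewrite h /= => neg; exfalso; move: neg.
  suff : 0 <= cos (th / 2 ^+ n.+1) by lra.
  apply: cos_ge0_pihalf; rewrite -ler_norml normrM.
  apply: le_trans th_le; rewrite ler_piMr // ger0_norm ?invr_ge0 ?exprn_ge0 //.
  by rewrite invf_le1 ?exprn_gt0.
(* f is a character that is continuous at 0 and trivial on the dyadic multiples of d, hence
   trivial. *)
pose l := th / d; exists l => t; pose f t := chi t * cis (- (t * l)).
have fD s t' : f (s + t') = f s * f t'.
  by rewrite /f chiD mulrDl opprD cisD mulrACA.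
have chi0 : chi 0 = 1.
  have n0 : chi 0 != 0.
    by apply/eqP => h; have := chi1 0; rewrite h /cnrm normr0 /=; lra.
  by apply: (mulfI n0); rewrite mulr1 -chiD addr0.
have f0 : f 0 = 1 by rewrite /f chi0 mul0r oppr0 cis0 mulr1.
have fdy n : f (d / 2 ^+ n) = 1.
  rewrite /f half -cisD; have -> : th / 2 ^+ n - d / 2 ^+ n * l = 0.
    by rewrite /l mulrAC [d * _]mulrC divfK ?subrr // gt_eqF.
  exact: cis0.
have fdyn n m : f (m%:R * (d / 2 ^+ n)) = 1.
  by elim: m => [|m IH]; rewrite ?mul0r ?f0 // mulrS mulrDl mul1r fD fdy IH mulr1.
have fC r : 0 < r -> exists2 e : R, 0 < e & forall t, `|t| < e -> cnrm (f t - 1) < r.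
  move=> r0; have r2 : 0 < r / 2 by rewrite divr_gt0.
  have [e e0 he] := chiC _ r2.
  have l1 : 0 < 4 * `|l| + 1 by have := normr_ge0 l; lra.
  exists (Num.min e (r / (4 * `|l| + 1))); first by rewrite lt_min e0 divr_gt0.
  move=> s; rewrite lt_min ltr_pdivlMr // => /andP[/he h1 h2].
  have -> : f s - 1 = (chi s - 1) * cis (- (s * l)) + (cis (- (s * l)) - 1).
    by rewrite /f mulrBl mul1r addrA subrK.
  have cD (z w : R[i]) : cnrm (z + w) <= cnrm z + cnrm w.
    by rewrite -lecR rmorphD /= -!cnrmE ler_normD.
  apply: le_lt_trans (cD _ _) _; rewrite cnrmM cnrm_cis mulr1.
  have := cnrm_cis1 (- (s * l)); rewrite normrN normrM.
  have := normr_ge0 s; have := normr_ge0 l; move: h1 h2.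
  move: `|s| `|l| (cnrm _) (cnrm _) => x y p q; nra.
have f1 s : 0 <= s -> f s = 1.
  move=> s0; apply/eqP; rewrite -subr_eq0 -normr_eq0 cnrmE.
  suff -> : cnrm (f s - 1) = 0 by [].
  apply/eqP; rewrite eq_le cnrm_ge0 andbT; apply/ler_addgt0Pr => r r0; rewrite add0r.
  have [e e0 he] := fC _ r0.
  have [||N hN] := @expr_small R 2^-1 (e / d) _ _ (divr_gt0 e0 d_gt0).
  - by rewrite invr_ge0.
  - by rewrite invf_lt1 // ltr1n.
  have := hN _ (leqnn N); rewrite ltr_pdivlMr // exprVn mulrC => dN.
  have q0 : 0 < d / 2 ^+ N by rewrite divr_gt0 ?exprn_gt0.
  have /truncn_itv/andP[h1 h2] : 0 <= s / (d / 2 ^+ N) by rewrite divr_ge0 // ltW.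
  set k := Num.truncn _ in h1 h2.
  have -> : f s = f (s - k%:R * (d / 2 ^+ N)).
    by rewrite -{1}[s](subrK (k%:R * (d / 2 ^+ N))) fD fdyn mulr1.
  apply/ltW/he; rewrite ler_pdivlMr // in h1; rewrite ltr_pdivrMr // -natr1 mulrDl mul1r in h2.
  by rewrite ger0_norm; lra.
have ft : f t = 1.
  have [t0|t0] := leP 0 t; first exact: f1.
  have := fD t (- t); rewrite subrr f0 [f (- t)]f1 ?mulr1 // oppr_ge0 ltW //.
by rewrite -[LHS]mulr1 -(cisNl (t * l)) mulrA -/(f t) ft mul1r.
Qed.

End Characters.

Section FlowDiagonalisation.
Variables (R : realType) (A : cstarAlgType R).

(** The implementing matrices commute and are multiples of unitaries, so they are diagonal in one
    orthonormal basis. The units of that basis are eigenvectors of the flow, and their eigenvalues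
    [chi a b] are continuous characters with values in the unit circle. *)
Lemma flow_diagonalisation (alpha : R -> A -> A) m (P : 'I_m -> 'I_m -> A) :
  flow alpha -> munits P -> (forall t, mspan P `<=` alpha t @^-1` mspan P) ->
  exists (Q : 'I_m -> 'I_m -> A) (mu : 'I_m -> R),
    [/\ munits Q, mspan Q = mspan P
      & forall t a b, alpha t (Q a b) = cis (t * (mu a - mu b)) *: Q a b].
Proof.
case: m P => [|n] P [aI a0 aD aC] PP inv; first by have [[]] := mu_inh PP.
have aM t : star_morphism (alpha t) by case: (aI t).
have /choice[th thE] : forall p : R * 'M[R[i]]_n.+1, exists N,
    alpha p.1 (mxlin P p.2) = mxlin P N.
  by move=> [t M] /=; have := inv t _ (mspan_mxlin P M) => /mspanP.
have thE' t M : alpha t (mxlin P M) = mxlin P (th (t, M)) by rewrite (thE (t, M)).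
have inj := mxlin_inj PP.
have [|||||| v [vu vM vC vs]] := @commuting_implementers R n (fun t M => th (t, M)).
- by move=> t c M N; apply: inj; rewrite -thE' !mxlinL (smD (aM t)) (smZ (aM t)) !thE'.
- by move=> t M N; apply: inj; rewrite -thE' -!mulmxE !mxlinM // (smM (aM t)) !thE'.
- by move=> t; apply: inj; rewrite -thE' -[1]/(1%:M) mxlin1 // (sm1 (aM t)).
- by move=> t M; apply: inj; rewrite -thE' !mxlin_star // (sm_star (aM t)) thE'.
- by move=> M; apply: inj; rewrite -thE' a0.
- by move=> s t M; apply: inj; rewrite -!thE' aD.
have [||U Uu [x xE]] := @commuting_normal_diagonalisation R n R v.
- exact: vC.
- move=> s t; have [c c0 cE] := vs t.
  have -> : (v t) ^t* = c *: (v t)^-1.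
    by apply: (mulrI (vu t)); rewrite cE -scalerAr divrr // -scalemx1.
  rewrite -scalerAl -scalerAr; congr (_ *: _).
  by apply: (mulrI (vu t)); rewrite mulrA vC -mulrA divrr // mulr1 mulrA divrr // mul1r.
pose Q := conj_units P U; have QP : munits Q by exact: munits_conj.
have U1 : U *m U ^t* = 1%:M by apply/unitarymxP.
pose E a b := U ^t* *m delta_mx a b *m U.
have Ev t a b : E a b *m v t = x t 0 b *: E a b.
  have DE : delta_mx a b *m diag_mx (x t) = x t 0 b *: delta_mx a b :> 'M[R[i]]_n.+1.
    apply/matrixP => i j; rewrite mul_mx_diag !mxE mulrC.
    by have [->|] := eqVneq j b; rewrite // andbF !mulr0.
  rewrite xE -!mulmxE /E !mulmxA -[_ *m U *m U ^t*]mulmxA U1 mulmx1.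
  by rewrite -[_ *m delta_mx a b *m _]mulmxA DE -scalemxAr -scalemxAl.
have vE t a b : v t *m E a b = x t 0 a *: E a b.
  have DE : diag_mx (x t) *m delta_mx a b = x t 0 a *: delta_mx a b :> 'M[R[i]]_n.+1.
    apply/matrixP => i j; rewrite mul_diag_mx !mxE.
    by have [->|] := eqVneq i a; rewrite //= !mulr0.
  rewrite xE -!mulmxE /E !mulmxA -[_ *m U *m U ^t*]mulmxA U1 mulmx1.
  by rewrite -[_ *m _ *m delta_mx a b]mulmxA DE -scalemxAr -scalemxAl.
have Q0 a b : mxlin P (E a b) != 0 by exact: (mu_neq0 QP).
have x0 t a : x t 0 a != 0.
  apply/eqP => h; have := vE t a a; rewrite h scale0r mulmxE => h2.
  have : E a a = 0 by apply: (mulrI (vu t)); rewrite mulr0.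
  by move=> h3; have := Q0 a a; rewrite h3 mxlin0 eqxx.
have aQ t a b : alpha t (Q a b) = (x t 0 b / x t 0 a) *: Q a b.
  rewrite /Q /conj_units thE' -mxlinZ; congr mxlin; apply: (mulrI (vu t)).
  rewrite -vM -scalerAr -!mulmxE -/(E a b) Ev vE scalerA divfK //.
pose chi a b t := x t 0 b / x t 0 a.
have {}aQ t a b : alpha t (Q a b) = chi a b t *: Q a b by exact: aQ.
have Qinj a b (z w : R[i]) : z *: Q a b = w *: Q a b -> z = w.
  by move/eqP; rewrite -subr_eq0 -scalerBl scaler_eq0 (negPf (mu_neq0 QP _ _)) orbF subr_eq0 => /eqP.
have chiD a b s t : chi a b (s + t) = chi a b s * chi a b t.
  apply: (Qinj a b); rewrite -aQ aD aQ (smZ (aM s)) aQ scalerA mulrC //.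
have chiM a b c t : chi a b t * chi b c t = chi a c t.
  by rewrite /chi mulrC mulrA divfK.
have aN t y : nrm (alpha t y) = nrm y.
  apply/eqP; rewrite eq_le sm_nrm //=.
  have {1}-> : y = alpha (- t) (alpha t y) by rewrite -aD addNr a0.
  exact: sm_nrm.
have chi1 a b t : cnrm (chi a b t) = 1.
  by rewrite -[cnrm _]mulr1 -(mu_nrm QP a b) -nrmZ -aQ aN mu_nrm.
have chi_cis a b : exists l : R, forall t, chi a b t = cis (t * l).
  apply: continuous_character => // r r0.
  have /continuous_nrmP/(_ 0 r r0)[d d_gt0 hd] := aC (Q a b); exists d => // t td.
  have := hd t; rewrite sub0r normrN => /(_ td).
  rewrite a0 aQ nrmB -[X in _ - X]scale1r -scalerBl nrmZ (mu_nrm QP) mulr1 //.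
(* Labels are determined only up to a common shift, which the base index [ord0] fixes;
   multiplicativity [chi a b * chi b 0 = chi a 0] recovers all other characters. *)
have /choice[mu muE] : forall a, exists l : R, forall t, chi a ord0 t = cis (t * l).
  by move=> a; exact: chi_cis.
exists Q, mu; split=> //; first exact: mspan_conj.
move=> t a b; rewrite aQ; congr (_ *: _).
have := chiM a b ord0 t; rewrite !muE mulrBr cisD => h.
by rewrite -mulrN1 -h -mulrA mulrN1 [X in _ * X]mulrC cisNl mulr1.
Qed.

End FlowDiagonalisation.

(** * Filtrations by matrix algebras *)

(** In x (x - 1), the factor belonging to the root further from x has absolute value at least
    1/2. *)
Lemma near_idempotent_real (R : realType) (x r : R) :
  0 <= r -> `|x * x - x| <= r -> `|((2^-1 < x)%R)%:R - x| <= 2 * r.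
Proof.
move=> r0; rewrite !ler_norml => /andP[h1 h2].
case: ltP => /= h; rewrite leNgt andbC leNgt.
  have hr : 0 <= r * (x - 2^-1) by apply: mulr_ge0 => //; lra.
  by apply/andP; split; apply/negP => h3; nra.
by apply/andP; split; apply/negP => h3; nra.
Qed.

Section Filtrations.
Variables (R : realType) (A : cstarAlgType R).

(** The start at size 1 makes the first nontrivial algebra, too, a relative commutant over its
    predecessor. *)
Definition unit_filtration (p : nat -> nat) (P : forall n, 'I_(p n) -> 'I_(p n) -> A) : Prop :=
  [/\ p 0%N = 1%N, forall n, munits (P n), forall n, mspan (P n) `<=` mspan (P n.+1)
    & forall x (r : R), 0 < r -> exists n y, mspan (P n) y /\ nrm (x - y) < r].

(** The embedding is not assumed unital; but its value at 1 is a unit for its range, which contains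
    1. *)
Lemma full_matrix_units (S : set A) : full_matrix_subalgebra S -> S 1 ->
  exists n (e : 'I_n -> 'I_n -> A), munits e /\ mspan e = S.
Proof.
move=> [n [f [fL fM fs _ fS]]] S1.
have fD M N : f (M + N) = f M + f N by have := fL 1 M N; rewrite !scale1r.
have f0 : f 0 = 0 by apply: (@addrI _ (f 0)); rewrite -fD !addr0.
have fZ c M : f (c *: M) = c *: f M by have := fL c M 0; rewrite f0 !addr0.
have f_sum (I : finType) (F : I -> 'M[R[i]]_n.+1) : f (\sum_i F i) = \sum_i f (F i).
  exact: (big_morph f fD f0).
have f1 : f 1%:M = 1.
  have [M _ fM1] : range f 1 by rewrite fS.
  by rewrite -[LHS]mulr1 -{1}fM1 -fM mul1mx.
exists n.+1, (fun a b => f (delta_mx a b)); split.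
  split=> [a b c d|a b|].
  - rewrite -fM mul_delta_mx_cond; case: eqP => _; first by rewrite !mulr1n.
    by rewrite !mulr0n.
  - by rewrite -fs map_delta_mx trmx_delta.
  - by rewrite -f_sum -mx1_sum_delta f1.
rewrite -fS eqEsubset; split=> [_ [c ->]|_ [M _ <-]].
  exists (\matrix_(a, b) c a b) => //; rewrite [X in f X]matrix_sum_delta f_sum.
  apply: eq_bigr => a _; rewrite f_sum; apply: eq_bigr => b _.
  by rewrite fZ mxE.
exists (fun a b => M a b); rewrite [M in LHS]matrix_sum_delta f_sum.
apply: eq_bigr => a _; rewrite f_sum; apply: eq_bigr => b _.
by rewrite fZ.
Qed.

Lemma matrix_filtration_units (An : nat -> set A) : matrix_filtration An ->
  exists p (P : forall n, 'I_(p n) -> 'I_(p n) -> A), unit_filtration P /\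
    forall n, n = 0%N \/ exists m, mspan (P n) = An m.
Proof.
move=> [Afull Amono A1 Adense].
have An1 n : An n 1 by elim: n => // n; exact: Amono.
have /choice[q qP] : forall n, exists q : {k & 'I_k -> 'I_k -> A},
    munits (projT2 q) /\ mspan (projT2 q) = An n.
  by move=> n; have [k [e eP]] := full_matrix_units (Afull n) (An1 n); exists (existT _ k e).
(* The scalars are inserted as level 0, so the given filtration is shifted by one. *)
pose P n : {k & 'I_k -> 'I_k -> A} :=
  if n is m.+1 then q m else existT _ 1%N (fun _ _ => 1).
have PP n : munits (projT2 (P n)).
  case: n => [|n]; last by case: (qP n).
  split=> /= [a b c d|a b|]; first by rewrite mulr1 !ord1 eqxx.
    exact: star1.
  by rewrite big_ord1.
exists (fun n => projT1 (P n)), (fun n => projT2 (P n)); split; last first.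
  by case=> [|n]; [left|right; exists n; case: (qP n)].
split=> // [n|x r r0].
  case: n => [|n]; last by case: (qP n) => _ /= ->; case: (qP n.+1) => _ ->; exact: Amono.
  apply: mspan_sub => [|a b]; first exact: PP.
  exact: mspan1 (PP 1%N).
have : closure (\bigcup_n An n) x by rewrite Adense.
move/closureP => /(_ r r0)[y [n _ Any] xy]; exists n.+1, y; split=> //=.
by case: (qP n) => _ ->.
Qed.

(** The triangle inequality gives [#|I| * K]. Applied to the powers x^(2^n), which are diagonal as
    well, it loses the factor [#|I|]. *)
Lemma diag_nrm_le (I : finType) (e : I -> I -> A) (d : I -> R) (K : R) :
  munits e -> 0 <= K -> (forall a, `|d a| <= K) -> nrm (\sum_a (d a)%:C *: e a a) <= K.
Proof.
move=> eP K0 dK; set x := \sum_a _.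
have xs : star x = x.
  rewrite /x star_sum; apply: eq_bigr => a _; rewrite starZ (mu_star eP).
  by congr (_ *: _); exact: conjc_real.
have xn n : x ^+ n = \sum_a (d a ^+ n)%:C *: e a a.
  elim: n => [|n IH].
    by rewrite expr0 -(mu_sum eP); apply: eq_bigr => a _; rewrite expr0 scale1r.
  rewrite exprS IH /x mulr_suml; apply: eq_bigr => a _; rewrite mulr_sumr.
  rewrite (bigD1 a) //= [X in _ + X]big1 ?addr0 => [|b ba].
    by rewrite -scalerAl -scalerAr (muME eP) scalerA -rmorphM exprS.
  by rewrite -scalerAl -scalerAr (muM eP) eq_sym (negPf ba) !scaler0.
apply: (@pow_bound_le _ _ _ #|I|%:R) => //; first exact: nrm_ge0.
move=> n; rewrite -nrm_pow_selfadj // xn; apply: le_trans (nrm_sum _ _) _.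
rewrite mulr_natl -sumr_const; apply: ler_sum => a _.
rewrite nrmZ (mu_nrm eP) mulr1.
have -> : cnrm (d a ^+ (2 ^ n))%:C = `|d a| ^+ (2 ^ n).
  by apply: complexI; rewrite -cnrmE normc_def /= expr0n addr0 sqrtr_sqr normrX.
by rewrite lerXn2r // nnegrE.
Qed.

(* The spectral projection of a for the eigenvalues greater than 1/2. *)
Lemma nearby_projection m (P : 'I_m -> 'I_m -> A) (a : A) (r : R) :
  munits P -> mspan P a -> star a = a -> nrm (a * a - a) <= r ->
  exists (Q : 'I_m -> 'I_m -> A) (D : pred 'I_m),
    [/\ munits Q, mspan Q = mspan P & nrm (\sum_(j in D) Q j j - a) <= 2 * r].
Proof.
move=> PP Pa as_ ar; have r0 : 0 <= r by apply: le_trans ar; exact: nrm_ge0.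
have [|Q [d [QP QS aE]]] := normal_diagonalisation PP Pa; first by rewrite as_.
have dr j : d j = (complex.Re (d j))%:C.
  rewrite aE in as_; have := selfadjoint_diag_real QP as_ j.
  case: (d j) => x y [] /eqP; rewrite -subr_eq0 -opprD oppr_eq0 -mulr2n mulrn_eq0 /=.
  by move/eqP->.
pose s j := complex.Re (d j).
have sr j : `|s j * s j - s j| <= r.
  apply: le_trans ar; have -> : a * a - a = lin Q (fun a b => (d a * d a - d a) *+ (a == b)).
    rewrite -lin_diag {1 2 3}aE mulr_suml -sumrB; apply: eq_bigr => i _.
    rewrite mulr_sumr (bigD1 i) //= [X in _ + X - _]big1 ?addr0 => [|b ba].
      by rewrite -scalerAl -scalerAr (muME QP) scalerA scalerBl.
    by rewrite -scalerAl -scalerAr (muM QP) eq_sym (negPf ba) !scaler0.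
  have := lin_coef_le QP (fun a b => (d a * d a - d a) *+ (a == b)) j j.
  rewrite eqxx mulr1n; apply: le_trans.
  rewrite dr -rmorphM -rmorphB /= -/(s j).
  by rewrite /cnrm normc_def /= expr0n addr0 sqrtr_sqr.
pose D : pred 'I_m := fun j => 2^-1 < s j.
exists Q, D; split=> //; rewrite aE big_mkcond -sumrB.
have -> : \sum_i ((if i \in D then Q i i else 0) - d i *: Q i i) =
    \sum_i ((D i)%:R - s i)%:C *: Q i i.
  apply: eq_bigr => i _; rewrite {1}dr rmorphB /= scalerBl; congr (_ - _).
  by rewrite -[i \in D]/(D i); case: (D i) => /=; rewrite ?scale1r ?scale0r.
apply: diag_nrm_le => //; first by rewrite mulr_ge0.
by move=> j; exact: near_idempotent_real.
Qed.

(** The units of one column serve as a basis of the space on which the matrix algebra acts, so that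
    dimension counts take place inside A and can use its norm. *)
Lemma column_free m (Q : 'I_m -> 'I_m -> A) (j0 : 'I_m) (c : 'I_m -> R[i]) :
  munits Q -> \sum_j c j *: Q j j0 = 0 -> forall j, c j = 0.
Proof.
move=> QP h j; have := congr1 (fun x => Q j j * x) h.
rewrite mulr0 mulr_sumr (bigD1 j) //= [X in _ + X]big1 ?addr0 => [|i ij].
  rewrite -scalerAr (muME QP) => /eqP; rewrite scaler_eq0 (negPf (mu_neq0 QP _ _)) orbF.
  by move/eqP.
by rewrite -scalerAr (muM QP) eq_sym (negPf ij) scaler0.
Qed.

Lemma lin_column m (Q : 'I_m -> 'I_m -> A) c (j j0 : 'I_m) :
  munits Q -> lin Q c * Q j j0 = \sum_i c i j *: Q i j0.
Proof.
move=> QP; rewrite /lin mulr_suml; apply: eq_bigr => i _.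
rewrite mulr_suml (bigD1 j) //= [X in _ + X]big1 ?addr0 => [|l lj].
  by rewrite -scalerAl (muME QP).
by rewrite -scalerAl (muM QP) (negPf lj) scaler0.
Qed.

End Filtrations.

(** * Sizes of matrix subalgebras *)

Section Divisibility.
Variables (R : realType) (A : cstarAlgType R).
Variables (p : nat -> nat) (P : forall n, 'I_(p n) -> 'I_(p n) -> A).
Hypothesis PF : unit_filtration P.
Arguments P : clear implicits.

Lemma unit_filtration_mono n m : (n <= m)%N -> mspan (P n) `<=` mspan (P m).
Proof.
have [_ _ PS _] := PF.
move=> /subnK <-; elim: (m - n)%N => [//|d IH].
exact: subset_trans IH (PS _).
Qed.

Lemma unit_filtration_approx (I : finType) (x : I -> A) (r : R) : 0 < r ->
  exists n (y : I -> A), forall i, mspan (P n) (y i) /\ nrm (x i - y i) < r.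
Proof.
move=> r0; have [_ _ _ PD] := PF.
have /choice[q qP] : forall i, exists q : nat * A, mspan (P q.1) q.2 /\ nrm (x i - q.2) < r.
  by move=> i; have [n [y h]] := PD (x i) r r0; exists (n, y).
exists (\max_i (q i).1)%N, (fun i => (q i).2) => i; have [h1 h2] := qP i; split=> //.
by apply: unit_filtration_mono h1; exact: leq_bigmax.
Qed.

(* With x_i in span P_n close to e_i0 and Q_D a projection in span P_n close to
   e_00, the map (v_i) |-> \sum_i x_i v_i from I copies of the range of Q_D is
   injective, and its adjoint y |-> (Q_D x_i^* y)_i is injective too. *)
Lemma munits_card_dvd (I : finType) (e : I -> I -> A) :
  munits e -> exists n, (#|I| %| p n)%N.
Proof.
move=> eP; have [z _] := mu_inh eP; have [_ PP _ _] := PF.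
pose k : R := #|I|%:R; have k1 : 1 <= k.
  by rewrite /k ler1n; apply/card_gt0P; exists z.
(* 22 (k + 1) exceeds both k + 9 and 21 k, the coefficients of r in the two contraction estimates
   below. *)
pose r : R := (22 * (k + 1))^-1.
have r0 : 0 < r by rewrite invr_gt0; lra.
have rk : r * (22 * (k + 1)) = 1 by rewrite mulVf // gt_eqF //; lra.
have r44 : 44 * r <= 1 by nra.
have r1 : r <= 1 by lra.
have [n [x xP]] := unit_filtration_approx (fun i => e i z) r0.
have xIn i : mspan (P n) (x i) by case: (xP i).
have xr i : nrm (e i z - x i) <= r by case: (xP i) => _ /ltW.
have xn i : nrm (x i) <= 1 + r.
  rewrite -[x i](subrK (e i z)) addrC; apply: le_trans (nrmD _ _) _.
  by rewrite (mu_nrm eP) lerD2l nrmB.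
pose a := (2%:R^-1 : R[i]) *: (x z + star (x z)).
have hh : Num.conj (2%:R^-1 : R[i]) = 2%:R^-1 by rewrite fmorphV /= rmorph_nat.
have as_ : star a = a by rewrite starZ starD starK hh addrC.
have Pa : mspan (P n) a by apply/mspanZ/mspanD => //; exact: mspan_star.
have ae : nrm (a - e z z) <= r.
  have -> : a - e z z = (2%:R^-1 : R[i]) *: ((x z - e z z) + star (x z - e z z)).
    rewrite starB (mu_star eP) addrACA -opprD scalerDr; congr (_ + _).
    by rewrite scalerN -mulr2n -[e z z *+ 2]scaler_nat scalerA mulVf ?scale1r // pnatr_eq0.
  rewrite nrmZ cnrm_half; have := nrmD (x z - e z z) (star (x z - e z z)).
  by rewrite nrm_star nrmB; have := xr z; lra.
have aa : nrm (a * a - a) <= 4 * r.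
  have -> : a * a - a = (a * a - e z z * e z z) - (a - e z z).
    by rewrite (muME eP) opprB addrA subrK.
  apply: le_trans (nrmD _ _) _; rewrite nrmN.
  have := nrmMB a a (e z z) (e z z); rewrite (mu_nrm eP).
  have an : nrm a <= 1 + r.
    rewrite -[a](subrK (e z z)) addrC; apply: le_trans (nrmD _ _) _.
    by rewrite (mu_nrm eP) lerD2l.
  have := nrm_ge0 a; have := nrm_ge0 (a - e z z).
  move: (nrm a) (nrm (a - e z z)) (nrm _) an ae => N M K *; nra.
(* The idempotency defect 4r puts the projection within 8r of a, hence within 9r of [e z z]. *)
have [Q [D [QP QS qa]]] := nearby_projection (PP n) Pa as_ aa.
set q := \sum_(j in D) Q j j in qa.
have qe : nrm (q - e z z) <= 9 * r.
  by apply: le_trans (nrmBD _ _ a) _; lra.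
have [j0 _] := mu_inh QP.
pose T : finType := {j : 'I_(p n) | j \in D}.
have qT (c : 'I_(p n) -> R[i]) :
    q * \sum_j c j *: Q j j0 = \sum_(j : T) c (val j) *: Q (val j) j0.
  rewrite -[RHS](big_sub D (fun j => c j *: Q j j0)) /q mulr_suml; apply: eq_bigr => i _.
  rewrite mulr_sumr (bigD1 i) //= [X in _ + X]big1 ?addr0 => [|l li].
    by rewrite -scalerAr (muME QP).
  by rewrite -scalerAr (muM QP) eq_sym (negPf li) scaler0.
have qTT (c : T -> R[i]) :
    q * (\sum_(j : T) c j *: Q (val j) j0) = \sum_(j : T) c j *: Q (val j) j0.
  rewrite mulr_sumr; apply: eq_bigr => j _.
  rewrite -scalerAr /q mulr_suml (bigD1 (val j)) ?(valP j) //= (muME QP) big1 ?addr0 //.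
  by move=> i /andP[_ ij]; rewrite (muM QP) (negPf ij).
have /choice[xi xiE] : forall i, exists c, x i = lin Q c.
  by move=> i; have := xIn i; rewrite -QS.
have dir1 : (#|I| * #|T| <= p n)%N.
  rewrite leqNgt; apply/negP => lt.
  have [|c [[s cs] cw]] :=
    @linear_dependence _ (I * T)%type 'I_(p n) (fun s j => xi s.1 j (val s.2)).
    by rewrite card_prod card_ord.
  pose v i := \sum_(j : T) c (i, j) *: Q (val j) j0.
  have xv0 : \sum_i x i * v i = 0.
    have -> : \sum_i x i * v i =
        \sum_i \sum_l \sum_j (c (i, l) * xi i j (val l)) *: Q j j0.
      apply: eq_bigr => i _; rewrite /v mulr_sumr; apply: eq_bigr => l _.
      rewrite -scalerAr xiE lin_column // scaler_sumr; apply: eq_bigr => j _.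
      by rewrite scalerA.
    rewrite pair_bigA exchange_big big1 //= => j _.
    rewrite -[RHS](scale0r (Q j j0)) -(cw j) scaler_suml.
    by apply: eq_bigr => -[i l] _.
  (* The sum of the [e z i * e j z * v j] is [e z z * v i], close to [q * v i = v i]; replacing each
     [e j z] by [x j] turns it into 0. Summed over i, the resulting bound forces all v i to
     vanish. *)
  have vle i : nrm (v i) <= 9 * r * nrm (v i) + r * \sum_j nrm (v j).
    have {1}-> : v i = (q - e z z) * v i - \sum_j e z i * (x j - e j z) * v j.
      have eev : \sum_j e z i * e j z * v j = e z z * v i.
        rewrite (bigD1 i) //= [X in _ + X]big1 ?addr0 => [|j ji]; first by rewrite (muME eP).
        by rewrite (muM eP) eq_sym (negPf ji) mul0r.
      under eq_bigr do rewrite mulrBr mulrBl.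
      rewrite big_split /= sumrN eev.
      under eq_bigr do rewrite -mulrA.
      by rewrite -mulr_sumr xv0 mulr0 sub0r opprK mulrBl subrK qTT.
    apply: le_trans (nrmD _ _) _; rewrite nrmN; apply: lerD.
      apply: le_trans (nrmM _ _) _; apply: ler_wpM2r; first exact: nrm_ge0.
      exact: qe.
    apply: le_trans (nrm_sum _ _) _; rewrite mulr_sumr; apply: ler_sum => j _.
    apply: le_trans (nrmM _ _) _; apply: ler_wpM2r; first exact: nrm_ge0.
    by apply: le_trans (nrmM _ _) _; rewrite (mu_nrm eP) mul1r nrmB.
  have : \sum_j nrm (v j) <= (9 + k) * r * \sum_j nrm (v j).
    apply: le_trans (ler_sum _ (fun i _ => vle i)) _.
    rewrite big_split /= -mulr_sumr; set S := \sum_j nrm (v j).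
    have -> : \sum_(i : I) r * S = k * (r * S) by rewrite sumr_const mulr_natl.
    by rewrite mulrA -mulrDl -mulrDl.
  have : 0 <= \sum_j nrm (v j) by apply: sumr_ge0 => j _; exact: nrm_ge0.
  move=> S0 Sle; have S1 : \sum_j nrm (v j) = 0.
    by move: S0 Sle; move: (\sum_j _) => S S0 Sle; nra.
  have v0 i : v i = 0.
    apply/nrm_eq0/eqP; move/eqP: S1; rewrite psumr_eq0 => [/allP/(_ i)|j _].
      by rewrite mem_index_enum => /(_ isT).
    exact: nrm_ge0.
  move: cs; rewrite (surjective_pairing s) => /eqP; apply.
  pose c' (j : 'I_(p n)) := if insub j is Some j' then c (s.1, j' : T) else 0.
  have : \sum_j c' j *: Q j j0 = 0.
    rewrite (bigID (mem D)) /= [X in _ + X]big1 ?addr0 => [|j jD]; last first.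
      by rewrite /c' insubN // scale0r.
    rewrite (big_sub D (fun j => c' j *: Q j j0)) -[RHS](v0 s.1).
    by apply: eq_bigr => j _; rewrite /c' valK.
  by move/(column_free QP)/(_ (val s.2)); rewrite /c' valK.
have dir2 : (p n <= #|I| * #|T|)%N.
  rewrite leqNgt; apply/negP => lt.
  have [|c [[s cs] cw]] :=
    @linear_dependence _ 'I_(p n) (I * T)%type (fun j s => Num.conj (xi s.1 j (val s.2))).
    by rewrite card_prod card_ord.
  pose y := \sum_j c j *: Q j j0.
  have qxy i : q * (star (x i) * y) = 0.
    have -> : star (x i) * y = \sum_l (\sum_j c j * Num.conj (xi i j l)) *: Q l j0.
      rewrite /y mulr_sumr; under eq_bigr do
        rewrite -scalerAr xiE (lin_star QP) lin_column // scaler_sumr.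
      rewrite exchange_big /=; apply: eq_bigr => l _.
      by rewrite scaler_suml; apply: eq_bigr => j _; rewrite scalerA.
    rewrite qT big1 // => l _.
    by have := cw (i, l) => /= ->; rewrite scale0r.
  (* w kills y, yet it approximates the sum of the [e i z * e z z * e z i], which is 1. Each term is
     off by at most r + 9r (1 + r) + 2r, which is at most 21r. *)
  pose w := \sum_i x i * q * star (x i).
  have wy : w * y = 0.
    by rewrite /w mulr_suml big1 // => i _; rewrite -!mulrA qxy mulr0.
  have qn : nrm q <= 1 + 9 * r.
    rewrite -[q](subrK (e z z)) addrC; apply: le_trans (nrmD _ _) _.
    by rewrite (mu_nrm eP) lerD2l.
  have w1 : nrm (1 - w) <= k * (21 * r).
    rewrite -(mu_sum eP) /w -sumrB; apply: le_trans (nrm_sum _ _) _.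
    rewrite /k mulr_natl -sumr_const; apply: ler_sum => i _.
    have -> : e i i = e i z * e z z * e z i by rewrite !(muME eP).
    apply: le_trans (nrmMB _ _ _ _) _; rewrite (mu_nrm eP) mulr1.
    have h1 := nrmMB (e i z) (e z z) (x i) q; rewrite (mu_nrm eP) mulr1 in h1.
    have h2 : nrm (e z i - star (x i)) <= r by rewrite -(mu_star eP) -starB nrm_star.
    have h3 := nrmM (x i) q; have h4 := xn i; have h5 := xr i.
    have h6 : nrm (e z z - q) <= 9 * r by rewrite nrmB.
    have hf : nrm (x i) * nrm (e z z - q) <= (1 + r) * (9 * r).
      by apply: ler_pM; rewrite ?nrm_ge0.
    have hg : nrm (x i * q) <= 2.
      apply: le_trans h3 _; apply: le_trans (ler_pM (nrm_ge0 _) (nrm_ge0 _) h4 qn) _.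
      by clear - r0 r44; nra.
    have hk : nrm (x i * q) * nrm (e z i - star (x i)) <= 2 * r.
      by apply: ler_pM; rewrite ?nrm_ge0.
    by move: h1 hf hk h5; clear - r0 r44 => h1 hf hk h5; nra.
  have : nrm y <= k * (21 * r) * nrm y.
    have {1}-> : y = (1 - w) * y by rewrite mulrBl wy mul1r subr0.
    apply: le_trans (nrmM _ _) _; apply: ler_wpM2r => //; exact: nrm_ge0.
  have y0 := nrm_ge0 y => yle.
  have : y = 0 by apply: nrm_eq0; nra.
  by move/(column_free QP)/(_ s)/eqP; apply/negP.
exists n; apply/dvdnP; exists #|T|; apply/eqP.
by rewrite eqn_leq mulnC dir1 dir2.
Qed.

End Divisibility.

(** * Tensor factorisations from filtrations *)

Section Chains.
Variables (R : realType) (A : cstarAlgType R).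

Lemma nat_units l (Q : 'I_l -> 'I_l -> A) :
  exists e : nat -> nat -> A, @ounits R A l e = Q.
Proof.
exists (fun a b => if insub a is Some i then if insub b is Some j then Q i j else 0 else 0).
by apply/funext => a; apply/funext => b; rewrite /ounits !valK.
Qed.

Lemma mspan_csub (I : finType) (e : I -> I -> A) (S : set A) :
  closed_subalgebra S -> (forall a b, S (e a b)) -> mspan e `<=` S.
Proof.
move=> SP Se _ [c ->]; apply: csub_sum => // a _; apply: csub_sum => // b _.
exact: csubZ.
Qed.

Lemma mspan_mprod_csub (I J : finType) (e : I -> I -> A) (h : J -> J -> A) (S : set A) :
  closed_subalgebra S -> (forall a b, S (e a b)) -> (forall a b, S (h a b)) ->
  mspan (mprod e h) `<=` S.
Proof. by move=> SP Se Sh; apply: mspan_csub => // a b; apply: csubM. Qed.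

(** A factor i < j lies in [B i.+1], hence in [B j], with which factor j commutes. Generation goes
    up the chain: each step is generated by the previous algebra and one factor. *)
Lemma chain_usystem (B : nat -> set A) (k : nat -> nat) (e : nat -> nat -> nat -> A) :
  (forall S, closed_subalgebra S -> B 0%N `<=` S) ->
  (forall j, B j `<=` B j.+1) ->
  (forall j, munits (@ounits R A (k j) (e j))) ->
  (forall j (a b : 'I_(k j)), B j.+1 (e j a b)) ->
  (forall j (a b : 'I_(k j)) x, B j x -> x * e j a b = e j a b * x) ->
  (forall j S, closed_subalgebra S -> B j `<=` S ->
     (forall a b : 'I_(k j), S (e j a b)) -> B j.+1 `<=` S) ->
  generating (\bigcup_j B j) -> usystem k e.
Proof.
move=> B0 BS eM eB eC eG Bgen.
have Bmono i j : (i <= j)%N -> B i `<=` B j.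
  move=> /subnK <-; elim: (j - i)%N => [//|d IH].
  exact: subset_trans IH (BS _).
split=> // [i j a b c d ij|S SP Se].
  move: ij; rewrite neq_ltn => /orP[ij|ji].
    by apply: eC; apply: (Bmono i.+1) (eB i a b).
  by apply/esym; apply: eC; apply: (Bmono j.+1) (eB j c d).
apply: Bgen => // x [j _]; move: x; elim: j => [|j IH]; first exact: B0.
by apply: eG => // a b; apply: Se; exists j, a, b.
Qed.

Variables (p : nat -> nat) (P : forall n, 'I_(p n) -> 'I_(p n) -> A).
Arguments P : clear implicits.
Hypothesis PF : unit_filtration P.

Lemma unit_filtration_bottom (S : set A) : closed_subalgebra S -> mspan (P 0) `<=` S.
Proof.
move=> SP; have [p0 PM _ _] := PF; have := PM 0%N.
move: (P 0); rewrite p0 => Q QM; apply: mspan_csub => // a b; rewrite !ord1.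
by have := mu_sum QM; rewrite big_ord1 => ->; exact: csub1.
Qed.

Lemma unit_filtration_generating : generating (\bigcup_n mspan (P n)).
Proof.
have [_ _ _ PD] := PF; move=> S SP PS x; have [_ _ _] := SP; apply => r r0.
by have [n [y [Py xy]]] := PD x r r0; exists y => //; apply: PS; exists n.
Qed.

Lemma unit_filtration_commutant n m : (n <= m)%N ->
  exists l (h : 'I_l -> 'I_l -> A),
    [/\ munits h, forall a b, mspan (P m) (h a b),
        forall a b x, mspan (P n) x -> x * h a b = h a b * x
      & [/\ (p n * l)%N = p m, mspan (P m) `<=` mspan (mprod (P n) h) &
        forall x, mspan (P m) x -> (forall y, mspan (P n) y -> x * y = y * x) -> mspan h x]].
Proof.
move=> nm; have [_ PM _ _] := PF.
have [|l [h [hM hP hC [lE full char]]]] := relative_commutant (PM m) (PM n).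
  move=> a b; apply: (unit_filtration_mono PF nm); exact: mspan_unit.
exists l, h; split=> //.
- move=> a b _ [c ->]; rewrite mulr_suml mulr_sumr; apply: eq_bigr => i _.
  rewrite mulr_suml mulr_sumr; apply: eq_bigr => j _.
  by rewrite -scalerAl -scalerAr hC.
- split=> //; first by rewrite -lE card_ord.
  move=> x Px xC; apply: char => // a b; apply: xC; exact: mspan_unit.
Qed.

Lemma invariant_filtration_labelled (alpha : R -> A -> A) :
  flow alpha -> (forall n t x, mspan (P n) x -> mspan (P n) (alpha t x)) ->
  exists k e nu, usystem k e /\ labelled k e nu alpha.
Proof.
move=> aF inv; have [aI a0 aD _] := aF.
have aM t : star_morphism (alpha t) by case: (aI t).
have step n : exists q : nat * (nat -> nat -> A) * (nat -> R),
    let: (l, e, mu) := q in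
    [/\ munits (@ounits R A l e), forall a b : 'I_l, mspan (P n.+1) (e a b),
        forall (a b : 'I_l) x, mspan (P n) x -> x * e a b = e a b * x,
        forall S, closed_subalgebra S -> mspan (P n) `<=` S ->
          (forall a b : 'I_l, S (e a b)) -> mspan (P n.+1) `<=` S
      & forall t (a b : 'I_l), alpha t (e a b) = cis (t * (mu a - mu b)) *: e a b].
  have [l [h [hM hP hC [lE full char]]]] := unit_filtration_commutant (leqnSn n).
  have hS : mspan h `<=` mspan (P n.+1).
    by have [_ PM _ _] := PF; exact: mspan_sub.
  have hC' x y : mspan (P n) x -> mspan h y -> x * y = y * x.
    move=> Px [c ->]; rewrite mulr_suml mulr_sumr; apply: eq_bigr => i _.
    rewrite mulr_suml mulr_sumr; apply: eq_bigr => j _.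
    by rewrite -scalerAl -scalerAr hC.
  have [|Q [mu [QM QS Qa]]] := flow_diagonalisation aF hM.
    move=> t x hx; apply: char; first by apply: inv; exact: hS.
    (* [alpha t x] commutes with y because x commutes with [alpha (- t) y], which lies in the
       invariant span of [P n]. *)
    move=> y Py; have {1 2}-> : y = alpha t (alpha (- t) y) by rewrite -aD subrr a0.
    rewrite -!(smM (aM t)); congr (alpha t _); apply/esym/hC' => //; exact: inv.
  have [e eE] := nat_units Q.
  have eQ (a b : 'I_l) : e a b = Q a b by rewrite -eE.
  have Qh a b : mspan h (Q a b) by rewrite -QS; exact: mspan_unit.
  exists (l, e, fun a => if insub a is Some i then mu i else 0); split.
  - by rewrite eE.
  - by move=> a b; rewrite eQ; apply: hS.
  - by move=> a b x Px; rewrite eQ; exact: hC'.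
  - move=> S SP PS Se; apply: subset_trans full _; apply: mspan_mprod_csub => // a b.
      by apply: PS; exact: mspan_unit.
    have hQ : mspan h `<=` S by rewrite -QS; apply: mspan_csub => // i j; rewrite -eQ.
    by apply: hQ; exact: mspan_unit.
  - by move=> t a b; rewrite eQ !valK.
have /choice[q qP] := step.
exists (fun n => (q n).1.1), (fun n => (q n).1.2), (fun n => (q n).2); split.
  apply: (@chain_usystem (fun n => mspan (P n))).
  - exact: unit_filtration_bottom.
  - by case: PF.
  - by move=> n; have := qP n; case: (q n) => -[l e mu] [].
  - by move=> n; have := qP n; case: (q n) => -[l e mu] [].
  - by move=> n; have := qP n; case: (q n) => -[l e mu] [].
  - by move=> n; have := qP n; case: (q n) => -[l e mu] [].
  - exact: unit_filtration_generating.
by move=> t n; have := qP n; case: (q n) => -[l e mu] [].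
Qed.

(** [f] and [g] are the units E_ab (x) 1 and 1 (x) E_cd, written as partial sums of h. *)
Lemma munits_split (I J : finType) (h : I * J -> I * J -> A) : munits h ->
  exists (f : I -> I -> A) (g : J -> J -> A),
    [/\ munits f, munits g, forall a b c d, f a b * g c d = h (a, c) (b, d)
      & forall a b c d, g c d * f a b = h (a, c) (b, d)].
Proof.
move=> hM.
pose f a b := \sum_c h (a, c) (b, c); pose g c d := \sum_a h (a, c) (a, d).
have fg a b c d : f a b * g c d = h (a, c) (b, d).
  rewrite /f mulr_suml (bigD1 c) //= [X in _ + X]big1 ?addr0 => [|j jc].
    rewrite /g mulr_sumr (bigD1 b) //= [X in _ + X]big1 ?addr0 => [|i ib].
      by rewrite (muME hM).
    by rewrite (muM hM) xpair_eqE eq_sym (negPf ib).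
  rewrite /g mulr_sumr big1 // => i _.
  by rewrite (muM hM) xpair_eqE (negPf jc) andbF.
have gf a b c d : g c d * f a b = h (a, c) (b, d).
  rewrite /g mulr_suml (bigD1 a) //= [X in _ + X]big1 ?addr0 => [|i ia].
    rewrite /f mulr_sumr (bigD1 d) //= [X in _ + X]big1 ?addr0 => [|j jd].
      by rewrite (muME hM).
    by rewrite (muM hM) xpair_eqE eq_sym (negPf jd) andbF.
  rewrite /f mulr_sumr big1 // => j _.
  by rewrite (muM hM) xpair_eqE (negPf ia).
have h1 : \sum_i \sum_j h (i, j) (i, j) = 1.
  rewrite -(mu_sum hM) (pair_bigA _ (fun i j => h (i, j) (i, j))) /=.
  by apply: eq_bigr => -[].
exists f, g; split=> //.
- split=> [a b c d|a b|]; last exact: h1.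
    rewrite {1}/f mulr_suml.
    have -> : f a d *+ (b == c) = \sum_j h (a, j) (d, j) *+ (b == c) by rewrite -sumrMnl.
    apply: eq_bigr => j _; rewrite /f mulr_sumr (bigD1 j) //= [X in _ + X]big1 ?addr0 => [|l lj].
      by rewrite (muM hM) xpair_eqE eqxx andbT.
    by rewrite (muM hM) xpair_eqE [j == l]eq_sym (negPf lj) andbF.
  by rewrite /f star_sum; apply: eq_bigr => j _; rewrite (mu_star hM).
- split=> [a b c d|a b|]; last by rewrite /g exchange_big.
    rewrite {1}/g mulr_suml.
    have -> : g a d *+ (b == c) = \sum_i h (i, a) (i, d) *+ (b == c) by rewrite -sumrMnl.
    apply: eq_bigr => j _; rewrite /g mulr_sumr (bigD1 j) //= [X in _ + X]big1 ?addr0 => [|l lj].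
      by rewrite (muM hM) xpair_eqE eqxx.
    by rewrite (muM hM) xpair_eqE [j == l]eq_sym (negPf lj).
  by rewrite /g star_sum; apply: eq_bigr => j _; rewrite (mu_star hM).
Qed.

Definition unit_size (k : nat) : Prop := exists n, (k %| p n)%N.

(* The filtration is thinned to P (N j) so that size (typ j) divides the size
   p (N j.+1) / p (N j) of the relative commutant, which then splits in two. *)
Lemma prescribed_usystem (typ : nat -> seq rat) :
  (forall j, unit_size (size (typ j))) ->
  (forall k l, unit_size k -> unit_size l -> unit_size (k * l)) ->
  exists (typ' : nat -> seq rat) (e : nat -> nat -> nat -> A),
    [/\ usystem (fun j => size (typ' j)) e, forall j, typ' j.*2 = typ j
      & forall j, unit_size (size (typ' j))].
Proof.
move=> typK KM; have [p0 PM PS _] := PF.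
have p_gt0 n : (0 < p n)%N.
  have [a _] := mu_inh (PM n); exact: leq_ltn_trans (leq0n a) (ltn_ord a).
have p_dvd n m : (n <= m)%N -> (p n %| p m)%N.
  by move=> /unit_filtration_commutant[l [h [_ _ _ [lE _ _]]]]; rewrite -lE dvdn_mulr.
(* Besides the divisibility, g moves to a strictly later level, so that the thinned filtration
   remains cofinal. *)
have /choice[g gP] : forall q : nat * nat, exists n',
    (q.1 < n')%N /\ (p q.1 * size (typ q.2) %| p n')%N.
  move=> [n j] /=; have [|m hm] := KM (p n) (size (typ j)) _ (typK j); first by exists n.
  exists (maxn m n.+1); rewrite leq_maxr; split=> //.
  by apply: dvdn_trans hm _; apply: p_dvd; exact: leq_maxl.
pose N := fix N j := if j is i.+1 then g (N i, i) else 0%N.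
have NS j : (N j < N j.+1)%N by case: (gP (N j, j)).
have Nd j : (p (N j) * size (typ j) %| p (N j.+1))%N by case: (gP (N j, j)).
have Nge j : (j <= N j)%N.
  by elim: j => // j IH; exact: leq_ltn_trans IH (NS j).
have step j : exists q : nat * (nat -> nat -> A) * (nat -> nat -> A),
    let: (r, f1, f2) := q in
    [/\ munits (@ounits R A (size (typ j)) f1) /\ munits (@ounits R A r f2), unit_size r,
        (forall a b : 'I_(size (typ j)), mspan (P (N j.+1)) (f1 a b)) /\
        (forall a b : 'I_r, mspan (P (N j.+1)) (f2 a b)),
        forall x, mspan (P (N j)) x ->
          (forall a b : 'I_(size (typ j)), x * f1 a b = f1 a b * x) /\
          (forall a b : 'I_r, x * f2 a b = f2 a b * x)
      & (forall (a b : 'I_(size (typ j))) (c d : 'I_r), f1 a b * f2 c d = f2 c d * f1 a b) /\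
        forall S, closed_subalgebra S -> mspan (P (N j)) `<=` S ->
          (forall a b : 'I_(size (typ j)), S (f1 a b)) ->
          (forall a b : 'I_r, S (f2 a b)) -> mspan (P (N j.+1)) `<=` S].
  have [l [h [hM hP hC [lE full char]]]] := unit_filtration_commutant (ltnW (NS j)).
  have : (size (typ j) %| l)%N by have := Nd j; rewrite -lE dvdn_pmul2l.
  case/dvdnP => r lr.
  have cE : #|{: 'I_(size (typ j)) * 'I_r}| = l by rewrite card_prod !card_ord lr mulnC.
  pose rho (x : 'I_(size (typ j)) * 'I_r) : 'I_l := cast_ord cE (enum_rank x).
  have rhoB : bijective rho.
    exists (fun i => enum_val (cast_ord (esym cE) i)) => x; rewrite /rho.
      by rewrite cast_ordK enum_rankK.
    by rewrite enum_valK cast_ordKV.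
  have [F1 [F2 [F1M F2M F12 F21]]] := munits_split (munits_reindex rhoB hM).
  have [f1 f1E] := nat_units F1; have [f2 f2E] := nat_units F2.
  have f1Q (a b : 'I_(size (typ j))) : f1 a b = F1 a b by rewrite -f1E.
  have f2Q (a b : 'I_r) : f2 a b = F2 a b by rewrite -f2E.
  have F1E a b : F1 a b = \sum_c h (rho (a, c)) (rho (b, c)).
    by rewrite -[LHS]mulr1 -(mu_sum F2M) mulr_sumr; apply: eq_bigr => c _; rewrite F12.
  have F2E c d : F2 c d = \sum_a h (rho (a, c)) (rho (a, d)).
    by rewrite -[LHS]mul1r -(mu_sum F1M) mulr_suml; apply: eq_bigr => a _; rewrite F12.
  have sumC (J : finType) (u : J -> A) x : (forall i, x * u i = u i * x) ->
      x * (\sum_i u i) = (\sum_i u i) * x.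
    by move=> h0; rewrite mulr_sumr mulr_suml; exact: eq_bigr.
  exists (r, f1, f2); split.
  - by rewrite f1E f2E.
  - exists (N j.+1); rewrite -lE lr mulnCA; exact: dvdn_mulr.
  - by split=> a b; rewrite ?f1Q ?f2Q ?F1E ?F2E; apply: mspan_sum => c _.
  - move=> x Px; split=> a b; rewrite ?f1Q ?f2Q ?F1E ?F2E; apply: sumC => i; exact: hC.
  - split=> [a b c d|S SP PSub S1 S2]; first by rewrite f1Q f2Q F12 F21.
    apply: subset_trans full _; apply: mspan_mprod_csub => // a b.
      by apply: PSub; exact: mspan_unit.
    have [rho' rK rK'] := rhoB; rewrite -[a]rK' -[b]rK'.
    case: (rho' a) (rho' b) => [a1 a2] [b1 b2]; rewrite -F12 -f1Q -f2Q.
    by apply: csubM.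
have /choice[q qP] := step.
have oddS i : i.+1./2 = (odd i + i./2)%N by rewrite -uphalfE uphalf_half.
pose r j := (q j).1.1; pose f1 j := (q j).1.2; pose f2 j := (q j).2.
have {}qP j := qP j.
(* A type is a list of labels whose length is the size of the factor. The complementary factors, at
   odd places, receive lists of zeros. *)
exists (fun i => if odd i then nseq (r i./2) 0 else typ i./2).
exists (fun i => if odd i then f2 i./2 else f1 i./2).
split; last 2 first.
- by move=> j; rewrite odd_double doubleK.
- move=> j; case: ifP => _ //; rewrite size_nseq.
  by have := qP j./2; rewrite /r; case: (q j./2) => -[r' f1' f2'] [].
(* Between two consecutive thinned levels the chain inserts the lower one multiplied by the factor
   of prescribed type. *)
apply: (@chain_usystem (fun i => if odd i
   then mspan (mprod (P (N i./2)) (@ounits R A (size (typ i./2)) (f1 i./2)))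
   else mspan (P (N i./2)))).
- exact: unit_filtration_bottom.
- move=> i; rewrite oddS /=; have := qP i./2; rewrite /f1; case: (odd i) => /=;
    case: (q i./2) => -[r' f1' f2'] /= [[h1 h2] h3 [h4 h5] h6 [h7 h8]].
    apply: mspan_sub => // a b; apply: (mspanM (PM _)); last exact: h4.
    by apply: (unit_filtration_mono PF (ltnW (NS _))); exact: mspan_unit.
  apply: mspan_sub => [|a b].
    apply: munits_prod => // a b c d; apply/esym; apply: (proj1 (h6 _ _)); exact: mspan_unit.
  rewrite -[P _ a b]mulr1 -(mu_sum h1) mulr_sumr; apply: mspan_sum => c _.
  exact: (mspan_unit (mprod (P (N i./2)) (@ounits R A _ f1')) (a, c) (b, c)).
- move=> i; have := qP i./2; rewrite /f1 /f2 /r; case: (odd i) => /=; rewrite ?size_nseq;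
    by case: (q i./2) => -[r' f1' f2'] /= [[h1 h2] h3 [h4 h5] h6 [h7 h8]].
- move=> i; rewrite oddS /=; have := qP i./2; rewrite /f1 /f2 /r; case: (odd i) => /=;
    rewrite ?size_nseq; case: (q i./2) => -[r' f1' f2'] /= [[h1 h2] h3 [h4 h5] h6 [h7 h8]].
    exact: h5.
  move=> a b; rewrite -[f1' a b]mul1r -(mu_sum (PM (N i./2))) mulr_suml.
  apply: mspan_sum => c _.
  exact: (mspan_unit (mprod (P (N i./2)) (@ounits R A _ f1')) (c, a) (c, b)).
- move=> i; have := qP i./2; rewrite /f1 /f2 /r; case: (odd i) => /=;
    rewrite ?size_nseq; case: (q i./2) => -[r' f1' f2'] /= [[h1 h2] h3 [h4 h5] h6 [h7 h8]].
    move=> a b _ [c ->]; rewrite mulr_suml mulr_sumr; apply: eq_bigr => i1 _.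
    rewrite mulr_suml mulr_sumr; apply: eq_bigr => i2 _.
    rewrite -scalerAl -scalerAr; congr (_ *: _); rewrite /mprod /ounits -mulrA h7 !mulrA.
    by congr (_ * _); apply: (proj2 (h6 _ _)); exact: mspan_unit.
  by move=> a b x /h6[].
- move=> i S SP; rewrite oddS /=; have := qP i./2; rewrite /f1 /f2 /r; case: (odd i) => /=;
    rewrite ?size_nseq; case: (q i./2) => -[r' f1' f2'] /= [[h1 h2] h3 [h4 h5] h6 [h7 h8]].
    move=> BS Se; apply: h8 => //.
      apply: subset_trans BS; apply: mspan_sub => [|a b].
        apply: munits_prod => // a b c d; apply/esym; apply: (proj1 (h6 _ _)); exact: mspan_unit.
      rewrite -[P _ a b]mulr1 -(mu_sum h1) mulr_sumr; apply: mspan_sum => c _.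
      exact: (mspan_unit (mprod (P (N i./2)) (@ounits R A _ f1')) (a, c) (b, c)).
    move=> a b; apply: BS; rewrite -[f1' a b]mul1r -(mu_sum (PM (N i./2))) mulr_suml.
    apply: mspan_sum => c _.
    exact: (mspan_unit (mprod (P (N i./2)) (@ounits R A _ f1')) (c, a) (c, b)).
  move=> BS Se; apply: mspan_mprod_csub => // a b; apply: BS; exact: mspan_unit.
move=> S SP BS x; apply: (unit_filtration_generating SP) => y [n _ Py]; apply: BS.
exists n.*2 => //; rewrite odd_double doubleK.
exact: (unit_filtration_mono PF (Nge n)).
Qed.

End Chains.

(** * Matching tensor factors *)

Section Matching.
Variable T : eqType.
Implicit Types f : nat -> T.

Let occ f s m := count (fun i => f i == s) (iota 0 m).

Let occS f s m : occ f s m.+1 = (occ f s m + (f m == s))%N.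
Proof. by rewrite /occ -addn1 iotaD count_cat /= addn0 add0n. Qed.

Let occ_mono f s m n : (m <= n)%N -> (occ f s m <= occ f s n)%N.
Proof.
move=> /subnK <-; elim: (n - m)%N => [//|d IH]; rewrite addSn occS.
exact: leq_trans IH (leq_addr _ _).
Qed.

Let occ_ex f s n : (forall m, exists2 i, (m <= i)%N & f i = s) ->
  exists2 j, f j = s & occ f s j = n.
Proof.
move=> fs; have ex : exists m, (n < occ f s m)%N.
  elim: n => [|n [m hm]].
    by have [i _ fi] := fs 0%N; exists i.+1; rewrite occS fi eqxx addn1.
  have [i mi fi] := fs m; exists i.+1; rewrite occS fi eqxx addn1 ltnS.
  exact: leq_trans hm (occ_mono _ _ mi).
case: (ex_minnP ex) => -[|m]; first by rewrite /occ.
rewrite occS => hm hmin.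
have le : (occ f s m <= n)%N.
  by rewrite leqNgt; apply/negP => /hmin; rewrite ltnn.
exists m; last first.
  by apply/eqP; rewrite eqn_leq le /= -ltnS; apply: leq_trans hm _; rewrite -addn1 leq_add2l leq_b1.
by apply/eqP; move: hm; case: eqP => //; rewrite addn0 ltnNge le.
Qed.

Let occ_uniq f s i j : f i = s -> f j = s -> occ f s i = occ f s j -> i = j.
Proof.
suff h i' j' : f i' = s -> (i' < j')%N -> (occ f s i' < occ f s j')%N.
  move=> fi fj; case: (ltngtP i j) => [/(h _ _ fi)|/(h _ _ fj)|//].
    by move=> + e; rewrite e ltnn.
  by move=> + e; rewrite e ltnn.
by move=> fi ij; apply: leq_trans (occ_mono f s ij); rewrite occS fi eqxx addn1.
Qed.

(** The n-th occurrence of s in f is sent to the n-th occurrence of s in g. *)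
Lemma infinite_multiplicity_matching (V : T -> Prop) (f g : nat -> T) :
  (forall i, V (f i)) -> (forall i, V (g i)) ->
  (forall s, V s -> forall m, exists2 i, (m <= i)%N & f i = s) ->
  (forall s, V s -> forall m, exists2 i, (m <= i)%N & g i = s) ->
  exists2 sigma : nat -> nat, bijective sigma & forall i, g (sigma i) = f i.
Proof.
move=> fV gV fI gI.
have /choice[s sP] : forall i, exists j, g j = f i /\ occ g (f i) j = occ f (f i) i.
  by move=> i; have [j h1 h2] := occ_ex (occ f (f i) i) (gI _ (fV i)); exists j.
have /choice[s' s'P] : forall j, exists i, f i = g j /\ occ f (g j) i = occ g (g j) j.
  by move=> j; have [i h1 h2] := occ_ex (occ g (g j) j) (fI _ (gV j)); exists i.
exists s; last by move=> i; case: (sP i).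
exists s' => [i|j].
  have [h1 h2] := sP i; have [h3 h4] := s'P (s i).
  by apply: (@occ_uniq f (f i)) => //; rewrite ?h3 // -h1 h4 h1 h2.
have [h1 h2] := s'P j; have [h3 h4] := sP (s' j).
by apply: (@occ_uniq g (g j)) => //; rewrite ?h3 // -h1 h4 h1 h2.
Qed.

End Matching.

Lemma injective_unbounded (f : nat -> nat) : injective f ->
  forall m, exists n, (m <= f n)%N.
Proof.
move=> fI m; apply/not_existsP => h.
have lt n : (f n < m)%N by rewrite ltnNge; apply/negP/h.
pose g (i : 'I_m.+1) : 'I_m := Ordinal (lt i).
have gI : injective g by move=> i j [] /fI /val_inj.
by have := leq_card g gI; rewrite !card_ord ltnn.
Qed.

Lemma rational_approximation (R : realType) (x r : R) : 0 < r ->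
  exists q : rat, `|x - ratr q| <= r.
Proof.
move=> r0; have [|q] := @rat_in_itvoo R (x - r) (x + r); first by lra.
rewrite in_itv /= => /andP[h1 h2]; exists q.
by rewrite ler_norml; apply/andP; split; lra.
Qed.

(** * Tensor products of factorised algebras *)

Section Tensor.
Variables (R : realType) (A B : cstarAlgType R) (AB : cstar_tensor A B).

Lemma tensor_left_morphism : star_morphism (fun a => tensor AB a 1).
Proof.
split; first exact: tensor_linearl.
  by split=> [|a a']; [exact: tensor1|rewrite -tensorM mulr1].
by move=> a; rewrite -tensor_star star1.
Qed.

Lemma tensor_right_morphism : star_morphism (fun b => tensor AB 1 b).
Proof.
split; first exact: tensor_linearr.
  by split=> [|a a']; [exact: tensor1|rewrite -tensorM mulr1].
by move=> a; rewrite -tensor_star star1.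
Qed.

Lemma tensorE a b : tensor AB a b = tensor AB a 1 * tensor AB 1 b.
Proof. by rewrite -tensorM mulr1 mul1r. Qed.

Lemma tensor_comm a b : tensor AB a 1 * tensor AB 1 b = tensor AB 1 b * tensor AB a 1.
Proof. by rewrite -!tensorM !mulr1 !mul1r. Qed.

Lemma tensor_generating (X : set A) (Y : set B) (Z : set AB) :
  generating X -> generating Y ->
  (forall a, X a -> Z (tensor AB a 1)) -> (forall b, Y b -> Z (tensor AB 1 b)) ->
  generating Z.
Proof.
move=> XG YG XZ YZ S SP ZS.
have SA a : S (tensor AB a 1).
  have := XG _ (preimage_closed_subalgebra tensor_left_morphism SP); apply.
  by move=> a' /XZ /ZS.
have SB b : S (tensor AB 1 b).
  have := YG _ (preimage_closed_subalgebra tensor_right_morphism SP); apply.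
  by move=> b' /YZ /ZS.
move=> x; have [_ _ _ ScL] := SP; apply: ScL => r r0.
have : closure [set x | exists (n : nat) (a : 'I_n -> A) (b : 'I_n -> B),
  x = \sum_(i < n) tensor AB (a i) (b i)] x by rewrite tensor_dense.
move/closureP => /(_ r r0)[y [n [a [b ->]]] xy]; exists (\sum_(i < n) tensor AB (a i) (b i)) => //.
by apply: csub_sum => // i _; rewrite tensorE; exact: csubM.
Qed.

Lemma tensor_flow_of_generators (alpha : R -> A -> A) (beta : R -> B -> B)
    (tau : R -> AB -> AB) (X : set A) (Y : set B) :
  flow alpha -> flow beta -> flow tau -> generating X -> generating Y ->
  (forall t a, X a -> tau t (tensor AB a 1) = tensor AB (alpha t a) 1) ->
  (forall t b, Y b -> tau t (tensor AB 1 b) = tensor AB 1 (beta t b)) ->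
  tensor_flow alpha beta tau.
Proof.
move=> [aI _ _ _] [bI _ _ _] tF XG YG hX hY; split=> // t a b.
have [tI _ _ _] := tF.
have aM : star_morphism (alpha t) by case: (aI t).
have bM : star_morphism (beta t) by case: (bI t).
have tM : star_morphism (tau t) by case: (tI t).
have hA : forall a, tau t (tensor AB a 1) = tensor AB (alpha t a) 1.
  apply: (star_morphism_eq (star_morphism_comp tensor_left_morphism tM)
    (star_morphism_comp aM tensor_left_morphism) XG) => a' /=; exact: hX.
have hB : forall b, tau t (tensor AB 1 b) = tensor AB 1 (beta t b).
  apply: (star_morphism_eq (star_morphism_comp tensor_right_morphism tM)
    (star_morphism_comp bM tensor_right_morphism) YG) => b' /=; exact: hY.
by rewrite tensorE (smM tM) hA hB -tensorE.
Qed.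

Lemma tensor_usystem (k l : nat -> nat) (e : nat -> nat -> nat -> A)
    (f : nat -> nat -> nat -> B) :
  usystem k e -> usystem l f ->
  usystem (fun i => if odd i then l i./2 else k i./2)
    (fun i a b => if odd i then tensor AB 1 (f i./2 a b) else tensor AB (e i./2 a b) 1).
Proof.
move=> [eM eC eG] [fM fC fG]; split.
- move=> i; rewrite /ounits; case: (odd i).
    exact: (star_morphism_munits tensor_right_morphism (fM i./2)).
  exact: (star_morphism_munits tensor_left_morphism (eM i./2)).
- move=> i j; have [ij|] := eqVneq i./2 j./2; last first.
    case: (odd i) (odd j) => -[] ij a b c d _.
    + by rewrite -!tensorM fC.
    + by rewrite tensor_comm.
    + by rewrite tensor_comm.
    + by rewrite -!tensorM eC.
  have : i != j -> odd i != odd j.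
    by apply: contra_neq => h; rewrite -(odd_double_half i) -(odd_double_half j) h ij.
  case: (odd i) (odd j) => -[] h a b c d /h // _.
    by rewrite tensor_comm.
  by rewrite tensor_comm.
apply: (tensor_generating eG fG) => _ [j [a [b ->]]].
  by exists j.*2; rewrite odd_double doubleK; exists a, b.
exists j.*2.+1; rewrite /= odd_double /= uphalf_double; by exists a, b.
Qed.

End Tensor.

Lemma usystem_reindex (R : realType) (A : cstarAlgType R) (k : nat -> nat)
    (e : nat -> nat -> nat -> A) (s : nat -> nat) :
  bijective s -> usystem k e -> usystem (fun i => k (s i)) (fun i => e (s i)).
Proof.
move=> [s' sK s'K] [eM eC eG]; split.
- by move=> j; exact: eM.
- by move=> i j a b c d ij; apply: eC; apply: contra_neq ij; exact: (can_inj sK).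
move=> S SP h; apply: eG => // x [j].
have := s'K j; move: (s' j) => i <- [a [b ->]]; apply: h.
by exists i, a, b.
Qed.

Theorem proposition3p1 (R : realType) (A : cstarAlgType R)
    (A_UHF : UHF A)
    (AA : cstar_tensor A A)
    (AA_iso_A : star_isomorphic AA A) :
  exists gamma : R -> A -> A, universal_UHF_flow AA gamma.
Proof.
have [An AnF] := A_UHF; have [p [P [PF _]]] := matrix_filtration_units AnF.
have [_ PM _ _] := PF; have [Phi [PhiM _]] := AA_iso_A.
(* The isomorphism carries units of the two legs of A (x) A to commuting units of A, whose product
   system has size [p n * p m]. *)
have KM k l : unit_size p k -> unit_size p l -> unit_size p (k * l).
  move=> [n kn] [m lm].
  have eM := star_morphism_munits PhiM (star_morphism_munits (tensor_left_morphism AA) (PM n)).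
  have fM := star_morphism_munits PhiM (star_morphism_munits (tensor_right_morphism AA) (PM m)).
  have [|q] := munits_card_dvd PF (munits_prod eM fM _).
    by move=> a b c d; rewrite -!(smM PhiM) tensor_comm.
  by rewrite card_prod !card_ord => h; exists q; apply: dvdn_trans h; exact: dvdn_mul.
pose V (s : seq rat) := unit_size p (size s).
pose typ0 j : seq rat := if @unpickle (nat * seq rat)%type j is Some (_, s) then
  if `[< V s >] then s else [:: 0] else [:: 0].
have V0 : V [:: 0] by exists 0%N.
have typ0V j : V (typ0 j).
  by rewrite /typ0; case: unpickle => [[_ s]|//]; case: ifP => // /asboolP.
have typ0I s : V s -> forall m, exists2 i, (m <= i)%N & typ0 i = s.
  move=> Vs m; have [|n mn] := @injective_unbounded (fun n => pickle (n, s)) _ m.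
    by move=> i j /(pcan_inj pickleK) [].
  by exists (pickle (n, s)); rewrite // /typ0 pickleK asboolT.
have [typ [e [eP typE typV]]] := prescribed_usystem PF typ0V KM.
have typI s : V s -> forall m, exists2 i, (m <= i)%N & typ i = s.
  move=> Vs m; have [i mi <-] := typ0I _ Vs m; exists i.*2; last exact: typE.
  by apply: leq_trans mi _; rewrite -addnn leq_addr.
pose lam (s : seq rat) a : R := ratr (nth 0 s a).
have [gam [gamF gamL]] := labelled_flow_exists eP (fun j => lam (typ j)).
exists gam; split; first exact: (labelled_UHF_flow eP gamF gamL).
move=> al [alF [Bn [BnF Bninv]]].
have [p' [P' [P'F P'E]]] := matrix_filtration_units BnF.
have [alI _ _ _] := alF; have alM t : star_morphism (al t) by case: (alI t).
have [k' [g [mu [gP gL]]]] : exists k e nu, usystem k e /\ labelled k e nu al.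
  apply: (invariant_filtration_labelled P'F alF) => n t x.
  (* Level 0 is the inserted copy of the scalars, which the flow fixes; every other level belongs to
     the invariant filtration. *)
  case: (P'E n) => [->|[m ->]]; last by rewrite -{2}(Bninv m t) => Bx; exists x.
  have [p0 P'M _ _] := P'F; have := P'M 0%N; move: (P' 0%N); rewrite p0 => Q QM [c ->].
  rewrite (star_morphism_lin _ _ (alM t)); exists c; congr lin.
  apply/funext => a; apply/funext => b; rewrite !ord1.
  by have := mu_sum QM; rewrite big_ord1 => ->; rewrite (sm1 (alM t)).
have [gM _ gG] := gP; have [_ _ eG] := eP.
(* Units from the filtration of alpha are measured against the filtration that defines gamma. *)
have k'V j : unit_size p (k' j).
  by have [n] := munits_card_dvd PF (gM j); rewrite card_ord; exists n.
have /choice[s sP] : forall j, exists s : seq rat, size s = k' j /\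
    \sum_(a < k' j) `|mu j a - lam s a| <= (2^-1 : R) ^+ (j.*2.+1).
  (* Factor j of alpha will stand at place 2j + 1 of the factorisation of A (x) A, where the cocycle
     argument allows a total error of 2^-(2j+1), here shared among the [k' j] labels. *)
  move=> j; pose r : R := (2^-1) ^+ (j.*2.+1) / (k' j).+1%:R.
  have r0 : 0 < r by rewrite divr_gt0 // exprn_gt0 // invr_gt0.
  have /choice[q qP] : forall a, exists q : rat, `|mu j a - ratr q| <= r.
    by move=> a; exact: rational_approximation.
  exists (mkseq q (k' j)); split; first by rewrite size_mkseq.
  apply: (@le_trans _ _ (\sum_(a < k' j) r)).
    by apply: ler_sum => a _; rewrite /lam nth_mkseq.
  rewrite sumr_const card_ord -[_ *+ _]mulr_natr /r mulrAC ler_pdivrMr ?ltr0n //.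
  by rewrite ler_wpM2l ?exprn_ge0 ?invr_ge0 // ler_nat.
pose typA i := if odd i then s i./2 else typ i./2.
have sizeA : (fun i => size (typA i)) = (fun i => if odd i then k' i./2 else size (typ i./2)).
  by apply/funext => i; rewrite /typA; case: (odd i) => //; case: (sP i./2).
pose F i a b : AA := if odd i then tensor AA 1 (g i./2 a b) else tensor AA (e i./2 a b) 1.
have FP : usystem (fun i => size (typA i)) F by rewrite sizeA; exact: tensor_usystem eP gP.
pose nu i a := if odd i then mu i./2 a else lam (typ i./2) a.
(* [tau] will be gamma (x) alpha itself; [tau'] replaces the labels of alpha by rational ones and
   leaves those of gamma unchanged. *)
have [tau [tauF tauL]] := labelled_flow_exists FP nu.
have [tau' [tau'F tau'L]] := labelled_flow_exists FP (fun i => lam (typA i)).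
exists tau; split.
  apply: (tensor_flow_of_generators gamF alF tauF eG gG) => t _ [j [a [b ->]]].
    have := tauL t j.*2; rewrite /F /nu /typA /= odd_double doubleK => /(_ a b) ->.
    by rewrite gamL (smZ (tensor_left_morphism AA)).
  have := tauL t j.*2.+1; rewrite /F /nu /typA /= odd_double /= uphalf_double.
  have [-> _] := sP j; move=> /(_ a b) ->.
  by rewrite gL (smZ (tensor_right_morphism AA)).
have [sg sgB sgE] : exists2 sg : nat -> nat, bijective sg & forall i, typ (sg i) = typA i.
  apply: (@infinite_multiplicity_matching _ V) => //.
    by move=> i; rewrite /typA /V; case: (odd i) => //; case: (sP i./2) => ->.
  move=> s0 Vs m; have [i mi <-] := typI _ Vs m; exists i.*2.
    by apply: leq_trans mi _; rewrite -addnn leq_addr.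
  by rewrite /typA odd_double doubleK.
have eP' := usystem_reindex sgB eP.
have kE : (fun i => size (typ (sg i))) = (fun i => size (typA i)).
  by apply/funext => i; rewrite sgE.
rewrite kE in eP'.
have [phi [psi [phiI phiK psiK phiE]]] := usystem_isomorphism FP eP'.
exists phi, psi; split=> //.
(* Matching factors of equal type identifies the transported gamma with [tau'] exactly; only the
   passage between [tau] and [tau'] costs a cocycle. *)
suff -> : (fun t x => psi (gam t (phi x))) = tau'.
  apply: (labelled_cocycle_perturbation FP tauF tauL tau'F tau'L) => i.
  rewrite /nu /typA; case: (boolP (odd i)) => io; last first.
    by rewrite big1 ?exprn_ge0 ?invr_ge0 // => a _; rewrite subrr normr0.
  have [sz sle] := sP i./2; rewrite sz; apply: le_trans sle _.
  by rewrite -{2}(odd_double_half i) io.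
apply/funext => t; apply/funext.
have [gI _ _ _] := gamF; have gamM : star_morphism (gam t) by case: (gI t).
have [t'I _ _ _] := tau'F; have t'M : star_morphism (tau' t) by case: (t'I t).
have [psiM _] := star_isomorphism_inv phiI phiK psiK; have [phiM _] := phiI.
have [_ _ FG] := FP.
apply: (star_morphism_eq (star_morphism_comp (star_morphism_comp phiM gamM) psiM) t'M FG).
move=> _ [j [a [b ->]]] /=; rewrite tau'L phiE.
have h := gamL t (sg j); rewrite sgE in h.
by rewrite h (smZ psiM) -phiE phiK.
Qed.
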